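(* The \textsc{Linked Planar 3-SAT} problem remains NP-complete even if all clauses are monotone.
   Context: A CNF formula $\phi$ has variable set $V$ and clause set $C$. Its incidence graph $G_\phi$ has vertex set $C \cup V$ and an edge between a variable $v$ and a clause $c$ if and only if $v$ occurs in $c$ (negated or unnegated); there are no other edges. A clause is monotone if it contains either only negated literals or only unnegated literals. \textsc{Linked Planar 3-SAT}: the input is a CNF formula $\phi$ with at most three variables per clause, its incidence graph $G_\phi = (C\cup V, E)$, and a Hamiltonian cycle $\kappa$ on $C \cup V$ that first visits all elements of $C$ and then all elements of $V$, such that the union of $G_\phi$ and $\kappa$ is a planar graph. The question is whether $\phi$ is satisfiable. *)

(* Defs.v *)
From HB Require Import structures.
From mathcomp Require Import all_boot all_order all_algebra.
From mathcomp Require Import all_classical all_reals all_analysis.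

Set Implicit Arguments.
Unset Strict Implicit.
Unset Printing Implicit Defensive.

Import Order.TTheory GRing.Theory Num.Theory.
Import numFieldNormedType.Exports.

(** * Turing machines, NP, polynomial-time reductions *)

(* A two-way infinite tape over the alphabet [S]; [None] is the blank.  The
   cells left of the head are listed from the head outwards, and every cell not
   listed is blank. *)
Record tape (S : Type) := Tape {
  tleft : seq (option S);
  thead : option S;
  tright : seq (option S) }.

Variant move := MoveLeft | MoveStay | MoveRight.

Definition move_code (m : move) : option bool :=
  match m with
  | MoveLeft => Some false | MoveStay => None | MoveRight => Some true
  end.

Definition move_decode (o : option bool) : move :=
  match o with
  | Some false => MoveLeft | None => MoveStay | Some true => MoveRight
  end.

Lemma move_codeK : cancel move_code move_decode.
Proof. by case. Qed.

HB.instance Definition _ := Finite.copy move (can_type move_codeK).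

Definition tape_act (S : Type) (t : tape S) (a : option S * move) : tape S :=
  match a.2 with
  | MoveLeft => Tape (behead (tleft t)) (head None (tleft t)) (a.1 :: tright t)
  | MoveStay => Tape (tleft t) a.1 (tright t)
  | MoveRight => Tape (a.1 :: tleft t) (head None (tright t)) (behead (tright t))
  end.

(* A nondeterministic multitape machine with input alphabet [bool] and tape
   alphabet [bool + tm_sym] plus the blank.  [tm_trans q r] holds the possible
   (next state, symbols written, head moves) in state [q] when [r] is read; the
   machine halts when this set is empty. *)
Record ntm := Ntm {
  tm_tapes : nat;
  tm_state : finType;
  tm_sym : finType;
  tm_start : tm_state;
  tm_accept : pred tm_state;
  tm_trans : tm_state ->
    {ffun 'I_tm_tapes.+1 -> option (bool + tm_sym)} ->
    {set tm_state * {ffun 'I_tm_tapes.+1 -> option (bool + tm_sym) * move}} }.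

Record config (M : ntm) := Config {
  cstate : tm_state M;
  ctapes : {ffun 'I_(tm_tapes M).+1 -> tape (bool + tm_sym M)} }.

Definition word_tape (G : Type) (w : seq bool) : tape (bool + G) :=
  let s := [seq Some (inl b) | b <- w] in
  Tape [::] (head None s) (behead s).

Definition init (M : ntm) (w : seq bool) : config M :=
  Config (tm_start M)
    [ffun i => if i == ord0 then word_tape (tm_sym M) w
               else word_tape (tm_sym M) [::]].

Definition step (M : ntm) (c d : config M) : Prop :=
  exists2 qa, qa \in tm_trans (cstate c) [ffun i => thead (ctapes c i)] &
    d = Config qa.1 [ffun i => tape_act (ctapes c i) (qa.2 i)].

Fixpoint reach (M : ntm) (n : nat) (c d : config M) : Prop :=
  if n is n'.+1 then exists2 c', step c c' & reach n' c' d else d = c.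

Definition halted (M : ntm) (c : config M) : Prop := forall d, ~ step c d.

Definition deterministic (M : ntm) : Prop :=
  forall q r, #|@tm_trans M q r| <= 1.

(* Every computation path on [w] halts within polynomially many steps. *)
Definition poly_time (M : ntm) : Prop :=
  exists a b k : nat, forall (w : seq bool) (n : nat) (c : config M),
    reach n (init M w) c -> n <= a * size w ^ k + b.

Fixpoint bit_prefix (G : Type) (s : seq (option (bool + G))) : seq bool :=
  if s is Some (inl b) :: s' then b :: bit_prefix s' else [::].

(* The output is the block of bits on the last tape that starts at the head. *)
Definition output (M : ntm) (c : config M) : seq bool :=
  let t := ctapes c ord_max in bit_prefix (thead t :: tright t).

Definition language := seq bool -> Prop.

Definition in_NP (L : language) : Prop :=
  exists2 M : ntm, poly_time M &
    forall w, L w <->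
      exists n c, [/\ reach n (init M w) c, halted c & tm_accept (cstate c)].

Definition poly_time_function (f : seq bool -> seq bool) : Prop :=
  exists M : ntm, [/\ deterministic M, poly_time M &
    forall w, exists n c,
      [/\ reach n (init M w) c, halted c & output c = f w]].

Definition poly_reducible (L L' : language) : Prop :=
  exists2 f, poly_time_function f & forall w, L w <-> L' (f w).

Definition NP_hard (L : language) : Prop :=
  forall L', in_NP L' -> poly_reducible L' L.

Definition NP_complete (L : language) : Prop := in_NP L /\ NP_hard L.

(** * Planar graphs *)

Section Planar.
Local Open Scope ring_scope.
Local Open Scope classical_set_scope.

(* A drawing of the simple graph [e] in the plane: vertices are distinct points
   and each edge [xy] is a simple arc [g x y] from [p x] to [p y], [g y x] being
   the same arc traversed backwards. *)
Definition plane_drawing (R : realType) (T : finType) (e : rel T)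
    (p : T -> R * R) (g : T -> T -> R -> R * R) : Prop :=
  [/\ injective p,
      forall x y, e x y ->
        [/\ {within `[0, 1], continuous (g x y)},
            {in `[0, 1] &, injective (g x y)},
            g x y 0 = p x, g x y 1 = p y &
            {in `[0, 1], forall t, g y x t = g x y (1 - t)}],
      forall x y z, e x y -> {in `]0, 1[, forall t, g x y t <> p z} &
      forall x y x' y', e x y -> e x' y' -> [set x; y]%SET <> [set x'; y']%SET ->
        {in `]0, 1[ &, forall s t, g x y s <> g x' y' t}].

Definition planar (R : realType) (T : finType) (e : rel T) : Prop :=
  exists p g, @plane_drawing R T e p g.

End Planar.

(** * CNF formulas and linked planar 3-SAT *)

(* The literal [(v, true)] is the unnegated variable [v], [(v, false)] its
   negation. *)
Definition literal (n : nat) := ('I_n * bool)%type.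

Record cnf := Cnf {
  nvars : nat;
  clauses : seq {set literal nvars};
  clauses_uniq : uniq clauses }.

Definition cvars (n : nat) (c : {set literal n}) : {set 'I_n} :=
  [set l.1 | l in c]%SET.

Definition satisfiable (phi : cnf) : Prop :=
  exists a : 'I_(nvars phi) -> bool,
    forall c, c \in clauses phi -> exists2 l, l \in c & a l.1 = l.2.

Definition monotone_clause (n : nat) (c : {set literal n}) : bool :=
  [forall l in c, l.2] || [forall l in c, ~~ l.2].

Definition monotone_cnf (phi : cnf) : bool :=
  all (@monotone_clause _) (clauses phi).

Definition three_cnf (phi : cnf) : bool :=
  all (fun c => #|cvars c| <= 3) (clauses phi).

(* Clauses and variables, in this order, are represented by their indices. *)
Definition vertex (phi : cnf) :=
  ('I_(size (clauses phi)) + 'I_(nvars phi))%type.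

Definition clause_of (phi : cnf) (i : 'I_(size (clauses phi))) :
  {set literal (nvars phi)} := tnth (in_tuple (clauses phi)) i.

Definition incidence (phi : cnf) : rel (vertex phi) := fun x y =>
  match x, y with
  | inl c, inr v | inr v, inl c => v \in cvars (clause_of c)
  | _, _ => false
  end.

(* [kappa] lists a Hamiltonian cycle on the vertices, clauses first. *)
Definition linking_cycle (phi : cnf) (kappa : seq (vertex phi)) : Prop :=
  [/\ 3 <= size kappa, uniq kappa, forall x, x \in kappa &
      exists cs vs, kappa = map inl cs ++ map inr vs].

Definition cycle_edge (T : eqType) (k : seq T) : rel T := fun x y =>
  [&& x \in k, y \in k & (next k x == y) || (next k y == x)].

Definition linked_graph (phi : cnf) (kappa : seq (vertex phi)) : rel (vertex phi) :=
  fun x y => incidence x y || cycle_edge kappa x y.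

(* Prefix-free binary encodings.  Indices are written in unary, which is
   polynomially equivalent to binary here since an instance lists all of its
   clauses and variables. *)
Definition enc_nat (n : nat) : seq bool := rcons (nseq n true) false.

Definition enc_seq (T : Type) (enc : T -> seq bool) (s : seq T) : seq bool :=
  foldr (fun x w => true :: enc x ++ w) [:: false] s.

Definition enc_literal (n : nat) (l : literal n) : seq bool :=
  l.2 :: enc_nat l.1.

Definition enc_clause (n : nat) (c : {set literal n}) : seq bool :=
  enc_seq (@enc_literal n) (enum c).

Definition enc_cnf (phi : cnf) : seq bool :=
  enc_nat (nvars phi) ++ enc_seq (@enc_clause (nvars phi)) (clauses phi).

Definition enc_edge (m n : nat) (cv : 'I_m * 'I_n) : seq bool :=
  enc_nat cv.1 ++ enc_nat cv.2.

(* The edge list of the incidence graph. *)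
Definition enc_incidence (phi : cnf) : seq bool :=
  enc_seq (@enc_edge _ _)
    (enum [pred cv : 'I_(size (clauses phi)) * 'I_(nvars phi) |
             @incidence phi (inl cv.1) (inr cv.2)]).

Definition enc_vertex (phi : cnf) (x : vertex phi) : seq bool :=
  match x with inl c => false :: enc_nat c | inr v => true :: enc_nat v end.

Definition enc_instance (phi : cnf) (kappa : seq (vertex phi)) : seq bool :=
  enc_cnf phi ++ enc_incidence phi ++ enc_seq (@enc_vertex phi) kappa.

Definition prefix_free (T : Type) (e : T -> seq bool) :=
  forall x y u v, e x ++ u = e y ++ v -> x = y /\ u = v.

Lemma prefix_free_nat : prefix_free enc_nat.
Proof.
elim=> [|n IH] [|m] u v //=; rewrite /enc_nat /= => -[]; first by [].
by move=> /IH [-> ->].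
Qed.

Lemma prefix_free_seq T (e : T -> seq bool) : prefix_free e -> prefix_free (enc_seq e).
Proof.
move=> pe; elim=> [|x s IH] [|y t] u v //=; first by case.
by move=> []; rewrite -!catA => /pe [-> /IH [-> ->]].
Qed.

Lemma prefix_free_lit n : prefix_free (@enc_literal n).
Proof.
by move=> [x b] [y c] u v /= [-> /prefix_free_nat [/ord_inj -> ->]].
Qed.

Lemma prefix_free_clause n : prefix_free (@enc_clause n).
Proof.
move=> c d u v /(prefix_free_seq (@prefix_free_lit n)) [E ->]; split=> //.
by apply/setP=> x; rewrite -!(mem_enum c) E mem_enum.
Qed.

Lemma prefix_free_vertex phi : prefix_free (@enc_vertex phi).
Proof.
by move=> [x|x] [y|y] u v //= [/prefix_free_nat [/ord_inj -> ->]].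
Qed.

Lemma enc_instance_inj (phi psi : cnf) k l :
  @enc_instance phi k = @enc_instance psi l ->
  existT (fun p => seq (vertex p)) phi k = existT (fun p => seq (vertex p)) psi l.
Proof.
case: phi k => n c uc k; case: psi l => m d ud l.
rewrite /enc_instance /enc_cnf /= -!catA => /prefix_free_nat [E]; subst m.
move=> /(prefix_free_seq (@prefix_free_clause n)) [E]; subst d.
rewrite (bool_irrelevance ud uc) in l *.
move/eqP; rewrite eqseq_cat // => /andP[_ /eqP].
move=> E; have := @prefix_free_seq _ _ (@prefix_free_vertex (Cnf uc)) k l [::] [::].
by rewrite !cats0 => /(_ E) [->].
Qed.

(* The encodings of the satisfiable instances whose formula satisfies
   [restr]. *)
Definition linked_planar_3SAT (R : realType) (restr : pred cnf) : language :=
  fun w => exists (phi : cnf) (kappa : seq (vertex phi)),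
    [/\ w = enc_instance kappa,
        three_cnf phi /\ restr phi,
        linking_cycle kappa,
        planar R (linked_graph kappa) &
        satisfiable phi].

(* Main.v *)
Require Import Defs.
From mathcomp Require Import all_boot all_order all_algebra.
From mathcomp Require Import all_classical all_reals all_analysis.
From mathcomp Require Import zify ring lra.
From Stdlib Require Import Btauto.
Import Defs.

Set Implicit Arguments.
Unset Strict Implicit.
Unset Printing Implicit Defensive.

(* In a linked graph every chord joins a clause to a variable, so two chords
   cross exactly when they are ordered alike on both parts of the cycle, and the
   graph is planar if and only if no three chords cross pairwise: three of them
   form a K33 with the cycle, and otherwise the chords that cross one preceding
   them go to one side of the cycle and the others to the other side.  Planarity
   is thus decidable in polynomial time, which gives membership in NP.

   For hardness, view the list of variables as a queue read from left to right.
   Each new variable is tied by a few monotone clauses to the variables at the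
   front of the queue and to the one pushed just before it.  Since both ends of
   the queue only move forward, listing the clauses backwards leaves no three
   crossing chords, whatever the queue program is.  NAND and NOR gates are
   monotone sets of clauses, and one extra gadget compensates for the parity of
   the number of negations, so that wires can be swapped; hence a queue program
   can sweep an accumulator over the variables of an arbitrary monotone CNF,
   clause after clause.  The tableau of a nondeterministic machine, with one
   variable for every value of every cell, is such a CNF: at-least-one clauses
   are positive and conflicts are negative. *)

(** * A stack language and its compilation to Turing machines *)

(** Complexity refers to concrete multitape machines, so polynomial time is proved down to machine
    steps: a stack language with one register per tape is compiled, and a calculus of closure
    properties then covers every function that occurs.

    Nonplanarity concerns arbitrary continuous arcs. No Jordan curve theorem is used: arcs of edges
    without a common end are disjoint and compact, hence a positive distance apart, and can be
    replaced by finite chains with steps shorter than half that gap. For [z] and [y] on two such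
    edges of K33 the vector [z - y] then stays away from 0; the parity of its crossings of a
    half-line, combined with the antisymmetry of [z - y], is contradictory modulo 2.

    The gadgets are shaped by monotonicity. Monotone clauses on [x] and [y] alone cannot express
    [x = y]: a positive one excludes that both are false, a negative one that both are true. They do
    express [y = ~~ x]. So an entry can be carried to the back of the queue only in negated form,
    and the parity of the number of turns has to be controlled throughout. *)

Inductive cmd :=
| Push of nat & bool
| Guess of nat
| Seq of cmd & cmd
| Case of nat & cmd & cmd & cmd
| While of nat & cmd & cmd.

Definition store := nat -> seq bool.

Definition upd (s : store) (r : nat) (v : seq bool) : store :=
  fun r' => if r' == r then v else s r'.

(* [exec o c t s t' s']: started at time [t] in store [s], [c] ends at time
   [t'] in store [s']; a bit guessed at time [t] is [o t]. *)
Inductive exec (o : nat -> bool) : cmd -> nat -> store -> nat -> store -> Prop :=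
| ExecPush r b t s : exec o (Push r b) t s t.+2 (upd s r (b :: s r))
| ExecGuess r t s : exec o (Guess r) t s t.+2 (upd s r (o t.+1 :: s r))
| ExecSeq c d t s t' s' t'' s'' :
    exec o c t s t' s' -> exec o d t' s' t'' s'' -> exec o (Seq c d) t s t'' s''
| ExecCaseNil r ce cf ct t s t' s' :
    s r = [::] -> exec o ce t.+1 s t' s' -> exec o (Case r ce cf ct) t s t'.+1 s'
| ExecCaseCons r ce cf ct b v t s t' s' :
    s r = b :: v -> exec o (if b then ct else cf) t.+1 (upd s r v) t' s' ->
    exec o (Case r ce cf ct) t s t'.+1 s'
| ExecWhileNil r cf ct t s : s r = [::] -> exec o (While r cf ct) t s t.+1 s
| ExecWhileCons r cf ct b v t s t' s' t'' s'' :
    s r = b :: v -> exec o (if b then ct else cf) t.+1 (upd s r v) t' s' ->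
    exec o (While r cf ct) t'.+1 s' t'' s'' ->
    exec o (While r cf ct) t s t'' s''.

Fixpoint guess_free (c : cmd) : bool :=
  match c with
  | Push _ _ => true
  | Guess _ => false
  | Seq c d => guess_free c && guess_free d
  | Case _ ce cf ct => [&& guess_free ce, guess_free cf & guess_free ct]
  | While _ cf ct => guess_free cf && guess_free ct
  end.

Fixpoint max_reg (c : cmd) : nat :=
  match c with
  | Push r _ | Guess r => r
  | Seq c d => maxn (max_reg c) (max_reg d)
  | Case r ce cf ct => maxn r (maxn (max_reg ce) (maxn (max_reg cf) (max_reg ct)))
  | While r cf ct => maxn r (maxn (max_reg cf) (max_reg ct))
  end.

Variant instr :=
| ILeft of nat
| IWrite of nat & bool
| IGuess of nat
| IPop of nat & nat & nat & nat
| IJump of nat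
| IHalt.

Fixpoint code_size (c : cmd) : nat :=
  match c with
  | Push _ _ | Guess _ => 2
  | Seq c d => code_size c + code_size d
  | Case _ ce cf ct => (code_size ce + code_size cf + code_size ct).+4
  | While _ cf ct => (code_size cf + code_size ct).+3
  end.

(** A push takes two instructions because a machine step writes before it moves: the first step
    moves the head left, the second writes. A guess is thus decided at the second step, which is why
    [exec] reads the oracle at [t.+1]. *)
Fixpoint compile (p : nat) (c : cmd) : seq instr :=
  match c with
  | Push r b => [:: ILeft r; IWrite r b]
  | Guess r => [:: ILeft r; IGuess r]
  | Seq c d => compile p c ++ compile (p + code_size c) d
  | Case r ce cf ct =>
      let pf := p.+2 + code_size ce in
      let pt := pf.+1 + code_size cf in
      let p' := pt.+1 + code_size ct in
      IPop r p.+1 pf pt :: compile p.+1 ce ++ IJump p' ::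
        compile pf cf ++ IJump p' :: compile pt ct ++ [:: IJump p']
  | While r cf ct =>
      let pt := p.+2 + code_size cf in
      IPop r (pt.+1 + code_size ct) p.+1 pt ::
        compile p.+1 cf ++ IJump p :: compile pt ct ++ [:: IJump p]
  end.

Lemma size_compile c p : size (compile p c) = code_size c.
Proof.
elim: c p => //= [c IHc d IHd|r ce IHe cf IHf ct IHt|r cf IHf ct IHt] p;
  by rewrite ?size_cat /= ?size_cat /= ?size_cat /= ?IHc ?IHd ?IHe ?IHf ?IHt; lia.
Qed.

(** * The machine of a program and its correctness *)

Section Machine.
Variables (K : nat) (code : seq instr) (acc : pred nat).

Let sym := (bool + void)%type.
Let act := {ffun 'I_K.+1 -> option sym * move}.

Definition act_on (rd : {ffun 'I_K.+1 -> option sym}) (r : nat)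
    (a : option sym * move) : act :=
  [ffun i : 'I_K.+1 => if i == r :> nat then a else (rd i, MoveStay)].

Definition instr_action (b : bool) (q : 'I_(size code).+1)
    (rd : {ffun 'I_K.+1 -> option sym}) : option ('I_(size code).+1 * act) :=
  match nth IHalt code q with
  | ILeft r => Some (inord q.+1, act_on rd r (rd (inord r), MoveLeft))
  | IWrite r b' => Some (inord q.+1, act_on rd r (Some (inl b'), MoveStay))
  | IGuess r => Some (inord q.+1, act_on rd r (Some (inl b), MoveStay))
  | IPop r pe pf pt =>
      Some (if rd (inord r) is Some (inl b')
            then (inord (if b' then pt else pf), act_on rd r (None, MoveRight))
            else (inord pe, act_on rd r (None, MoveStay)))
  | IJump p => Some (inord p, act_on rd 0 (rd ord0, MoveStay))
  | IHalt => None
  end.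

(** The two bits give the same action except at a guess. State [size code] lies past the code and
    halts through the default [IHalt]. *)
Definition machine : ntm :=
  @Ntm K 'I_(size code).+1 void (inord 0) (fun q => acc q)
    (fun q rd => [set x | (Some x == instr_action true q rd) || (Some x == instr_action false q rd)]%SET).

Definition advance (b : bool) (c : config machine) : option (config machine) :=
  omap (fun x : 'I_(size code).+1 * act =>
      @Config machine x.1 [ffun i => tape_act (ctapes c i) ((x.2 : act) i)])
    (instr_action b (cstate c) [ffun i => thead (ctapes c i)]).

Lemma step_advance (c d : config machine) :
  step c d <-> exists b, advance b c = Some d.
Proof.
rewrite /step /advance; split=> [[x]|[b]].
  rewrite /= inE => /orP[] /eqP E ->; by [exists true; rewrite -E|exists false; rewrite -E].
case E: (instr_action b _ _) => [x|] //= [<-]; exists x => //.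
by rewrite /= inE; case: b E => ->; rewrite eqxx ?orbT.
Qed.

Fixpoint runs (o : nat -> bool) (t n : nat) (c : config machine) : option (config machine) :=
  if n is n'.+1 then obind (runs o t.+1 n') (advance (o t) c) else Some c.

Lemma runs_add o t n m c :
  runs o t (n + m) c = obind (runs o (t + n) m) (runs o t n c).
Proof.
elim: n t c => [|n IH] t c /=; first by rewrite addn0.
by case: (advance _ _) => //= d; rewrite IH addSnnS.
Qed.

Lemma eq_runs o o' t n c :
  (forall i, t <= i -> o i = o' i) -> runs o t n c = runs o' t n c.
Proof.
elim: n t c => //= n IH t c E; rewrite E //.
by case: (advance _ _) => //= d; apply: IH => i /ltnW; apply: E.
Qed.

(** The oracle records which of the two actions was taken at each step. The starting time is
    arbitrary so that the induction can shift it. *)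
Lemma reach_runs n t (c d : config machine) :
  reach n c d <-> exists o, runs o t n c = Some d.
Proof.
elim: n t c => [|n IH] t c /=; first by split=> [->|]; [exists (fun=> true)|case=> o []].
split=> [[c' /step_advance[b Hb] /(IH t.+1)[ o Ho]]|[ o ]].
  exists (fun i => if i == t then b else o i); rewrite eqxx Hb /= -Ho.
  by apply: eq_runs => i ti; rewrite gtn_eqF.
case E: (advance _ _) => [c'|] //= H.
by exists c'; [apply/step_advance; exists (o t)|apply/(IH t.+1); exists o].
Qed.

Lemma halted_advance (c : config machine) :
  nth IHalt code (cstate c) = IHalt -> halted c /\ forall b, advance b c = None.
Proof.
move=> E; have N b : advance b c = None by rewrite /advance /instr_action E.
by split=> // d /step_advance[b]; rewrite N.
Qed.

Definition is_guess (i : instr) := if i is IGuess _ then true else false.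

Lemma machine_deterministic : ~~ has is_guess code -> deterministic machine.
Proof.
move=> ng q rd /=.
have -> : instr_action true q rd = instr_action false q rd.
  rewrite /instr_action; case: (ltnP q (size code)) => [lt|ge]; last by rewrite nth_default.
  case E: (nth _ _ _) => //; case/negP: ng.
  by apply/(has_nthP IHalt); exists q => //; rewrite E.
case E: (instr_action false q rd) => [x|]; last first.
  rewrite (_ : [set _ | _]%SET = finset.set0) ?cards0 //;
  by apply/finset.setP=> y; rewrite !inE.
rewrite (_ : [set _ | _]%SET = [set x]%SET) ?cards1 //.
by apply/finset.setP=> y; rewrite !inE orbb.
Qed.

(** The head stands on the top of the stack. Popped cells remain listed on its left as explicit
    blanks, and [j] explicit blanks may follow the stack on the right. *)
Definition tape_rep (t : tape sym) (v : seq bool) : Prop :=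
  all (pred1 None) (tleft t) /\
  exists j, thead t :: tright t = [seq Some (inl b) | b <- v] ++ nseq j None.

Definition rep (c : config machine) (p : nat) (s : store) : Prop :=
  cstate c = p :> nat /\ forall i : 'I_K.+1, tape_rep (ctapes c i) (s i).

Lemma tape_rep_head t v : tape_rep t v -> thead t = omap inl (ohead v).
Proof. by case=> _ [j]; case: v => [|b v] /=; [case: j => [|j]//= []|case]. Qed.

Lemma tape_rep_pop t b v : tape_rep t (b :: v) ->
  tape_rep (tape_act t (None, MoveRight)) v.
Proof.
case: t => l h r [/= al [j [-> ->]]]; split=> //=.
(* When the last bit is popped and nothing is listed further right, the head reads a default blank,
   which becomes explicit. *)
by case: v => [|b' v] /=; [exists (maxn j 1); case: j|exists j].
Qed.

Lemma tape_rep_push t b v : tape_rep t v ->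
  tape_rep (tape_act (tape_act t (thead t, MoveLeft)) (Some (inl b), MoveStay)) (b :: v).
Proof.
case: t => l h r [/= al [j E]]; split=> /=; first by case: l al => //= ? ? /andP[].
by exists j; rewrite E.
Qed.

Lemma tape_stay (t : tape sym) : tape_act t (thead t, MoveStay) = t.
Proof. by case: t. Qed.

Lemma inord_val p : p <= size code -> @inord (size code) p = p :> nat.
Proof. by move=> lp; rewrite inordK. Qed.

Definition simulates o t (n p p' : nat) (s s' : store) :=
  forall c, rep c p s -> exists2 c', runs o t n c = Some c' & rep c' p' s'.

Lemma simulates_trans o t n m p p' p'' s s' s'' :
  simulates o t n p p' s s' -> simulates o (t + n) m p' p'' s' s'' ->
  simulates o t (n + m) p p'' s s''.
Proof.
move=> H1 H2 c /H1[c' E /H2[c'' E' r]]; exists c'' => //.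
by rewrite runs_add E.
Qed.

Lemma simulates_jump o t p p' s : nth IHalt code p = IJump p' -> p' <= size code ->
  simulates o t 1 p p' s s.
Proof.
move=> E lp c [Ep R].
eexists; first by rewrite /= /advance /instr_action Ep E /=; reflexivity.
split=> [|i] /=; first exact: inord_val.
rewrite !ffunE; case: eqP => [/(@ord_inj _ i ord0) ->|_]; rewrite ?ffunE tape_stay; exact: R.
Qed.

Lemma simulates_pop_nil o t p r pe pf pt s :
  nth IHalt code p = IPop r pe pf pt -> pe <= size code -> r <= K ->
  s r = [::] -> simulates o t 1 p pe s s.
Proof.
move=> E lp lr sr c [Ep R].
have Ei : @inord K r = r :> nat by rewrite inordK.
have Eh : thead (ctapes c (inord r)) = None.
  by rewrite (tape_rep_head (R _)) Ei sr.
eexists; first by rewrite /= /advance /instr_action Ep E /= ffunE Eh /=; reflexivity.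
split=> [|i] /=; first exact: inord_val.
rewrite !ffunE; case: eqP => [ir|_]; last by rewrite ?ffunE tape_stay.
have -> : i = inord r by apply: ord_inj; rewrite Ei.
by rewrite -Eh tape_stay.
Qed.

Lemma simulates_pop_cons o t p r pe pf pt s b v :
  nth IHalt code p = IPop r pe pf pt -> pf <= size code -> pt <= size code -> r <= K ->
  s r = b :: v -> simulates o t 1 p (if b then pt else pf) s (upd s r v).
Proof.
move=> E lf lt lr sr c [Ep R].
have Ei : @inord K r = r :> nat by rewrite inordK.
have Eh : thead (ctapes c (inord r)) = Some (inl b).
  by rewrite (tape_rep_head (R _)) Ei sr.
eexists; first by rewrite /= /advance /instr_action Ep E /= ffunE Eh /=; reflexivity.
split=> [|i] /=; first by case: (b); exact: inord_val.
rewrite !ffunE /upd; case: eqP => [ir|_]; last by rewrite ?ffunE tape_stay.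
by apply: (@tape_rep_pop _ b); rewrite -sr -ir.
Qed.

Lemma simulates_push o t p r b s (i2 : instr) :
  nth IHalt code p = ILeft r -> nth IHalt code p.+1 = i2 ->
  (i2 = IWrite r b \/ i2 = IGuess r /\ b = o t.+1) ->
  p.+1 < size code -> r <= K ->
  simulates o t 2 p p.+2 s (upd s r (b :: s r)).
Proof.
move=> E E2 H2 lp lr c [Ep R].
have Ei : @inord K r = r :> nat by rewrite inordK.
have Ep1 : @inord (size code) p.+1 = p.+1 :> nat by rewrite inord_val // ltnW.
eexists.
  rewrite /= /advance /instr_action Ep E /= Ep1 E2 /=.
  by case: H2 => [->|[-> <-]] /=; reflexivity.
have F (i : 'I_K.+1) : tape_rep
    (tape_act (if i == r :> nat then tape_act (ctapes c i) (thead (ctapes c i), MoveLeft)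
               else ctapes c i) (if i == r :> nat then (Some (inl b), MoveStay)
               else (thead (ctapes c i), MoveStay))) (upd s r (b :: s r) i).
  rewrite /upd; case: eqP => [ir|_]; last by rewrite tape_stay.
  by rewrite -ir; exact: tape_rep_push.
case: H2 => [_|[_ bE]]; split=> [|i] /=; rewrite ?inord_val //.
all: have := F i; rewrite !ffunE -?bE; case: eqP => [ir|_]; rewrite ?ffunE ?tape_stay //.
all: by have -> : inord r = i by apply: ord_inj; rewrite Ei.
Qed.

(** The times in [exec] are exact step counts, so one oracle drives both program and machine. The
    induction is on the execution, since a loop runs the same command again. *)
Lemma exec_simulates o c t s t' s' p :
  exec o c t s t' s' -> max_reg c <= K -> p + code_size c <= size code ->
  (forall k, k < code_size c -> nth IHalt code (p + k) = nth IHalt (compile p c) k) ->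
  t <= t' /\ simulates o t (t' - t) p (p + code_size c) s s'.
Proof.
move=> H; elim: H p => {c t s t' s'}.
- move=> r b t s p /= lr lp C; split; first by lia.
  rewrite (_ : t.+2 - t = 2); last by lia.
  rewrite addn2; apply: (simulates_push (i2 := IWrite r b)) => //; last by lia.
  - by have := C 0; rewrite addn0; apply.
  - by have := C 1; rewrite addn1; apply.
  - by left.
- move=> r t s p /= lr lp C; split; first by lia.
  rewrite (_ : t.+2 - t = 2); last by lia.
  rewrite addn2; apply: (simulates_push (i2 := IGuess r)) => //; last by lia.
  - by have := C 0; rewrite addn0; apply.
  - by have := C 1; rewrite addn1; apply.
  - by right.
- move=> c d t s t' s' t'' s'' _ IHc _ IHd p /= lr lp C.
  case: (IHc p) => [||k lk|l1 H1]; [lia|lia| |].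
    by rewrite C ?nth_cat ?size_compile ?lk //; lia.
  case: (IHd (p + code_size c)) => [||k lk|l2 H2]; [lia|lia| |].
    rewrite -addnA C ?nth_cat ?size_compile; last by lia.
    by rewrite ifF; [congr nth; lia|lia].
  split; first by lia.
  rewrite (_ : t'' - t = (t' - t) + (t'' - t')); last by lia.
  rewrite addnA; apply: simulates_trans H1 _.
  by rewrite subnKC.
- move=> r ce cf ct t s t' s' sr _ IH p /= lr lp C.
  case: (IH p.+1) => [||k lk|l1 H1]; [lia|lia| |].
    rewrite addSnnS C; last by lia.
    by rewrite /= nth_cat size_compile lk.
  split; first by lia.
  rewrite (_ : t'.+1 - t = 1 + ((t' - t.+1) + 1)); last by lia.
  apply: simulates_trans (simulates_trans (_ : simulates _ _ _ p.+1 _ _ _) _).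
  - have := C 0; rewrite addn0 /= => /(_ isT) E.
    by apply: simulates_pop_nil E _ _ sr; lia.
  - rewrite addn1; exact: H1.
  - apply: simulates_jump; last by lia.
    rewrite addSnnS C; last by lia.
    rewrite /= nth_cat size_compile ltnn subnn /=; congr IJump; lia.
- move=> r ce cf ct b v t s t' s' sr _ IH p /= lr lp C.
  pose q := if b then p.+3 + code_size ce + code_size cf else p.+2 + code_size ce.
  case: (IH q) => [||k lk|l1 H1].
  + by case: (b); lia.
  + by rewrite /q; case: (b); lia.
  + rewrite /q; case: b lk {q sr IH} => lk.
      rewrite (_ : _ + _ + _ + k = p + (code_size ce + code_size cf + k).+3); last by lia.
      rewrite C /=; last by lia.
      rewrite nth_cat size_compile ifF; last by lia.
      rewrite (_ : _ - _ = (code_size cf + k).+2 ); last by lia.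
      rewrite /= nth_cat size_compile ifF; last by lia.
      rewrite (_ : _ - _ = k.+1 ); last by lia.
      by rewrite /= nth_cat size_compile lk; congr (nth _ (compile _ _) _); lia.
    rewrite (_ : _ + _ + k = p + (code_size ce + k).+2); last by lia.
    rewrite C /=; last by lia.
    rewrite nth_cat size_compile ifF; last by lia.
    rewrite (_ : _ - _ = k.+1 ); last by lia.
    by rewrite /= nth_cat size_compile lk.
  split; first by lia.
  rewrite (_ : t'.+1 - t = 1 + ((t' - t.+1) + 1)); last by lia.
  apply: simulates_trans (simulates_trans (_ : simulates _ _ _ q _ _ _) _).
  - have := C 0; rewrite addn0 /= => /(_ isT) E.
    rewrite (_ : q = if b then (p.+2 + code_size ce).+1 + code_size cf else p.+2 + code_size ce); last by rewrite /q; case: (b); lia.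
    by apply: simulates_pop_cons E _ _ _ sr; lia.
  - rewrite addn1; exact: H1.
  - apply: simulates_jump; last by lia.
    rewrite /q; case: (b).
      rewrite (_ : _ + _ + _ + code_size ct = p + (code_size ce + code_size cf + code_size ct).+3); last by lia.
      rewrite C /=; last by lia.
      rewrite nth_cat size_compile ifF; last by lia.
      rewrite (_ : _ - _ = (code_size cf + code_size ct).+2 ); last by lia.
      rewrite /= nth_cat size_compile ifF; last by lia.
      rewrite (_ : _ - _ = (code_size ct).+1 ); last by lia.
      rewrite /= nth_cat size_compile ltnn subnn /=; congr IJump; lia.
    rewrite (_ : _ + _ + _ = p + (code_size ce + code_size cf).+2); last by lia.
    rewrite C /=; last by lia.
    rewrite nth_cat size_compile ifF; last by lia.
    rewrite (_ : _ - _ = (code_size cf).+1 ); last by lia.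
    rewrite /= nth_cat size_compile ltnn subnn /=; congr IJump; lia.
- move=> r cf ct t s sr p /= lr lp C; split; first by lia.
  rewrite (_ : t.+1 - t = 1); last by lia.
  have := C 0; rewrite addn0 /= => /(_ isT) E.
  rewrite (_ : p + _ = (p.+2 + code_size cf).+1 + code_size ct); last by lia.
  by apply: simulates_pop_nil E _ _ sr; lia.
- move=> r cf ct b v t s t' s' t'' s'' sr _ IH _ IHw p /= lr lp C.
  case: (IHw p) => [||k lk|l2 H2]; [by []|by []|exact: C|].
  pose q := if b then p.+2 + code_size cf else p.+1.
  case: (IH q) => [||k lk|l1 H1].
  + by case: (b); lia.
  + by rewrite /q; case: (b); lia.
  + rewrite /q; case: b lk {q sr IH} => lk.
      rewrite (_ : _ + _ + k = p + (code_size cf + k).+2); last by lia.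
      rewrite C /=; last by lia.
      rewrite nth_cat size_compile ifF; last by lia.
      rewrite (_ : _ - _ = k.+1 ); last by lia.
      by rewrite /= nth_cat size_compile lk.
    rewrite addSnnS C /=; last by lia.
    by rewrite nth_cat size_compile lk.
  split; first by lia.
  rewrite (_ : t'' - t = 1 + ((t' - t.+1) + (1 + (t'' - t'.+1)))); last by lia.
  apply: simulates_trans (simulates_trans (_ : simulates _ _ _ q _ _ _) (simulates_trans (_ : simulates _ _ _ _ p _ s') _)).
  - have := C 0; rewrite addn0 /= => /(_ isT) E.
    by apply: simulates_pop_cons E _ _ _ sr; lia.
  - rewrite addn1; exact: H1.
  - apply: simulates_jump; last by lia.
    rewrite /q; case: (b).
      rewrite (_ : _ + _ + code_size ct = p + (code_size cf + code_size ct).+2); last by lia.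
      rewrite C /=; last by lia.
      rewrite nth_cat size_compile ifF; last by lia.
      rewrite (_ : _ - _ = (code_size ct).+1 ); last by lia.
      by rewrite /= nth_cat size_compile ltnn subnn /=.
    rewrite addSnnS C /=; last by lia.
    by rewrite nth_cat size_compile ltnn subnn.
  - by rewrite (_ : t + _ + _ + _ = t'.+1); last by lia.
Qed.

Definition word_store (w : seq bool) : store := fun r => if r == 0 then w else [::].

Lemma rep_init w : rep (init machine w) 0 (word_store w).
Proof.
split=> [|i] /=; first exact: inord_val.
rewrite ffunE /word_store.
case: eqP => [->|ni] /=; last first.
  rewrite ifF; last by apply/eqP => i0; apply: ni; apply: ord_inj.
  by split=> //; exists 1.
by split=> //=; case: w => [|b w]; [exists 1|exists 0; rewrite cats0].
Qed.

(** With its oracle fixed a run is deterministic and cannot go past a halting configuration. Applied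
    to the oracle of each computation path, this bounds all of them. *)
Lemma runs_halted_bound o t n c d (m : nat) (e : config machine) :
  runs o t n c = Some d -> (forall b, advance b d = None) ->
  runs o t m c = Some e -> m <= n.
Proof.
move=> R N; case: (leqP m n) => // /subnKC <-; rewrite addSnnS runs_add R /=.
by rewrite N.
Qed.
End Machine.

Lemma guess_free_compile c p : guess_free c -> ~~ has is_guess (compile p c).
Proof.
elim: c p => //= [c IHc d IHd|r ce IHe cf IHf ct IHt|r cf IHf ct IHt] p.
- by move=> /andP[/IHc hc /IHd hd]; rewrite has_cat negb_or hc hd.
- by move=> /and3P[/IHe he /IHf hf /IHt ht]; rewrite has_cat /= has_cat /= has_cat /= orbF !negb_or he hf ht.
- by move=> /andP[/IHf hf /IHt ht]; rewrite has_cat /= has_cat /= orbF negb_or hf ht.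
Qed.

(** [4 * n + 3] bounds the code size of an [n]-bit word plus 2 ([csize_bits]); it is at most [7 * n]
    unless [n = 0]. The right-hand side has the form that [poly_time] asks for. *)
Lemma expn_poly c n : (4 * n + 3) ^ c <= 7 ^ c * n ^ c + 7 ^ c.
Proof.
case: n => [|n].
  by apply: leq_trans (leq_addl _ _); case: c => // c; rewrite leq_exp2r.
rewrite (leq_trans _ (leq_addr _ _)) // -expnMn.
by case: c => // c; rewrite leq_exp2r //; lia.
Qed.

Section Programs.
Variables (c : cmd) (w : seq bool).

Lemma exec_runs K o t s' (post : seq instr) acc :
  exec o c 0 (word_store w) t s' -> max_reg c <= K ->
  let M := machine K (compile 0 c ++ post) acc in
  exists2 d : config M, runs o 0 t (init M w) = Some d & rep d (code_size c) s'.
Proof.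
move=> H lK M.
have := @exec_simulates K (compile 0 c ++ post) acc _ _ _ _ _ _ 0 H lK.
rewrite size_cat size_compile leq_addr => /(_ isT)[].
  by move=> k lk; rewrite nth_cat size_compile lk.
by move=> _; rewrite subn0; apply; exact: rep_init.
Qed.
End Programs.

(* The witness program leaves its result in register [K], the last tape. *)
Lemma program_poly_time_function (f : seq bool -> seq bool) (c : cmd) (K e : nat) :
  guess_free c -> max_reg c <= K ->
  (forall w o, exists t s', [/\ exec o c 0 (word_store w) t s',
     t <= (4 * size w + 3) ^ e & s' K = f w]) ->
  poly_time_function f.
Proof.
move=> gf lK H; pose M := machine K (compile 0 c ++ [::]) xpredT; exists M.
have halt w o : exists n d, [/\ runs o 0 n (init M w) = Some d,
    n <= (4 * size w + 3) ^ e, output d = f w, halted d & forall b, advance b d = None].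
  have [t [s' [E le E']]] := H w o.
  have [d Rd [Ed Td]] := exec_runs [::] xpredT E lK; exists t, d.
  have [] := @halted_advance _ _ _ d; last split=> //.
    by rewrite Ed cats0 nth_default // size_compile.
  rewrite /output; have [_ [j ->]] := Td ord_max; rewrite E'.
  by elim: (f w) => [|b' v IH] /=; [case: j|rewrite IH].
split.
- by apply: machine_deterministic; rewrite cats0 guess_free_compile.
- exists (7 ^ e), (7 ^ e), e => w n d /(reach_runs _ 0)[ o Ho].
  have [m [d' [Rd lm _ _ N]]] := halt w o.
  exact: leq_trans (runs_halted_bound Rd N Ho) (leq_trans lm (expn_poly _ _)).
- move=> w; have [n [d [Rd _ Od Hd _]]] := halt w (fun=> true).
  by exists n, d; split=> //; apply/(reach_runs _ 0); exists (fun=> true).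
Qed.

(* Acceptance is read off the top of register 0. *)
Lemma program_in_NP (L : language) (c : cmd) (e : nat) :
  (forall w o, exists t s', exec o c 0 (word_store w) t s' /\
     t < (4 * size w + 3) ^ e) ->
  (forall w, L w <-> exists o t s' v, exec o c 0 (word_store w) t s' /\ s' 0 = true :: v) ->
  in_NP L.
Proof.
move=> H HL; pose p := code_size c.
(* The appended test pops register 0 and jumps to the accepting state [p.+2], past the code, exactly
   on [true]; otherwise it reaches [IHalt] at [p.+1]. It takes one step, whence the strict time
   bound in the hypothesis. *)
pose M := machine (max_reg c) (compile 0 c ++ [:: IPop 0 p.+1 p.+1 p.+2; IHalt]) (pred1 p.+2).
have halt w o t s' : exec o c 0 (word_store w) t s' -> exists d : config M,
   [/\ runs o 0 t.+1 (init M w) = Some d, halted d, forall b, advance b d = None &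
    tm_accept (cstate d) = (ohead (s' 0) == Some true)].
  move=> E.
  have [d Rd Td] := exec_runs [:: IPop 0 p.+1 p.+1 p.+2; IHalt] (pred1 p.+2) E (leqnn _).
  have szc : size (compile 0 c ++ [:: IPop 0 p.+1 p.+1 p.+2; IHalt]) = p.+2.
    by rewrite size_cat size_compile addn2.
  have nthp : nth IHalt (compile 0 c ++ [:: IPop 0 p.+1 p.+1 p.+2; IHalt]) p = IPop 0 p.+1 p.+1 p.+2.
    by rewrite nth_cat size_compile ltnn subnn.
  have haltp q : p < q -> nth IHalt (compile 0 c ++ [:: IPop 0 p.+1 p.+1 p.+2; IHalt]) q = IHalt.
    by move=> pq; rewrite nth_cat size_compile ifF; [case: (q - _) (subn_gt0 p q) => [|[|[|k]]]; rewrite ?pq //|lia].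
  have [q pq [s'' H2]] : exists2 q, (if ohead (s' 0) == Some true then q = p.+2 else q = p.+1) &
      exists s'', @simulates (max_reg c) (compile 0 c ++ [:: IPop 0 p.+1 p.+1 p.+2; IHalt])
        (pred1 p.+2) o t 1 p q s' s''.
    case E0: (s' 0) => [|b v] /=.
      by exists p.+1 => //; exists s'; apply: simulates_pop_nil nthp _ _ E0; rewrite ?szc.
    exists (if b then p.+2 else p.+1); first by case: (b).
    by exists (upd s' 0 v); apply: simulates_pop_cons nthp _ _ _ E0; rewrite ?szc.
  have [d' Rd' [Ed' _]] := H2 d Td.
  have [|h1 h2] := @halted_advance _ _ _ d'.
    by apply: haltp; rewrite Ed'; case: eqP pq => _ ->.
  exists d'; split=> //.
    by have := runs_add o 0 t 1 (init M w); rewrite addn1 Rd => ->.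
  by rewrite /= Ed'; case: eqP pq => _ ->; rewrite ?eqxx //; apply/eqP; lia.
exists M.
  exists (7 ^ e), (7 ^ e), e => w n d /(reach_runs _ 0)[ o Ho].
  have [t [s' [E lt]]] := H w o; have [d' [Rd _ N _]] := halt _ _ _ _ E.
  exact: leq_trans (runs_halted_bound Rd N Ho) (leq_trans lt (expn_poly _ _)).
move=> w; rewrite HL; split.
  move=> [ o [t [s' [v [E E0]]]]]; have [d [Rd hd _ ad]] := halt _ _ _ _ E.
  exists t.+1, d; split=> //; first by apply/(reach_runs _ 0); exists o.
  by rewrite ad E0.
move=> [n [d [/(reach_runs _ 0)[ o Ho] hd ad]]].
have [t [s' [E lt]]] := H w o; have [d' [Rd hd' N ad']] := halt _ _ _ _ E.
exists o, t, s'.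
have le1 := runs_halted_bound Rd N Ho.
have Nd b : advance b d = None.
  by case E1: (advance b d) => [x|] //; case: (hd x); apply/step_advance; exists b.
have le2 := runs_halted_bound Ho Nd Rd.
have En : n = t.+1 by apply/eqP; rewrite eqn_leq le1 le2.
move: Ho; rewrite En Rd => -[Ed]; move: ad; rewrite -Ed ad'.
by case: (s' 0) => [|[] v] // _; exists v.
Qed.

(** * Polynomial-time functions on encoded data *)

(** A single type carries all data. Its encoding is Polish notation, hence self-delimiting: a code
    can be read off the top of a register without knowing its length. *)
Inductive tree := Leaf | Node of tree & tree.

Fixpoint enc (x : tree) : seq bool :=
  if x is Node a b then true :: enc a ++ enc b else [:: false].

Definition tsize (x : tree) : nat := size (enc x).

Lemma tsize_node a b : tsize (Node a b) = (tsize a + tsize b).+1.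
Proof. by rewrite /tsize /= size_cat. Qed.

(** The end time is chosen before the oracle, so such a piece behaves alike under all oracles and
    can be inserted into guessing programs. *)
Definition run (c : cmd) (s s' : store) (n : nat) : Prop :=
  forall t, exists2 t', (forall o, exec o c t s t' s') & t' <= t + n.

Ltac store_eq :=
  apply/funext => ?; rewrite /upd;
  repeat match goal with |- context[?a == ?b :> nat] =>
    (have -> : (a == b) = false by apply/negbTE; lia) ||
    (have -> : (a == b) = true by lia) ||
    (let E := fresh "E" in
     case: (eqVneq a b) => E; try (exfalso; lia); [try rewrite -> E in *|]) end;
  rewrite ?eqxx; try done; try congruence.

Ltac upds :=
  rewrite /upd;
  repeat match goal with |- context[?a == ?b :> nat] =>
    (have -> : (a == b) = false by apply/negbTE; lia) ||
    (have -> : (a == b) = true by lia) end.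

Lemma run_conv c s s1 s' n m : run c s s1 n -> s1 = s' -> n <= m -> run c s s' m.
Proof. by move=> R <- nm t; have [t' E le] := R t; exists t' => //; lia. Qed.

Lemma run_eq c s0 s s' n : s0 = s -> run c s s' n -> run c s0 s' n.
Proof. by move=> ->. Qed.

Lemma run_push r b s : run (Push r b) s (upd s r (b :: s r)) 2.
Proof. by move=> t; exists t.+2; [constructor|lia]. Qed.

Lemma run_seq c d s s' s'' n m :
  run c s s' n -> run d s' s'' m -> run (Seq c d) s s'' (n + m).
Proof.
move=> R1 R2 t; have [t1 E1 l1] := R1 t; have [t2 E2 l2] := R2 t1.
by exists t2; [move=> o; exact: ExecSeq (E1 o) (E2 o)|lia].
Qed.

Lemma run_case_cons r ce cf ct s s' b v n :
  s r = b :: v -> run (if b then ct else cf) (upd s r v) s' n ->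
  run (Case r ce cf ct) s s' n.+2.
Proof.
move=> sr R t; have [t' E l] := R t.+1.
by exists t'.+1; [move=> o; apply: ExecCaseCons sr (E o)|lia].
Qed.

Lemma run_case_false r ce cf ct s s' v n :
  s r = false :: v -> run cf (upd s r v) s' n -> run (Case r ce cf ct) s s' n.+2.
Proof. by move=> sr R; exact: (@run_case_cons r ce cf ct s s' false v n sr R). Qed.

Lemma run_case_true r ce cf ct s s' v n :
  s r = true :: v -> run ct (upd s r v) s' n -> run (Case r ce cf ct) s s' n.+2.
Proof. by move=> sr R; exact: (@run_case_cons r ce cf ct s s' true v n sr R). Qed.

Lemma run_while_nil r cf ct s : s r = [::] -> run (While r cf ct) s s 1.
Proof. by move=> sr t; exists t.+1; [constructor|lia]. Qed.

Lemma run_while_cons r cf ct s s' s'' b v n m :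
  s r = b :: v -> run (if b then ct else cf) (upd s r v) s' n ->
  run (While r cf ct) s' s'' m -> run (While r cf ct) s s'' (n + m).+2.
Proof.
move=> sr R1 R2 t; have [t1 E1 l1] := R1 t.+1; have [t2 E2 l2] := R2 t1.+1.
by exists t2; [move=> o; apply: ExecWhileCons sr (E1 o) (E2 o)|lia].
Qed.

(* A no-op, provided register [t] is empty. *)
Definition nop t := While t (Push t true) (Push t true).
Definition clear r t := While r (nop t) (nop t).
Definition move_rev r r' := While r (Push r' false) (Push r' true).
Definition move_rev2 r r1 r2 :=
  While r (Seq (Push r1 false) (Push r2 false)) (Seq (Push r1 true) (Push r2 true)).
Definition xfer r r' t := Seq (move_rev r t) (move_rev t r').
Definition copy r r' t := Seq (move_rev r t) (move_rev2 t r r').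

Lemma run_clear r t s : r != t -> s t = [::] ->
  run (clear r t) s (upd s r [::]) (3 * size (s r) + 1).
Proof.
move=> rt st; move E: (s r) => v; elim: v s st E => [|b v IH] s st E.
  by apply: run_conv (run_while_nil _ _ E) _ _ => //; store_eq.
apply: run_conv (run_while_cons (s' := upd s r v) E _ (IH _ _ _)) _ _.
- by case: (b); apply: run_while_nil; rewrite /upd eq_sym (negbTE rt).
- by rewrite /upd eq_sym (negbTE rt).
- by rewrite /upd eqxx.
- by store_eq.
- by rewrite /=; lia.
Qed.

Lemma run_move_rev r r' s : r != r' ->
  run (move_rev r r') s (upd (upd s r [::]) r' (catrev (s r) (s r'))) (4 * size (s r) + 1).
Proof.
move=> rr'; move E: (s r) => v; elim: v s E => [|b v IH] s E.
  by apply: run_conv (run_while_nil _ _ E) _ _ => //; store_eq.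
apply: run_conv (run_while_cons (s' := upd (upd s r v) r' (b :: s r')) (n := 2) E _ (IH _ _)) _ _.
- by case: (b); apply: run_conv (run_push _ _ _) _ _ => //; store_eq.
- by rewrite /upd (negbTE rr') eqxx.
- by store_eq.
- by rewrite /=; lia.
Qed.

Lemma run_move_rev2 r r1 r2 s : r != r1 -> r != r2 -> r1 != r2 ->
  run (move_rev2 r r1 r2) s
    (upd (upd (upd s r [::]) r1 (catrev (s r) (s r1))) r2 (catrev (s r) (s r2)))
    (6 * size (s r) + 1).
Proof.
move=> n1 n2 n12; move E: (s r) => v; elim: v s E => [|b v IH] s E.
  by apply: run_conv (run_while_nil _ _ E) _ _ => //; store_eq.
apply: run_conv (run_while_cons
   (s' := upd (upd (upd s r v) r1 (b :: s r1)) r2 (b :: s r2)) (n := 4) E _ (IH _ _)) _ _.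
- by case: (b); apply: run_conv (run_seq (run_push _ _ _) (run_push _ _ _)) _ _ => //; store_eq.
- by rewrite /upd (negbTE n1) (negbTE n2) eqxx.
- by store_eq.
- by rewrite /=; lia.
Qed.

Lemma run_xfer r r' t s : r != r' -> r != t -> r' != t -> s t = [::] ->
  run (xfer r r' t) s (upd (upd s r [::]) r' (s r ++ s r')) (8 * size (s r) + 2).
Proof.
move=> n1 n2 n3 st; apply: run_conv (run_seq (run_move_rev _ n2) (run_move_rev _ _)) _ _.
- by rewrite eq_sym.
- by store_eq; rewrite st !catrevE cats0 revK.
- by rewrite /upd eqxx st catrevE cats0 size_rev; lia.
Qed.

Lemma run_copy r r' t s : r != r' -> r != t -> r' != t -> s t = [::] ->
  run (copy r r' t) s (upd s r' (s r ++ s r')) (10 * size (s r) + 2).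
Proof.
move=> n1 n2 n3 st.
apply: run_conv (run_seq (run_move_rev _ n2) (run_move_rev2 _ _ _ n1)) _ _.
- by rewrite eq_sym.
- by rewrite eq_sym.
- by store_eq; rewrite ?st !catrevE ?cats0 ?revK.
- by rewrite /upd eqxx st catrevE cats0 size_rev; lia.
Qed.

(* Register [b.+2] counts, in unary, the subtrees still to be read from [b]. *)
Definition split_loop b :=
  While b.+2 (Push b true) (Case b (Push b true) (Push b.+1 false)
    (Seq (Push b.+1 true) (Seq (Push b.+2 true) (Push b.+2 true)))).

Definition split b := Seq (Push b.+2 true) (split_loop b).

Definition upd3 s b (u v w : seq bool) := upd (upd (upd s b u) b.+1 v) b.+2 w.

(** Stated with the rest of the loop as a continuation: what follows the subtree [x] is a
    hypothesis, so the induction can chain the two children of a node. *)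
Lemma run_split_loop x b s s' v u k n :
  run (split_loop b) (upd3 s b v (catrev (enc x) u) k) s' n ->
  run (split_loop b) (upd3 s b (enc x ++ v) u (true :: k)) s' (n + 10 * tsize x).
Proof.
elim: x v u k n => [|x IHx y IHy] v u k n R.
  apply: run_conv (run_while_cons (s' := upd3 s b v (false :: u) k) (n := 4) _ _ R) _ _ => //.
  - by rewrite /upd3 /upd eqxx.
  - rewrite /=; apply: (@run_case_cons _ _ _ _ _ _ _ v).
    by rewrite /upd3 /upd; do !rewrite ifF ?eqxx //; lia.
  - by apply: run_conv (run_push _ _ _) _ _ => //; rewrite /upd3; store_eq.
  - by rewrite /tsize /=; lia.
have R' := IHx (enc y ++ v) (true :: u) (true :: k) _ (IHy _ _ _ _ _).
have {R} : run (split_loop b) (upd3 s b v (catrev (enc y) (catrev (enc x) (true :: u))) k) s' n.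
  by move: R; rewrite !catrevE /= rev_cons rev_cat cat_rcons -catA.
move=> /R' {}R'.
apply: run_conv (run_while_cons (n := 8) _ _ R') _ _ => //.
- by rewrite /upd3 /upd eqxx.
- rewrite /=; apply: (@run_case_cons _ _ _ _ _ _ _ (enc x ++ enc y ++ v)).
    by rewrite /upd3 /upd; do !rewrite ifF ?eqxx //=; rewrite ?catA //; lia.
  apply: run_conv (run_seq (run_push _ _ _) (run_seq (run_push _ _ _) (run_push _ _ _))) _ _ => //.
  by rewrite /upd3; store_eq.
- by rewrite tsize_node; lia.
Qed.

Lemma run_split x b s v : s b = enc x ++ v -> s b.+1 = [::] -> s b.+2 = [::] ->
  run (split b) s (upd (upd s b v) b.+1 (rev (enc x))) (10 * tsize x + 3).
Proof.
move=> sb s1 s2.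
apply: run_conv (run_seq (run_push _ _ _) _) _ _.
- rewrite (_ : upd s b.+2 (true :: s b.+2) = upd3 s b (enc x ++ v) [::] [:: true]).
    by apply: run_split_loop; apply: run_while_nil; rewrite /upd3 /upd eqxx.
  by rewrite /upd3; store_eq.
- by rewrite /upd3 catrevE cats0; store_eq.
- by rewrite -/(tsize x); lia.
Qed.

(** * Encodable types and polynomial bounds *)

Structure ctype := CType { csort :> Type; code : csort -> tree }.
Arguments code {_} _.

Definition csize {A : ctype} (x : A) := tsize (code x).

Canonical tree_ctype := @CType tree id.
Canonical unit_ctype := @CType unit (fun=> Leaf).
Canonical bool_ctype := @CType bool (fun b => if b then Node Leaf Leaf else Leaf).
Canonical prod_ctype (A B : ctype) :=
  @CType (A * B)%type (fun p => Node (code p.1) (code p.2)).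
(** Codes coincide on purpose: a nonempty list has the code of the pair of its head and tail, and a
    number that of a list of units, so that operations transfer by [pt_recode]. *)
Definition code_seq (A : ctype) : seq A -> tree := foldr (fun x t => Node (code x) t) Leaf.
Canonical seq_ctype (A : ctype) := @CType (seq A) (@code_seq A).
Definition code_nat (n : nat) : tree := iter n (Node Leaf) Leaf.
Canonical nat_ctype := @CType nat code_nat.

(** One exponent describes the bound. As the base is at least 2, constants and sums are absorbed by
    increasing it. *)
Definition pb {A : ctype} (h : A -> nat) : Prop :=
  exists c, forall x, h x <= (csize x + 2) ^ c.

Section PolyBounds.
Context {A : ctype}.
Implicit Types h : A -> nat.

Let base_ge2 (x : A) : 1 < csize x + 2. Proof. by rewrite addn2. Qed.

Lemma pb_le h h' : (forall x, h x <= h' x) -> pb h' -> pb h.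
Proof. by move=> le [c H]; exists c => x; apply: leq_trans (le x) (H x). Qed.

Lemma pb_const k : pb (fun _ : A => k).
Proof.
exists k => x; apply: leq_trans (ltnW (ltn_expl _ (ltnSn 1))) _.
by case: k => // k; rewrite leq_exp2r // addn2.
Qed.

Lemma pb_size : pb (fun x : A => csize x).
Proof. by exists 1 => x; rewrite expn1 leq_addr. Qed.

Lemma pb_mul h h' : pb h -> pb h' -> pb (fun x => h x * h' x).
Proof. by move=> [c H] [d H']; exists (c + d) => x; rewrite expnD leq_mul. Qed.

Lemma pb_add h h' : pb h -> pb h' -> pb (fun x => h x + h' x).
Proof.
move=> [c H] [d H']; exists (c + d).+1 => x; rewrite expnS.
apply: leq_trans (leq_add (H x) (H' x)) _.
apply: leq_trans (_ : 2 * (csize x + 2) ^ (c + d) <= _); last by rewrite leq_mul2r base_ge2 orbT.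
by rewrite mul2n -addnn leq_add // leq_exp2l //; lia.
Qed.

Lemma pb_pow h k : pb h -> pb (fun x => h x ^ k).
Proof.
move=> ph; elim: k => [|k IH]; first exact: pb_const.
by apply: pb_le (pb_mul ph IH) => x; rewrite expnS.
Qed.

Lemma pb_comp {B : ctype} (f : A -> B) (h : B -> nat) :
  pb (fun x => csize (f x)) -> pb h -> pb (fun x => h (f x)).
Proof.
move=> pf [c H]; apply: pb_le (pb_pow c (pb_add pf (pb_const 2))) => x.
exact: H.
Qed.
End PolyBounds.

(* [f] is computed in polynomial time by programs that, for every [b], find the
   argument in register [b], leave the value there, and use only registers
   [>= b], those [> b] being empty before and after. *)
Definition pt {A B : ctype} (f : A -> B) : Prop :=
  exists (P : nat -> cmd) (h : A -> nat),
  [/\ forall b, guess_free (P b), pb h, pb (fun x => csize (f x)) &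
   forall b s x, s b = enc (code x) -> (forall r, b < r -> s r = [::]) ->
     run (P b) s (upd s b (enc (code (f x)))) (h x)].

Ltac pbs := repeat first
  [ assumption | exact: pb_const | exact: pb_size
  | apply: pb_add | apply: pb_mul ].

(** * Closure properties of polynomial-time functions *)

Section Closure.
Context {A B C : ctype}.

Lemma pt_size (f : A -> B) : pt f -> pb (fun x => csize (f x)).
Proof. by case=> P [h []]. Qed.

(** Programs see only codes; the types of the values may even differ. *)
Lemma pt_recode {B' : ctype} (f : A -> B) (g : A -> B') :
  (forall x, code (f x) = code (g x)) -> pt f -> pt g.
Proof.
move=> E [P [h [gf ph ps R]]]; exists P, h; split=> // [|b s x sb se].
  by apply: pb_le ps => x; rewrite /csize E.
by rewrite -E; exact: R.
Qed.

Lemma pt_redomain {A' : ctype} (i : A' -> A) (f : A -> B) :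
  (forall x, code (i x) = code x) -> pt f -> pt (fun x => f (i x)).
Proof.
move=> E [P [h [gf ph ps R]]]; exists P, (fun x => h (i x)); split=> // [||b s x sb se].
- by apply: pb_comp ph; apply: pb_le pb_size => x; rewrite /csize E.
- apply: (@pb_comp _ _ i (fun x => csize (f x))) ps.
  by apply: pb_le pb_size => x; rewrite /csize E.
- by apply: R => //; rewrite E.
Qed.

Lemma pt_id : pt (fun x : A => x).
Proof.
exists (fun b => nop b.+1), (fun x => 1); split=> // [||b s x sb se].
- exact: pb_const.
- exact: pb_size.
- by apply: run_conv (run_while_nil _ _ _) _ _; rewrite ?se //; store_eq.
Qed.

Lemma pt_comp (f : A -> B) (g : B -> C) : pt f -> pt g -> pt (fun x => g (f x)).
Proof.
move=> [P [h [gf ph ps R]]] [P' [h' [gf' ph' ps' R']]].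
exists (fun b => Seq (P b) (P' b)), (fun x => h x + h' (f x)); split.
- by move=> b /=; rewrite gf gf'.
- by apply: pb_add => //; apply: pb_comp ph'.
- exact: (@pb_comp _ _ f (fun x => csize (g x))).
move=> b s x sb se; apply: run_conv (run_seq (R _ _ _ sb se) (R' b _ (f x) _ _)) _ (leqnn _).
- by rewrite /upd eqxx.
- by move=> r br; rewrite /upd gtn_eqF // se.
- by store_eq.
Qed.

Fixpoint push_all b (v : seq bool) : cmd :=
  if v is x :: v' then Seq (push_all b v') (Push b x) else nop b.+1.

Lemma run_push_all b v s : s b.+1 = [::] ->
  run (push_all b v) s (upd s b (v ++ s b)) (2 * size v + 1).
Proof.
move=> s1; elim: v => [|x v IH] /=.
  by apply: run_conv (run_while_nil _ _ s1) _ _ => //; store_eq.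
apply: run_conv (run_seq IH (run_push _ _ _)) _ _; last by lia.
by store_eq.
Qed.

Lemma guess_free_push_all b v : guess_free (push_all b v).
Proof. by elim: v => //= x v ->. Qed.

Lemma pt_const (y : B) : pt (fun _ : A => y).
Proof.
exists (fun b => Seq (clear b b.+1) (push_all b (enc (code y)))),
  (fun x => 3 * csize x + 1 + (2 * csize y + 1)); split.
- by move=> b /=; rewrite guess_free_push_all.
- by pbs.
- by pbs.
move=> b s x sb se.
apply: run_conv (run_seq (run_clear (t := b.+1) _ _) (run_push_all _ _)) _ _.
- by lia.
- by rewrite se.
- by rewrite /upd ifF ?se //; lia.
- by store_eq; rewrite cats0.
- by rewrite sb.
Qed.

Lemma pt_pair (f : A -> B) (g : A -> C) : pt f -> pt g -> pt (fun x => (f x, g x)).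
Proof.
move=> [P [h [gf ph ps R]]] [P' [h' [gf' ph' ps' R']]].
exists (fun b => Seq (copy b b.+1 b.+2) (Seq (P b.+1) (Seq (copy b b.+2 b.+3)
  (Seq (P' b.+2) (Seq (clear b b.+3) (Seq (xfer b.+2 b b.+3)
  (Seq (xfer b.+1 b b.+3) (Push b true)))))))),
 (fun x => (10 * csize x + 2) + (h x + ((10 * csize x + 2) + (h' x + ((3 * csize x + 1) +
   ((8 * csize (g x) + 2) + ((8 * csize (f x) + 2) + 2))))))); split.
- by move=> b /=; rewrite gf gf'.
- by pbs.
- apply: pb_le (pb_add (pb_add ps ps') (pb_const 1)) => x.
  by rewrite /csize tsize_node addn1.
move=> b s x sb se.
have s1 := se b.+1 (ltnSn _); have s2 : s b.+2 = [::] by apply: se; lia.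
have s3 : s b.+3 = [::] by apply: se; lia.
apply: run_seq; first by apply: run_conv (run_copy _ _ _ s2) (erefl _) _; rewrite ?sb //; lia.
rewrite sb s1 cats0; apply: run_seq.
  apply: R; first by rewrite /upd eqxx.
  by move=> r br; rewrite /upd ifF ?se //; lia.
apply: run_seq.
  apply: run_conv (run_copy _ _ _ _) (erefl _) _; try lia; rewrite /upd.
  - by rewrite !ifF ?s3 //; lia.
  - by rewrite !ifF ?sb //; lia.
apply: run_seq.
  apply: R'; first by rewrite /upd eqxx !ifF ?sb ?s2 ?cats0 //; lia.
  by move=> r br; rewrite /upd !ifF ?se //; lia.
apply: run_seq.
  apply: run_conv (run_clear _ _) (erefl _) _; try lia; rewrite /upd !ifF ?s3 ?sb //; lia.
apply: run_seq.
  apply: run_conv (run_xfer _ _ _ _) (erefl _) _; try lia; rewrite /upd.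
  - by rewrite !ifF ?s3 //; lia.
  - by rewrite ifF ?eqxx //; lia.
apply: run_seq.
  apply: run_conv (run_xfer _ _ _ _) (erefl _) _; try lia; rewrite /upd.
  - by rewrite !ifF ?s3 //; lia.
  - by do !rewrite ifF ?eqxx //; lia.
apply: run_conv (run_push _ _ _) _ _ => //.
by store_eq; rewrite ?cats0 ?s1 ?s2.
Qed.

Lemma pt_if (c : A -> bool) (f g : A -> B) :
  pt c -> pt f -> pt g -> pt (fun x => if c x then f x else g x).
Proof.
move=> [Q [k [gc pk pc K]]] [P [h [gf ph ps R]]] [P' [h' [gf' ph' ps' R']]].
exists (fun b => Seq (copy b b.+1 b.+2) (Seq (Q b.+1) (Case b.+1 (P b)
   (P' b) (Seq (clear b.+1 b.+2) (P b))))),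
  (fun x => (10 * csize x + 2) + (k x + (h x + h' x + 9))); split.
- by move=> b /=; rewrite gf gf' gc.
- by pbs.
- by apply: pb_le (pb_add ps ps') => x; case: (c x); [exact: leq_addr|exact: leq_addl].
move=> b s x sb se.
have s1 := se b.+1 (ltnSn _); have s2 : s b.+2 = [::] by apply: se; lia.
apply: run_seq; first by apply: run_conv (run_copy _ _ _ s2) (erefl _) _; rewrite ?sb //; lia.
rewrite sb s1 cats0; apply: run_seq.
  apply: K; first by rewrite /upd eqxx.
  by move=> r br; rewrite /upd ifF ?se //; lia.
case: (c x).
- apply: run_conv (@run_case_cons _ _ _ _ _ _ true [:: false; false] _ _ _) (erefl _) _; first by rewrite /upd eqxx.
    apply: run_seq; first by apply: run_conv (run_clear _ _) (erefl _) (leqnn _); rewrite /upd ?eqxx ?ifF //; lia.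
    apply: run_conv (R b _ x _ _) _ (leqnn _).
    + by rewrite /upd !ifF ?sb //; lia.
    + by move=> r br; rewrite /upd; do !case: eqP => //; rewrite se.
    + by store_eq; rewrite s1.
  by rewrite /upd eqxx /=; lia.
- apply: run_conv (@run_case_cons _ _ _ _ _ _ false [::] _ _ _) (erefl _) _; first by rewrite /upd eqxx.
    apply: run_conv (R' b _ x _ _) _ (leqnn _).
    + by rewrite /upd !ifF ?sb //; lia.
    + by move=> r br; rewrite /upd; do !case: eqP => //; rewrite se.
    + by store_eq; rewrite s1.
  by lia.
Qed.

(** The code of [n x] serves as the loop counter, one round per bit. The bound [S] on all
    intermediate values is essential: a polynomial-time [f] may double its argument at each
    round. *)
Lemma pt_iter (n : A -> B) (f : A -> A) (S : A -> nat) : pt n -> pt f -> pb S ->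
  (forall x i, i <= csize (n x) -> csize (iter i f x) <= S x) ->
  pt (fun x => iter (csize (n x)) f x).
Proof.
move=> [Q [k [gc pk pc K]]] [P [h [gf [e ph] ps R]]] pS HS.
exists (fun b => Seq (copy b b.+1 b.+2) (Seq (Q b.+1) (Seq (xfer b b.+2 b.+3)
   (Seq (While b.+1 (P b.+2) (P b.+2)) (xfer b.+2 b b.+3))))),
  (fun x => (10 * csize x + 2) + (k x + ((8 * csize x + 2) +
    ((csize (n x) * ((S x + 2) ^ e).+2 + 1) + (8 * S x + 2))))); split.
- by move=> b /=; rewrite gf gc.
- pbs.
  apply: pb_le (pb_add (pb_pow e (pb_add pS (pb_const 2))) (pb_const 2)) => x.
  by rewrite !addn2.
- by apply: pb_le pS => x; apply: HS.
move=> b s x sb se.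
have s1 := se b.+1 (ltnSn _); have s2 : s b.+2 = [::] by apply: se; lia.
have s3 : s b.+3 = [::] by apply: se; lia.
apply: run_seq; first by apply: run_conv (run_copy _ _ _ s2) (erefl _) _; rewrite ?sb //; lia.
rewrite sb s1 cats0; apply: run_seq.
  apply: K; first by rewrite /upd eqxx.
  by move=> r br; rewrite /upd ifF ?se //; lia.
apply: run_seq.
  apply: run_conv (run_xfer _ _ _ _) (erefl _) _; try lia; rewrite /upd.
  - by rewrite !ifF ?s3 //; lia.
  - by rewrite !ifF ?sb //; lia.
pose F (i : nat) := upd (upd s b [::]) b.+2 (enc (@code A (iter i f x))).
apply: (@run_seq _ _ _ (upd (F (csize (n x))) b.+1 [::])).
  suff G : forall v i, i + size v <= @csize B (n x) ->
      run (While b.+1 (P b.+2) (P b.+2)) (upd (F i) b.+1 v)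
       (upd (F (i + size v)) b.+1 [::]) (size v * ((S x + 2) ^ e).+2 + 1).
    apply: run_eq (G (enc (code (n x))) 0 _) => //.
    by rewrite /F; store_eq; rewrite s2 cats0 sb.
  elim=> [|b' v IH] i lei.
    by rewrite addn0; apply: run_conv (run_while_nil _ _ _) _ _; rewrite // /upd eqxx.
  apply: run_conv (@run_while_cons _ _ _ _ (upd (F i.+1) b.+1 v) _ b' v ((S x + 2) ^ e) _ _ _ (IH i.+1 _)) _ _.
  - by rewrite /upd eqxx.
  - rewrite if_same; apply: run_conv (R b.+2 _ (iter i f x) _ _) _ _.
    + by rewrite /F; upds.
    + by move=> r br; rewrite /F /upd !ifF ?se //; lia.
    + by rewrite /F; store_eq.
    + apply: leq_trans (ph _) _; case: (e) => // e'; rewrite leq_exp2r // leq_add2r HS //.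
      by rewrite /= in lei; lia.
  - by rewrite /= in lei; lia.
  - by rewrite addSnnS.
  - by rewrite /=; lia.
apply: run_conv (run_xfer _ _ _ _) _ _; try lia; rewrite /F.
- by rewrite /upd !ifF ?s3 //; lia.
- by store_eq; rewrite ?cats0 ?s1 ?s2.
- by have := HS x _ (leqnn _); rewrite /upd ifF ?eqxx /csize /tsize; lia.
Qed.
End Closure.

Definition hdT (x : tree) := if x is Node a _ then a else Leaf.
Definition tlT (x : tree) := if x is Node _ b then b else Leaf.
Definition is_node (x : tree) := if x is Node _ _ then true else false.

Lemma pt_hdT : pt hdT.
Proof.
exists (fun b => Case b (Push b false) (Push b false)
   (Seq (split b) (Seq (clear b b.+2) (move_rev b.+1 b)))),
  (fun x => 20 * csize x + 10); split=> //; first by pbs.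
  by apply: pb_le pb_size => -[|a b] //; rewrite /csize /= tsize_node; lia.
move=> b s [|x y] sb se.
  have {}sb : s b = [:: false] := sb.
  apply: run_conv (run_case_false _ _ sb (run_push _ _ _)) _ _ => //.
  by store_eq.
have {}sb : s b = true :: enc x ++ enc y := sb.
have s1 := se b.+1 (ltnSn _); have s2 : s b.+2 = [::] by apply: se; lia.
apply: run_conv (run_case_true _ _ sb _) (erefl _) _.
  rewrite /=; apply: run_seq.
    by apply: (@run_split x _ _ (enc y)); rewrite /upd ?eqxx // !ifF //; lia.
  apply: run_seq.
    by apply: run_conv (run_clear _ _) (erefl _) (leqnn _); rewrite /upd ?ifF //; lia.
  apply: run_conv (run_move_rev _ _) _ (leqnn _); first by lia.
  by store_eq; rewrite ?catrevE ?revK ?cats0 ?s1 //; do !rewrite ifF ?eqxx //; lia.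
by upds; rewrite ?size_rev /csize tsize_node /tsize; lia.
Qed.

Lemma pt_tlT : pt tlT.
Proof.
exists (fun b => Case b (Push b false) (Push b false)
   (Seq (split b) (clear b.+1 b.+2))),
  (fun x => 20 * csize x + 10); split=> //; first by pbs.
  by apply: pb_le pb_size => -[|a b] //; rewrite /csize /= tsize_node; lia.
move=> b s [|x y] sb se.
  have {}sb : s b = [:: false] := sb.
  apply: run_conv (run_case_false _ _ sb (run_push _ _ _)) _ _ => //.
  by store_eq.
have {}sb : s b = true :: enc x ++ enc y := sb.
have s1 := se b.+1 (ltnSn _); have s2 : s b.+2 = [::] by apply: se; lia.
apply: run_conv (run_case_true _ _ sb _) (erefl _) _.
  rewrite /=; apply: run_seq.
    by apply: (@run_split x _ _ (enc y)); rewrite /upd ?eqxx // !ifF //; lia.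
  apply: run_conv (run_clear _ _) _ (leqnn _); rewrite /upd ?ifF //; try lia.
  by store_eq.
by upds; rewrite ?size_rev /csize tsize_node /tsize; lia.
Qed.

Lemma pt_is_node : pt is_node.
Proof.
exists (fun b => Seq (Case b (Push b.+1 false) (Push b.+1 false)
   (Seq (clear b b.+1) (Seq (Push b.+1 false) (Seq (Push b.+1 false) (Push b.+1 true)))))
    (xfer b.+1 b b.+2)),
  (fun x => 3 * csize x + 50); split=> //; first by pbs.
  by apply: pb_le (pb_const 3) => -[|a b].
move=> b s x sb se.
have s1 := se b.+1 (ltnSn _); have s2 : s b.+2 = [::] by apply: se; lia.
apply: run_conv (run_seq (s' := upd (upd s b [::]) b.+1 (enc (code (is_node x)))) (n := 3 * csize x + 10) _ (run_xfer _ _ _ _)) _ _.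
- case: x sb => [|x y] sb.
    have {}sb : s b = [:: false] := sb.
    apply: run_conv (run_case_false _ _ sb (run_push _ _ _)) _ _ => //.
    by store_eq; rewrite s1.
  have {}sb : s b = true :: enc x ++ enc y := sb.
  apply: run_conv (run_case_true _ _ sb _) (erefl _) _.
    rewrite /=; apply: run_seq.
      by apply: run_conv (run_clear _ _) (erefl _) (leqnn _); rewrite /upd ?ifF //; lia.
    apply: run_conv (run_seq (run_push _ _ _) (run_seq (run_push _ _ _) (run_push _ _ _))) _ (leqnn _).
    by store_eq; rewrite s1.
  by rewrite /upd eqxx /csize tsize_node /tsize size_cat; lia.
- by lia.
- by lia.
- by lia.
- by rewrite /upd !ifF //; lia.
- by store_eq; rewrite ?cats0 ?s1.
- by rewrite /upd eqxx; case: (x) => [|? ?] /=; lia.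
Qed.

Lemma pt_of_tree {A B : ctype} (F : tree -> tree) (f : A -> B) :
  pt F -> (forall x, F (code x) = code (f x)) -> pt f.
Proof.
move=> pF E; apply: (pt_recode (f := fun x => F (code x))) => //.
exact: (pt_redomain (i := @code A)).
Qed.

Lemma pt_fst {A B C : ctype} (f : A -> B * C) : pt f -> pt (fun x => (f x).1).
Proof.
by move=> pf; apply: pt_comp pf _; exact: pt_of_tree pt_hdT _.
Qed.

Lemma pt_snd {A B C : ctype} (f : A -> B * C) : pt f -> pt (fun x => (f x).2).
Proof.
by move=> pf; apply: pt_comp pf _; exact: pt_of_tree pt_tlT _.
Qed.

Lemma pt_behead {A B : ctype} (f : A -> seq B) : pt f -> pt (fun x => behead (f x)).
Proof. by move=> pf; apply: pt_comp pf _; apply: pt_of_tree pt_tlT _ => -[]. Qed.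

Lemma pt_nilp {A B : ctype} (f : A -> seq B) : pt f -> pt (fun x => nilp (f x)).
Proof.
move=> pf; apply: pt_comp pf _.
have p1 : pt (fun s : seq B => is_node (code s)).
  exact: (pt_redomain (i := @code (seq_ctype B))) pt_is_node.
apply: (pt_recode (f := fun s : seq B => if is_node (code s) then false else true)).
  by case.
by apply: pt_if => //; apply: pt_const.
Qed.

Lemma pt_cons {A B : ctype} (f : A -> B) (g : A -> seq B) : pt f -> pt g -> pt (fun x => f x :: g x).
Proof. by move=> pf pg; apply: pt_recode (pt_pair pf pg). Qed.


Lemma pt_head {A B : ctype} (d : A -> B) (f : A -> seq B) : pt d -> pt f -> pt (fun x => head (d x) (f x)).
Proof.
move=> pd pf.
apply: (pt_recode (f := fun x => if nilp (f x) then code (d x) else hdT (code (f x)))).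
  by move=> x; case: (f x).
apply: pt_if; first exact: pt_nilp.
  exact: (pt_recode (f := d)).
by apply: pt_comp pt_hdT; exact: (pt_recode (f := f)).
Qed.

Lemma pt_negb {A : ctype} (f : A -> bool) : pt f -> pt (fun x => ~~ f x).
Proof. by move=> pf; apply: pt_if pf (pt_const _) (pt_const _). Qed.

Lemma pt_andb {A : ctype} (f g : A -> bool) : pt f -> pt g -> pt (fun x => f x && g x).
Proof. by move=> pf pg; apply: pt_if pf pg (pt_const _). Qed.

Lemma pt_orb {A : ctype} (f g : A -> bool) : pt f -> pt g -> pt (fun x => f x || g x).
Proof. by move=> pf pg; apply: pt_if pf (pt_const _) pg. Qed.

Lemma pt_eqb {A : ctype} (f g : A -> bool) : pt f -> pt g -> pt (fun x => f x == g x).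
Proof.
move=> pf pg; apply: (pt_recode (f := fun x => if f x then g x else ~~ g x)).
  by move=> x; case: (f x); case: (g x).
by apply: pt_if pf pg (pt_negb pg).
Qed.

Lemma csize_cons {A : ctype} (x : A) s : csize (x :: s) = (csize x + csize s).+1.
Proof. by rewrite /csize tsize_node. Qed.

Lemma csize_pair {A B : ctype} (x : A) (y : B) :
  csize (x, y) = (csize x + csize y).+1.
Proof. by rewrite /csize tsize_node. Qed.

Lemma size_csize {A : ctype} (s : seq A) : size s < csize s.
Proof. by elim: s => //= x s IH; rewrite csize_cons; lia. Qed.

Lemma csize_cat {A : ctype} (s t : seq A) : csize (s ++ t) + 1 = csize s + csize t.
Proof. by elim: s => [|x s IH] /=; rewrite ?csize_cons; [rewrite /csize /tsize /=; lia|lia]. Qed.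

Lemma csize_drop {A : ctype} (s : seq A) i : csize (drop i s) <= csize s.
Proof.
have := csize_cat (take i s) (drop i s); rewrite cat_take_drop.
by have := size_csize (take i s); lia.
Qed.

Lemma csize_behead {A : ctype} (s : seq A) : csize (behead s) <= csize s.
Proof. by case: s => //= x s; rewrite csize_cons; lia. Qed.

Lemma csize_nat n : csize n = n.*2.+1.
Proof.
elim: n => // n IH; rewrite /csize in IH *.
rewrite (_ : code n.+1 = Node Leaf (code n)) // tsize_node IH /tsize /=; lia.
Qed.

Section Fold.
Context {A B S : ctype}.
Variables (f : A -> B -> S -> S) (q : A * B -> nat) (b0 : B).

(** Idle on the empty list: the number of rounds is the code size of the list, which exceeds its
    length. *)
Let step (u : A * (seq B * S)) : A * (seq B * S) :=
  (u.1, if nilp u.2.1 then u.2 else (behead u.2.1, f u.1 (head b0 u.2.1) u.2.2)).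

Lemma iter_fold_step k x s acc : iter k step (x, (s, acc)) =
    (x, (drop k s, foldl (fun a b => f x b a) acc (take k s))).
Proof.
elim: k s acc => [|k IH] s acc; first by rewrite take0 drop0.
by rewrite iterSr; case: s => [|b s]; rewrite /step /= IH.
Qed.

Lemma pt_fold_step : pt (fun u : A * (B * S) => f u.1 u.2.1 u.2.2) -> pt step.
Proof.
move=> pf; apply: pt_pair; first exact: pt_fst pt_id.
apply: pt_if; [exact: pt_nilp (pt_fst (pt_snd pt_id))|exact: pt_snd pt_id|].
apply: pt_pair; first exact: pt_behead (pt_fst (pt_snd pt_id)).
apply: (pt_comp (f := fun u : A * (seq B * S) => (u.1, (head b0 u.2.1, u.2.2)))) pf.
apply: pt_pair; first exact: pt_fst pt_id.
apply: pt_pair; last exact: pt_snd (pt_snd pt_id).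
exact: pt_head (pt_const b0) (pt_fst (pt_snd pt_id)).
Qed.

Lemma csize_foldl x N c s acc :
  (forall b a, csize b <= N -> csize (f x b a) <= csize a + c) ->
  all (fun b => csize b <= N) s ->
  csize (foldl (fun a b => f x b a) acc s) <= csize acc + size s * c.
Proof.
move=> H; elim: s acc => [|b s IH] acc /=; first by rewrite addn0.
move=> /andP[bN /IH]; move/(_ (f x b acc)) => le; apply: leq_trans le _.
by have := H b acc bN; rewrite mulSn; lia.
Qed.

Lemma all_csize (s : seq B) N : csize s <= N -> all (fun b => csize b <= N) s.
Proof. by elim: s => //= b s IH; rewrite csize_cons => le; rewrite IH; lia. Qed.

(** A step may enlarge the accumulator only by an amount that does not depend on the accumulator;
    the total growth is then at most the length times a polynomial. *)
Lemma pt_foldl_inhabited (l : A -> seq B) (s0 : A -> S) :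
  pt (fun u : A * (B * S) => f u.1 u.2.1 u.2.2) -> pb q ->
  (forall x b s, csize (f x b s) <= csize s + q (x, b)) ->
  pt l -> pt s0 -> pt (fun x => foldl (fun s b => f x b s) (s0 x) (l x)).
Proof.
move=> pf [c pq] Hq pl ps.
(* Every element [b] of the list has [csize (x, b)] at most [csize u], so [(csize u + 2) ^ c] bounds
   each increment. *)
pose S0 (u : A * (seq B * S)) := csize u + csize u * (csize u + 2) ^ c.
have pS : pb S0.
  apply: pb_add pb_size (pb_mul pb_size (pb_pow c (pb_add pb_size (pb_const 2)))).
have HS : forall u i, csize (iter i step u) <= S0 u.
  case=> x [s acc] i; rewrite iter_fold_step /S0.
  set K := (_ ^ c).
  have H : csize (foldl (fun a b => f x b a) acc (take i s)) <= csize acc + size (take i s) * K.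
    apply: (@csize_foldl _ (csize s)) => [b a le|]; last first.
      have: all (fun b => csize b <= csize s) s by exact: all_csize.
      by rewrite -{2}(cat_take_drop i s) all_cat => /andP[].
    apply: leq_trans (Hq _ _ _) _; rewrite leq_add2l; apply: leq_trans (pq _) _.
    by rewrite /K; case: (c) => // c'; rewrite leq_exp2r // !csize_pair; lia.
  have : size (take i s) * K <= csize (x, (s, acc)) * K.
    rewrite leq_mul2r; apply/orP; right; rewrite !csize_pair size_take_min.
    by have := size_csize s; lia.
  by rewrite !csize_pair; have := csize_drop s i; lia.
apply: (pt_recode (f := fun x => (iter (csize (l x)) step (x, (l x, s0 x))).2.2)).
  move=> x; rewrite iter_fold_step /= take_oversize //.
  exact: ltnW (size_csize _).
apply: pt_snd; apply: pt_snd.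
apply: (pt_comp (f := fun x => (x, (l x, s0 x)))
  (g := fun u : A * (seq B * S) => iter (csize u.2.1) step u)).
  by apply: pt_pair; [exact: pt_id|exact: pt_pair].
apply: (pt_iter (n := fun u : A * (seq B * S) => u.2.1)) pS _ => //.
  exact: pt_fst (pt_snd pt_id).
exact: pt_fold_step.
Qed.
End Fold.

(** A default element for [head] exists unless [B] is empty, and then the list is empty and the fold
    returns [s0]. *)
Lemma pt_foldl {A B S : ctype}
    (f : A -> B -> S -> S) (q : A * B -> nat) (l : A -> seq B) (s0 : A -> S) :
  pt (fun u : A * (B * S) => f u.1 u.2.1 u.2.2) -> pb q ->
  (forall x b s, csize (f x b s) <= csize s + q (x, b)) ->
  pt l -> pt s0 -> pt (fun x => foldl (fun s b => f x b s) (s0 x) (l x)).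
Proof.
case: (pselect (inhabited B)) => [[b0]|nB]; first exact: pt_foldl_inhabited.
move=> _ _ _ _ ps; apply: (pt_recode (f := s0)) ps => x.
by case: (l x) => // b; case: nB.
Qed.


Lemma pt_catrev {A B : ctype} (f g : A -> seq B) : pt f -> pt g -> pt (fun x => catrev (f x) (g x)).
Proof.
move=> pf pg.
apply: (pt_recode (f := fun x => foldl (fun s b => b :: s) (g x) (f x))).
  by move=> x; congr code; elim: (f x) (g x) => //= b s IH t; rewrite IH.
apply: (pt_foldl (f := fun _ b s => b :: s) (q := fun u => csize u)) pf pg.
- by apply: pt_cons; [apply: pt_fst; apply: pt_snd; exact: pt_id|exact: pt_snd (pt_snd pt_id)].
- exact: pb_size.
- by move=> x b s; rewrite csize_cons csize_pair; lia.
Qed.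

Lemma pt_rev {A B : ctype} (f : A -> seq B) : pt f -> pt (fun x => rev (f x)).
Proof. by move=> pf; apply: pt_catrev pf (pt_const _). Qed.

Lemma pt_cat {A B : ctype} (f g : A -> seq B) : pt f -> pt g -> pt (fun x => f x ++ g x).
Proof.
move=> pf pg; apply: (pt_recode (f := fun x => catrev (rev (f x)) (g x))).
  by move=> x; rewrite catrevE revK.
by apply: pt_catrev pg; apply: pt_rev.
Qed.

Lemma pt_map {A B C : ctype} (f : A -> B -> C) (l : A -> seq B) :
  pt (fun u : A * B => f u.1 u.2) -> pt l -> pt (fun x => [seq f x b | b <- l x]).
Proof.
move=> pf pl.
apply: (pt_recode (f := fun x => rev (foldl (fun s b => f x b :: s) [::] (l x)))).
  move=> x; congr code; rewrite -[RHS]/(rev [::] ++ _).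
  by elim: (l x) [::] => [|b s IH] t /=; rewrite ?cats0 // IH rev_cons cat_rcons.
apply: pt_rev.
apply: (pt_foldl (f := fun x b s => f x b :: s) (q := fun u => csize (f u.1 u.2) + 1)) pl (pt_const _).
- apply: pt_cons; last exact: pt_snd (pt_snd pt_id).
  apply: (pt_comp (f := fun u : A * (B * seq C) => (u.1, u.2.1))) pf.
  by apply: pt_pair; [exact: pt_fst pt_id|apply: pt_fst; exact: pt_snd pt_id].
- by apply: pb_add (pt_size pf) (pb_const _).
- by move=> x b s; rewrite csize_cons /=; lia.
Qed.

Lemma pt_flatten {A B : ctype} (f : A -> seq (seq B)) : pt f -> pt (fun x => flatten (f x)).
Proof.
move=> pf; apply: (pt_recode (f := fun x => foldl (fun s b => s ++ b) [::] (f x))).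
  move=> x; congr code; rewrite -[RHS]/([::] ++ _).
  by elim: (f x) [::] => [|b s IH] t /=; rewrite ?cats0 // IH catA.
apply: (pt_foldl (f := fun x b s => s ++ b) (q := fun u => csize u)) pf (pt_const _).
- by apply: pt_cat; [exact: pt_snd (pt_snd pt_id)|apply: pt_fst; exact: pt_snd pt_id].
- exact: pb_size.
- by move=> x b s; have := csize_cat s b; rewrite csize_pair; lia.
Qed.

Section Derived.
Variable A : ctype.
Implicit Types (B C : ctype) (n m : A -> nat).

Lemma pt_filter B (p : A -> B -> bool) (l : A -> seq B) :
  pt (fun u : A * B => p u.1 u.2) -> pt l -> pt (fun x => [seq b <- l x | p x b]).
Proof.
move=> pp pl.
apply: (pt_recode (f := fun x => flatten [seq (if p x b then [:: b] else [::]) | b <- l x])).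
  by move=> x; congr code; elim: (l x) => //= b s <-; case: (p x b).
apply: pt_flatten; apply: (pt_map (f := fun x b => if p x b then [:: b] else [::])) pl.
apply: pt_if pp _ (pt_const _).
by apply: pt_cons (pt_const _); exact: pt_snd pt_id.
Qed.

Lemma pt_has B (p : A -> B -> bool) (l : A -> seq B) :
  pt (fun u : A * B => p u.1 u.2) -> pt l -> pt (fun x => has (p x) (l x)).
Proof.
move=> pp pl; apply: (pt_recode (f := fun x => ~~ nilp [seq b <- l x | p x b])).
  by move=> x; congr code; elim: (l x) => //= b s IH; case: (p x b).
by apply: pt_negb; apply: pt_nilp; apply: pt_filter.
Qed.

Lemma pt_all B (p : A -> B -> bool) (l : A -> seq B) :
  pt (fun u : A * B => p u.1 u.2) -> pt l -> pt (fun x => all (p x) (l x)).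
Proof.
move=> pp pl; apply: (pt_recode (f := fun x => ~~ has (fun b => ~~ p x b) (l x))).
  by move=> x; rewrite -all_predC; congr code; apply: eq_all => b /=; rewrite negbK.
by apply: pt_negb; apply: (pt_has (p := fun x b => ~~ p x b)) pl; apply: pt_negb.
Qed.

Lemma pt_size_seq B (l : A -> seq B) : pt l -> pt (fun x => size (l x)).
Proof.
move=> pl; apply: (pt_recode (f := fun x => [seq tt | _ <- l x])); last first.
  by apply: pt_map pl; apply: pt_const.
by move=> x; elim: (l x) => //= b s IH; rewrite /code /= /code_seq /= in IH *; rewrite IH.
Qed.

Lemma code_nseq (k : nat) : code (nseq k tt) = code k.
Proof. by elim: k => //= k IH; rewrite /code /= /code_seq /= in IH *; rewrite IH. Qed.

Lemma pt_nseq_tt n : pt n -> pt (fun x => nseq (n x) tt).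
Proof. by move=> pn; apply: (pt_recode (f := n)) => // x; rewrite code_nseq. Qed.

Lemma pt_nat_of_seq n : pt (fun x => nseq (n x) tt) -> pt n.
Proof. by apply: pt_recode => x; rewrite code_nseq. Qed.

Lemma pt_drop B n (l : A -> seq B) : pt n -> pt l -> pt (fun x => drop (n x) (l x)).
Proof.
move=> pn pl; apply: (pt_recode (f := fun x => foldl (fun s _ => behead s) (l x) (nseq (n x) tt))).
  move=> x; congr code; elim: (n x) (l x) => [|k IH] s /=; first by rewrite drop0.
  by rewrite IH; case: s => [|b s] //=; case: k {IH}.
apply: (pt_foldl (f := fun x b s => behead s) (q := fun=> 0)) (pt_nseq_tt pn) pl.
- by apply: pt_behead; exact: pt_snd (pt_snd pt_id).
- exact: pb_const.
- by move=> x b s; rewrite addn0 csize_behead.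
Qed.

Lemma pt_nth B n (d : A -> B) (l : A -> seq B) :
  pt d -> pt l -> pt n -> pt (fun x => nth (d x) (l x) (n x)).
Proof.
move=> pd pl pn; apply: (pt_recode (f := fun x => head (d x) (drop (n x) (l x)))).
  by move=> x; rewrite -nth0 nth_drop addn0.
by apply: pt_head pd _; apply: pt_drop.
Qed.

Lemma pt_addn n m : pt n -> pt m -> pt (fun x => n x + m x).
Proof.
move=> pn pm; apply: pt_nat_of_seq.
apply: (pt_recode (f := fun x => nseq (n x) tt ++ nseq (m x) tt)).
  by move=> x; rewrite nseqD.
by apply: pt_cat; apply: pt_nseq_tt.
Qed.

Lemma pt_subn n m : pt n -> pt m -> pt (fun x => n x - m x).
Proof.
move=> pn pm; apply: pt_nat_of_seq.
apply: (pt_recode (f := fun x => drop (m x) (nseq (n x) tt))).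
  by move=> x; rewrite drop_nseq.
by apply: pt_drop pm _; apply: pt_nseq_tt.
Qed.

Lemma pt_nseq B n (f : A -> B) : pt n -> pt f -> pt (fun x => nseq (n x) (f x)).
Proof.
move=> pn pf; apply: (pt_recode (f := fun x => [seq f x | _ <- nseq (n x) tt])).
  by move=> x; rewrite map_nseq.
apply: (pt_map (f := fun x _ => f x)) (pt_nseq_tt pn).
by apply: (pt_comp (f := fst)) pf; exact: pt_fst pt_id.
Qed.

Lemma pt_muln n m : pt n -> pt m -> pt (fun x => n x * m x).
Proof.
move=> pn pm; apply: pt_nat_of_seq.
apply: (pt_recode (f := fun x => flatten (nseq (n x) (nseq (m x) tt)))).
  by move=> x; elim: (n x) => //= k; rewrite mulSn nseqD /code /= /code_seq !foldr_cat => ->.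
by apply: pt_flatten; apply: pt_nseq pn _; apply: pt_nseq_tt.
Qed.

Lemma pt_expn n k : pt n -> pt (fun x => n x ^ k).
Proof.
move=> pn; elim: k => [|k IH]; first exact: pt_const.
by apply: (pt_recode (f := fun x => n x * n x ^ k)) (pt_muln pn IH) => x; rewrite expnS.
Qed.

Lemma pt_leq n m : pt n -> pt m -> pt (fun x => n x <= m x).
Proof.
move=> pn pm; apply: (pt_recode (f := fun x => nilp (nseq (n x - m x) tt))).
  by move=> x; rewrite /nilp size_nseq.
by apply: pt_nilp; apply: pt_nseq_tt; apply: pt_subn.
Qed.

Lemma pt_succn n : pt n -> pt (fun x => (n x).+1).
Proof.
by move=> pn; apply: (pt_recode (f := fun x => (tt, n x))) (pt_pair (pt_const tt) pn).
Qed.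

Lemma pt_eqn n m : pt n -> pt m -> pt (fun x => n x == m x).
Proof.
move=> pn pm; apply: (pt_recode (f := fun x => (n x <= m x) && (m x <= n x))).
  by move=> x; rewrite -eqn_leq.
by apply: pt_andb; apply: pt_leq.
Qed.

End Derived.

Lemma pt_mem_nat {A : ctype} (n : A -> nat) (l : A -> seq nat) :
  pt n -> pt l -> pt (fun x => n x \in l x).
Proof.
move=> pn pl; apply: (pt_recode (f := fun x => has (fun k => n x == k) (l x))).
  by move=> x; congr code; rewrite -has_pred1; apply: eq_has => k /=; exact: eq_sym.
apply: (pt_has (p := fun x k => n x == k)) pl.
by apply: pt_eqn (pt_snd pt_id); apply: pt_comp pn; exact: pt_fst pt_id.
Qed.

Lemma pt_take {A B : ctype} (n : A -> nat) (l : A -> seq B) :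
  pt n -> pt l -> pt (fun x => take (n x) (l x)).
Proof.
move=> pn pl; apply: (pt_recode (f := fun x => rev (drop (size (l x) - n x) (rev (l x))))).
  move=> x; rewrite drop_rev revK; congr code; case: (leqP (n x) (size (l x))) => [le|lt].
    by rewrite subKn.
  by rewrite (eqP (ltnW lt : _ - _ == 0)) subn0 take_size take_oversize // ltnW.
apply: pt_rev; apply: pt_drop; last exact: pt_rev.
by apply: pt_subn pn; apply: pt_size_seq.
Qed.

Lemma pt_iota {A : ctype} (n : A -> nat) : pt n -> pt (fun x => iota 0 (n x)).
Proof.
move=> pn; apply: (pt_recode (f := fun x =>
   foldl (fun s _ => n x - (size s).+1 :: s) [::] (nseq (n x) tt))).
  move=> x; congr code; move: (n x) => k.
  suff H i : i <= k -> foldl (fun s _ => k - (size s).+1 :: s) [::] (nseq i tt) = iota (k - i) i.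
    by rewrite H // subnn.
  elim: i => [|i IH] lei //.
  have -> : nseq i.+1 tt = nseq i tt ++ [:: tt] by rewrite -[[:: tt]]/(nseq 1 tt) -nseqD addn1.
  rewrite foldl_cat /= IH; last exact: ltnW.
  by rewrite size_iota; congr (_ :: iota _ _); lia.
apply: (pt_foldl (f := fun x (_ : unit) s => n x - (size s).+1 :: s) (q := fun u => csize (n u.1) + 1)) (pt_nseq_tt pn) (pt_const _).
- have pn' : pt (fun u : A * (unit * seq nat) => n u.1).
    by apply: (pt_comp (f := fst)) pn; exact: pt_fst pt_id.
  apply: pt_cons; last exact: pt_snd (pt_snd pt_id).
  apply: pt_subn pn' _; apply: pt_succn; apply: pt_size_seq; exact: pt_snd (pt_snd pt_id).
- apply: pb_add (pb_const _); apply: (pb_comp (h := fun y => csize (n y))) (pt_size pn).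
  by apply: pb_le pb_size => -[x y]; rewrite csize_pair /=; lia.
- by move=> x b s; rewrite csize_cons !csize_nat /=; lia.
Qed.

Lemma pt_sumn {A : ctype} (l : A -> seq nat) : pt l -> pt (fun x => sumn (l x)).
Proof.
move=> pl; apply: (pt_recode (f := fun x => foldl (fun s k => s + k) 0 (l x))).
  by move=> x; rewrite sumnE -foldl_idx /= ?big_cons; congr code; elim: (l x) 0.
apply: (pt_foldl (f := fun x k s => s + k) (q := fun u => csize u)) pl (pt_const _).
- by apply: pt_addn; [exact: pt_snd (pt_snd pt_id)|exact: pt_fst (pt_snd pt_id)].
- exact: pb_size.
- by move=> x b s; rewrite csize_pair !csize_nat; lia.
Qed.

(** Polynomial time is read off the syntax of the function. A bound variable, as under [map] or
    [all], is paired with the environment; functions already known to be in [pt] are taken from the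
    context. *)
Ltac pt_step := match goal with
  | H : pt ?f |- pt ?f => exact: H
  | |- pt (fun x => x) => exact: pt_id
  | |- pt (fun x => ?c) => exact: (pt_const c)
  | H : pt ?f |- pt (fun x => ?f x) => exact: H
  | H : pt (fun u => ?f u.1 u.2) |- pt (fun x => ?f (@?a x) (@?b x)) =>
      apply: (pt_comp (f := fun x => (a x, b x))) H
  | |- pt (fun x => (@?f x).1) => apply: (pt_fst (f := f))
  | |- pt (fun x => (@?f x).2) => apply: (pt_snd (f := f))
  | |- pt (fun x => (@?f x, @?g x)) => apply: (pt_pair (f := f) (g := g))
  | |- pt (fun x => (@?f x) :: (@?g x)) => apply: (pt_cons (f := f) (g := g))
  | |- pt (fun x => (@?f x) ++ (@?g x)) => apply: (pt_cat (f := f) (g := g))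
  | |- pt (fun x => if _ then _ else _) => apply: pt_if
  | |- pt (fun x => ~~ (@?f x)) => apply: (pt_negb (f := f))
  | |- pt (fun x => (@?f x) && (@?g x)) => apply: (pt_andb (f := f) (g := g))
  | |- pt (fun x => (@?f x) || (@?g x)) => apply: (pt_orb (f := f) (g := g))
  | |- pt (fun x => (@?f x) == (@?g x) :> bool) => apply: (pt_eqb (f := f) (g := g))
  | |- pt (fun x => (@?f x) == (@?g x) :> nat) => apply: (pt_eqn (n := f) (m := g))
  | |- pt (fun x => (@?f x) <= (@?g x)) => apply: (pt_leq (n := f) (m := g))
  | |- pt (fun x => (@?f x) + (@?g x)) => apply: (pt_addn (n := f) (m := g))
  | |- pt (fun x => (@?f x) - (@?g x)) => apply: (pt_subn (n := f) (m := g))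
  | |- pt (fun x => (@?f x) * (@?g x)) => apply: (pt_muln (n := f) (m := g))
  | |- pt (fun x => expn (@?f x) ?k) => apply: (pt_expn (n := f))
  | |- pt (fun x => (@?f x).+1) => apply: (pt_succn (n := f))
  | |- pt (fun x => size (@?f x)) => apply: (pt_size_seq (l := f))
  | |- pt (fun x => sumn (@?f x)) => apply: (pt_sumn (l := f))
  | |- pt (fun x => iota 0 (@?f x)) => apply: (pt_iota (n := f))
  | |- pt (fun x => rev (@?f x)) => apply: (pt_rev (f := f))
  | |- pt (fun x => behead (@?f x)) => apply: (pt_behead (f := f))
  | |- pt (fun x => nilp (@?f x)) => apply: (pt_nilp (f := f))
  | |- pt (fun x => flatten (@?f x)) => apply: (pt_flatten (f := f))
  | |- pt (fun x => take (@?n x) (@?f x)) => apply: (pt_take (n := n) (l := f))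
  | |- pt (fun x => drop (@?n x) (@?f x)) => apply: (pt_drop (n := n) (l := f))
  | |- pt (fun x => nseq (@?n x) (@?f x)) => apply: (pt_nseq (n := n) (f := f))
  | |- pt (fun x => head (@?d x) (@?f x)) => apply: (pt_head (d := d) (f := f))
  | |- pt (fun x => nth (@?d x) (@?f x) (@?n x)) => apply: (pt_nth (d := d) (l := f) (n := n))
  | |- pt (fun x => map (@?p x) (@?f x)) => apply: (pt_map (f := p) (l := f))
  | |- pt (fun x => seq.filter (@?p x) (@?f x)) => apply: (pt_filter (p := p) (l := f))
  | |- pt (fun x => has (@?p x) (@?f x)) => apply: (pt_has (p := p) (l := f))
  | |- pt (fun x => all (@?p x) (@?f x)) => apply: (pt_all (p := p) (l := f))
  | |- pt (fun x => (@?f x) \in (@?g x)) => apply: (pt_mem_nat (n := f) (l := g))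
  | H : pt ?f |- pt (fun x => ?f (@?g x)) => apply: (pt_comp (f := g)) H
  end; cbv beta.
Ltac pts := repeat pt_step.

Lemma eqseq_all (T : eqType) (d : T) (s t : seq T) :
  (s == t) = (size s == size t) && all (fun i => nth d s i == nth d t i) (iota 0 (size s)).
Proof.
apply/eqP/andP => [->|[/eqP sz /allP H]]; first by split=> //; apply/allP.
by apply: (@eq_from_nth _ d) => // i li; apply/eqP/H; rewrite mem_iota.
Qed.

Lemma pt_eq_bits {A : ctype} (f g : A -> seq bool) : pt f -> pt g -> pt (fun x => f x == g x).
Proof.
move=> pf pg; apply: (pt_recode (f := fun x => (size (f x) == size (g x)) &&
   all (fun i => nth true (f x) i == nth true (g x) i) (iota 0 (size (f x))))).
  by move=> x; rewrite (eqseq_all true).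
by pts.
Qed.

Lemma uniq_all (T : eqType) (d : T) (s : seq T) :
  uniq s = all (fun i => all (fun j => (j <= i) || ~~ (nth d s i == nth d s j))
     (iota 0 (size s))) (iota 0 (size s)).
Proof.
apply/idP/allP => [us i|H].
  rewrite mem_iota => /andP[_ li]; apply/allP => j; rewrite mem_iota => /andP[_ lj].
  by case: leqP => //= ij; rewrite nth_uniq // ltn_eqF.
apply/(uniqP d) => i j li lj /eqP E.
have {}H a b : a < size s -> b < size s -> nth d s a == nth d s b -> b <= a.
  move=> la lb ab; have := H a; rewrite mem_iota la => /(_ isT) /allP/(_ b).
  by rewrite mem_iota lb ab orbF => /(_ isT).
by apply/eqP; rewrite eqn_leq (H j i) ?(H i j) // eq_sym.
Qed.

Lemma pt_uniq_bits {A : ctype} (f : A -> seq (seq bool)) : pt f -> pt (fun x => uniq (f x)).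
Proof.
move=> pf; apply: (pt_recode (f := fun x =>
  all (fun i => all (fun j => (j <= i) || ~~ (nth [::] (f x) i == nth [::] (f x) j))
     (iota 0 (size (f x)))) (iota 0 (size (f x))))).
  by move=> x; rewrite (uniq_all [::]).
pts; apply: pt_eq_bits; pts.
Qed.

(** * From programs on codes to machines on words *)

Definition load :=
  Seq (move_rev 0 1) (Seq (Push 0 false)
    (While 1 (Seq (Push 0 false) (Push 0 true))
       (Seq (Push 0 false) (Seq (Push 0 false) (Seq (Push 0 true) (Push 0 true)))))).

Definition empty_store : store := fun=> [::].

(** The loop conses each bit as a node followed by its code: [true] becomes
    [[:: true; true; false; false]] and [false] becomes [[:: true; false]]. The list is built from
    its end, hence the reversal beforehand. *)
Lemma run_load w :
  run load (word_store w) (upd empty_store 0 (enc (code w))) (20 * size w + 10).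
Proof.
have loop v : forall (t : seq bool), run (While 1 (Seq (Push 0 false) (Push 0 true))
    (Seq (Push 0 false) (Seq (Push 0 false) (Seq (Push 0 true) (Push 0 true)))))
   (upd (upd empty_store 0 (enc (code t))) 1 v)
   (upd empty_store 0 (enc (code (catrev v t)))) (10 * size v + 1).
  elim: v => [|b v IH] t.
    by apply: run_conv (run_while_nil _ _ _) _ _ => //; store_eq.
  apply: run_conv (@run_while_cons _ _ _ _
    (upd (upd empty_store 0 (enc (code (b :: t)))) 1 v) _ b v 8 _ _ _ (IH (b :: t))) _ _ => //.
    case: b.
      by apply: run_conv (run_seq (run_push _ _ _) (run_seq (run_push _ _ _)
        (run_seq (run_push _ _ _) (run_push _ _ _)))) _ _ => //; store_eq.
    by apply: run_conv (run_seq (run_push _ _ _) (run_push _ _ _)) _ _ => //; store_eq.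
  by rewrite /=; lia.
apply: run_conv (run_seq (run_move_rev _ _) (run_seq (run_push _ _ _) (run_eq _ (loop (rev w) [::])))) _ _ => //.
- by rewrite /word_store; store_eq; rewrite catrevE cats0.
- by rewrite catrevE revK cats0.
- by rewrite /word_store /= size_rev; lia.
Qed.

Definition pop r t := Case r (nop t) (nop t) (nop t).

Lemma run_pop r t s b v : r != t -> s r = b :: v -> s t = [::] -> run (pop r t) s (upd s r v) 3.
Proof.
move=> rt sr st; apply: run_conv (@run_case_cons _ _ _ _ _ _ _ _ 1 sr _) (erefl _) _ => //.
by rewrite if_same; apply: run_while_nil; rewrite /upd eq_sym (negbTE rt).
Qed.

Definition unload :=
  While 0 (nop 2) (Case 0 (nop 2) (Push 1 false) (Seq (pop 0 2) (Seq (pop 0 2) (Push 1 true)))).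

Lemma run_unload (v : seq bool) s : s 0 = enc (code v) -> s 2 = [::] ->
  run unload s (upd (upd s 0 [::]) 1 (catrev v (s 1))) (12 * size v + 5).
Proof.
elim: v s => [|b v IH] s s0 s2.
  apply: run_conv (@run_while_cons _ _ _ _ (upd s 0 [::]) _ false [::] 1 1 s0 _ _) (erefl _) _ => //.
    exact: run_while_nil.
  apply: run_conv (run_while_nil _ _ _) _ _ => //; store_eq.
have s0' : s 0 = true :: enc (code b) ++ enc (code v) := s0.
apply: run_conv (@run_while_cons _ _ _ _ (upd (upd s 0 (enc (code v))) 1 (b :: s 1)) _ true _ 10 _ s0' _ (IH _ _ _)) _ _ => //.
- case: b s0 s0' => _ _.
    apply: run_conv (@run_case_true _ _ _ _ _ _ _ _ _ (run_seq (@run_pop _ _ _ false ([:: false] ++ enc (code v)) _ _ _)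
       (run_seq (@run_pop _ _ _ false (enc (code v)) _ _ _) (run_push _ _ _)))) _ _ => //.
    by store_eq.
  apply: run_conv (@run_case_false _ _ _ _ _ _ _ _ _ (run_push _ _ _)) _ _ => //.
  by store_eq.
- by store_eq.
- by rewrite /=; lia.
Qed.

Lemma csize_bits (w : seq bool) : csize w + 2 <= 4 * size w + 3.
Proof.
elim: w => // b w IH; rewrite csize_cons /=.
have: csize b <= 3 by case: b.
lia.
Qed.

Theorem pt_poly_time_function (f : seq bool -> seq bool) : pt f -> poly_time_function f.
Proof.
move=> [P [h [gf ph ps R]]].
pose c0 := Seq load (Seq (P 0) unload).
(* The output is expected on the last tape, so [K] exceeds all other registers; the final [move_rev]
   also undoes the reversal made by [unload]. *)
pose K := (maxn (max_reg c0) 1).+1.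
have K2 : 1 < K by rewrite /K ltnS leq_maxr.
have [e He] : pb (fun w : seq bool => (20 * csize w + 10) + (h w + (12 * csize (f w) + 5)) + (4 * csize (f w) + 1)) by pbs.
apply: (@program_poly_time_function f (Seq c0 (move_rev 1 K)) K e).
- by rewrite /= gf.
- change (maxn (max_reg c0) (maxn 1 (maxn K K)) <= K).
  by rewrite geq_max leqW ?leq_maxl // !geq_max leqnn (ltnW K2).
move=> w o.
have R1 : run c0 (word_store w) (upd empty_store 1 (rev (f w)))
   ((20 * size w + 10) + (h w + (12 * size (f w) + 5))).
  apply: run_seq (run_load w) (run_seq (R 0 _ w _ _) (run_conv (run_unload _ _) _ (leqnn _))).
  - by [].
  - by case.
  - by [].
  - by [].
  - by store_eq; rewrite catrevE cats0.
have R2 := run_seq R1 (@run_move_rev 1 K _ _).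
have [|t E le] := R2 _ 0; first by rewrite neq_ltn K2.
exists t, (upd (upd (upd empty_store 1 (rev (f w))) 1 [::]) K
   (catrev (upd empty_store 1 (rev (f w)) 1) (upd empty_store 1 (rev (f w)) K))); split.
- exact: E.
- apply: leq_trans (_ : (csize w + 2) ^ e <= _); last first.
    by case: (e) => // e'; rewrite leq_exp2r ?csize_bits.
  apply: leq_trans (He w); apply: leq_trans le _.
  have := size_csize w; have := size_csize (f w).
  by rewrite /upd /= size_rev; lia.
- by rewrite /upd /= eqxx catrevE revK ifF ?cats0 //; lia.
Qed.

(** * Guessing certificates *)

Lemma exec_det o c t s t1 s1 : exec o c t s t1 s1 ->
  forall t2 s2, exec o c t s t2 s2 -> t1 = t2 /\ s1 = s2.
Proof.
elim=> {c t s t1 s1}.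
- by move=> r b t s t2 s2 E; inversion E; subst.
- by move=> r t s t2 s2 E; inversion E; subst.
- move=> c d t s t' s' t'' s'' _ IH1 _ IH2 t2 s2 E; inversion E; subst.
  match goal with H : exec o c _ _ _ _ |- _ => have [? ?] := IH1 _ _ H end; subst.
  match goal with H : exec o d _ _ _ _ |- _ => exact: IH2 H end.
- move=> r ce cf ct t s t' s' sr _ IH t2 s2 E; inversion E; subst; last by congruence.
  match goal with H : exec o ce _ _ _ _ |- _ => by have [-> ->] := IH _ _ H end.
- move=> r ce cf ct b v t s t' s' sr _ IH t2 s2 E; inversion E; subst; first by congruence.
  match goal with H : s r = _ :: _ |- _ => move: H; rewrite sr => -[? ?]; subst end.
  match goal with H : exec o _ t.+1 _ _ _ |- _ => by have [-> ->] := IH _ _ H end.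
- by move=> r cf ct t s sr t2 s2 E; inversion E; subst; last by congruence.
- move=> r cf ct b v t s t' s' t'' s'' sr _ IH _ IHw t2 s2 E; inversion E; subst; first by congruence.
  match goal with H : s r = _ :: _ |- _ => move: H; rewrite sr => -[? ?]; subst end.
  match goal with H : exec o _ t.+1 _ _ _ |- _ => have [? ?] := IH _ _ H end; subst.
  match goal with H : exec o (While r cf ct) _.+1 _ _ _ |- _ => exact: IHw H end.
Qed.

Definition guess_bit :=
  Seq (Guess 3) (Case 3 (nop 4) (Seq (Push 2 false) (Push 2 true))
    (Seq (Push 2 false) (Seq (Push 2 false) (Seq (Push 2 true) (Push 2 true))))).

Definition guess_store x (y : seq bool) v : store :=
  upd (upd (upd empty_store 0 x) 2 (enc (code y))) 1 v.

Lemma exec_time o c t s t' s' : exec o c t s t' s' -> t <= t'.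
Proof. by elim=> *; lia. Qed.

Lemma exec_guess_bit b t x y v : exists2 t', t.+1 < t' <= t + 20 &
  forall o, o t.+1 = b -> exec o guess_bit t (guess_store x y v) t' (guess_store x (b :: y) v).
Proof.
have R : run (Case 3 (nop 4) (Seq (Push 2 false) (Push 2 true))
    (Seq (Push 2 false) (Seq (Push 2 false) (Seq (Push 2 true) (Push 2 true)))))
    (upd (guess_store x y v) 3 [:: b]) (guess_store x (b :: y) v) 10.
  case: b.
    apply: run_conv (@run_case_true _ _ _ _ _ _ [::] _ _ (run_seq (run_push _ _ _) (run_seq (run_push _ _ _)
        (run_seq (run_push _ _ _) (run_push _ _ _))))) _ _ => //.
    by rewrite /guess_store; store_eq.
  apply: run_conv (@run_case_false _ _ _ _ _ _ [::] _ _ (run_seq (run_push _ _ _) (run_push _ _ _))) _ _ => //.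
  by rewrite /guess_store; store_eq.
have [t' E le] := R t.+2.
exists t'; first by have := exec_time (E (fun=> true)); lia.
move=> o ob; have E2 := ExecGuess o 3 t (guess_store x y v); rewrite ob in E2.
exact: ExecSeq E2 (E o).
Qed.

Lemma exec_guess_loop o x v : forall t y, exists t' y',
  [/\ size y' = size y + size v, t' <= t + (22 * size v + 1) &
   exec o (While 1 guess_bit guess_bit) t (guess_store x y v) t' (guess_store x y' [::])].
Proof.
elim: v => [|b v IH] t y; first by exists t.+1, y; split; rewrite ?addn0 //; [lia|constructor].
have [t1 /andP[_ l1] /(_ o erefl) E1] := exec_guess_bit (o t.+2) t.+1 x y v.
have [t2 [y' [sz l2 E2]]] := IH t1.+1 (o t.+2 :: y).
exists t2, y'; split; [rewrite sz /=; lia|rewrite /=; lia|].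
apply: (@ExecWhileCons _ _ _ _ b v) E2 => //.
rewrite if_same (_ : upd _ _ _ = guess_store x y v) //.
by rewrite /guess_store; store_eq.
Qed.

(** Every string of the right length is guessed under a suitable oracle. Only its values in the time
    interval of the loop matter, so the oracles of successive rounds can be glued together. *)
Lemma exec_guess_loop_all x z : forall v t y, size z = size v -> exists t' o, t <= t' /\
  forall o', (forall i, t <= i < t' -> o' i = o i) ->
   exec o' (While 1 guess_bit guess_bit) t (guess_store x y v) t' (guess_store x (catrev z y) [::]).
Proof.
elim: z => [|b z IH] [|b' v] t y //= sz.
  by exists t.+1, xpredT; split=> [|o' _]; [exact: leqnSn|constructor].
have [t1 /andP[lt1 _] E1] := exec_guess_bit b t.+1 x y v.
have [t2 [f2 [l2 E2]]] := IH v t1.+1 (b :: y) (succn_inj sz).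
exists t2, (fun i => if i < t1.+1 then b else f2 i); split; first by lia.
move=> o' Ho'; apply: (@ExecWhileCons _ _ _ _ b' v _ _ t1 (guess_store x (b :: y) v)) => //.
  rewrite if_same (_ : upd _ _ _ = guess_store x y v); last by rewrite /guess_store; store_eq.
  by apply: E1; rewrite Ho' ?ifT //; lia.
by apply: E2 => i li; rewrite Ho' ?ifF //; lia.
Qed.

(** The code of [k w] is consumed as a counter, one guess per bit, so certificates have exactly that
    length and shorter ones are to be padded. *)
Theorem pt_in_NP (B : ctype) (L : language) (k : seq bool -> B)
    (V : seq bool * seq bool -> bool) :
  pt k -> pt V ->
  (forall w, L w <-> exists y, size y = csize (k w) /\ V (w, y)) -> in_NP L.
Proof.
move=> [P [h [gf ph ps R]]] [Q [h' [gf' ph' ps' R']]] HL.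
pose pre := Seq load (Seq (copy 0 1 2) (Seq (P 1) (Push 2 false))).
pose loop := While 1 guess_bit guess_bit.
pose post := Seq (xfer 0 1 3) (Seq (xfer 2 0 3) (Seq (xfer 1 0 3) (Seq (Push 0 true) (Q 0)))).
pose c := Seq pre (Seq loop post).
have Rpre w : run pre (word_store w) (guess_store (enc (code w)) [::] (enc (code (k w))))
    ((20 * size w + 10) + ((10 * csize w + 2) + (h w + 2))).
  apply: run_seq (run_load w) (run_seq (@run_copy 0 1 2 _ _ _ _ _)
    (run_conv (run_seq (R 1 _ w _ _) (run_push _ _ _)) _ (leqnn _))) => //.
  - by rewrite /upd /= cats0.
  - by case=> [|[|r]].
  - by rewrite /guess_store; store_eq.
have Rpost w y : run post (guess_store (enc (code w)) y [::])
    (upd empty_store 0 (enc (code (V (w, y)))))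
    ((8 * csize w + 2) + ((8 * csize y + 2) + ((8 * csize w + 2) + (2 + h' (w, y))))).
  apply: run_conv (run_seq (@run_xfer 0 1 3 _ _ _ _ _) (run_seq (@run_xfer 2 0 3 _ _ _ _ _)
   (run_seq (@run_xfer 1 0 3 _ _ _ _ _) (run_seq (run_push _ _ _) (R' 0 _ (w, y) _ _))))) _ _ => //.
  - by rewrite /upd /guess_store /upd /= !cats0.
  - by case=> [|[|[|[|r]]]].
  - by rewrite /guess_store; store_eq.
  - by rewrite /guess_store /upd /= !cats0 /csize /tsize.
have [e' He'] := ph'.
have [e He] : pb (fun w : seq bool => ((20 * csize w + 10) + ((10 * csize w + 2) + (h w + 2))) +
    ((22 * csize (k w) + 1) + ((8 * csize w + 2) + ((8 * (4 * csize (k w) + 3) + 2) + ((8 * csize w + 2) +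
     (2 + (csize w + (4 * csize (k w) + 3) + 3) ^ e'))))) + 1).
  by pbs; apply: pb_pow; pbs.
have all_o w o : exists t y, [/\ exec o c 0 (word_store w) t (upd empty_store 0 (enc (code (V (w, y))))),
    size y = csize (k w) & t < (4 * size w + 3) ^ e].
  have [t1 /(_ o) E1 l1] := Rpre w 0.
  have [t2 [y [sz l2 E2]]] := exec_guess_loop o (enc (code w)) (enc (code (k w))) t1 [::].
  have [t3 /(_ o) E3 l3] := Rpost w y t2.
  exists t3, y; split=> //; first exact: ExecSeq E1 (ExecSeq E2 E3).
  apply: leq_trans (_ : (csize w + 2) ^ e <= _); last first.
    by case: (e) => // ?; rewrite leq_exp2r ?csize_bits.
  apply: leq_trans (He w).
  have l4 : h' (w, y) <= (csize w + (4 * csize (k w) + 3) + 3) ^ e'.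
    apply: leq_trans (He' _) _; case: (e') => // ?; rewrite leq_exp2r // csize_pair.
    by have := csize_bits y; rewrite sz /csize /tsize /=; lia.
  have l2' : t2 <= t1 + (22 * csize (k w) + 1) := l2.
  have l5 : csize y <= 4 * csize (k w) + 3.
    by have := csize_bits y; rewrite (_ : size y = csize (k w)) //; lia.
  have l6 := size_csize w; move: l1 l2' l3 l4 l5 l6.
  move: (csize (k w)) (csize w) (csize y) (size w) (h w) (h' _) => a b d f g g'.
  by move: (_ ^ e') => X *; lia.
apply: (@program_in_NP L c e) => [w o|w].
  by have [t [y [E _ l]]] := all_o w o; exists t; eexists; split; [exact: E|].
rewrite HL; split=> [[y [sz Vy]]|[ o [t [s' [v [E E0]]]]]].
  have [t1 E1 l1] := Rpre w 0.
  have [t2 [f2 [l2 E2]]] := @exec_guess_loop_all (enc (code w)) (rev y) (enc (code (k w))) t1 [::] (etrans (size_rev y) sz).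
  have [t3 E3 l3] := Rpost w y t2.
  exists f2, t3, (upd empty_store 0 (enc (code (V (w, y))))), [:: false; false].
  split; last by rewrite /upd /= Vy.
  apply: ExecSeq (E1 _) (ExecSeq (E2 _ _) _) => //.
  by rewrite catrevE revK cats0; exact: E3.
have [t' [y [E' sz _]]] := all_o w o.
(* Under the same oracle the accepting execution is the one analysed in [all_o], so its guesses form
   the certificate. *)
have [_ Es] := exec_det E E'; exists y; split=> //.
by move: E0; rewrite Es /upd /=; case: (V _).
Qed.

(** * Three pairwise crossing chords are not planar *)

Section DiscreteK33.
Import Order.TTheory GRing.Theory Num.Theory.
Local Open Scope ring_scope.
Variable R : realType.
Implicit Types (z y : R * R) (d : R).

(** An open half-plane with half of its boundary line: of two opposite nonzero vectors exactly one
    belongs to it. *)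
Definition sgz2 z : bool := (0 < z.1) || ((z.1 == 0) && (0 < z.2)).

Definition far d z := (d <= `|z.1|) || (d <= `|z.2|).
Definition close d z z' := (`|z.1 - z'.1| < d) && (`|z.2 - z'.2| < d).

(* Crossing of the upper half of the vertical axis. *)
Definition up z z' : bool := (sgz2 z != sgz2 z') && (0 < z.2).

Lemma sgz2_neq d z z' : far d z -> close d z z' -> sgz2 z != sgz2 z' -> d <= `|z.2|.
Proof.
move=> /orP[] // fz /andP[c1 _]; rewrite /sgz2.
have : (0 < z.1) && (0 < z'.1) || (z.1 < 0) && (z'.1 < 0).
  move: fz c1; rewrite ler_normr ltr_norml => /orP[] ? /andP[? ?]; apply/orP; [left|right]; apply/andP; split; lra.
case/orP=> /andP[a b]; first by rewrite a b.
by rewrite (lt_gtF a) (lt_gtF b) (lt_eqF a) (lt_eqF b).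
Qed.

Lemma far_neq0 d z : 0 < d -> far d z -> z != 0.
Proof.
move=> d0; apply: contraTneq => ->; rewrite /far /= normr0 orbb; by rewrite -ltNge.
Qed.

Lemma sgz2N z : z != 0 -> sgz2 (- z) = ~~ sgz2 z.
Proof.
case: z => a b; rewrite /sgz2 /= oppr_eq0 !oppr_gt0.
have -> : ((a, b) != 0) = (a != 0) || (b != 0) by rewrite -negb_and.
case: (ltgtP a 0) => //= _.
by case: (ltgtP b 0).
Qed.

Lemma sign_close d z z' : 0 < d -> d <= `|z.2| -> close d z z' -> (0 < z'.2) = (0 < z.2).
Proof.
move=> d0 dz /andP[_ c2]; move: dz c2; rewrite ler_normr ltr_norml => /orP[] ? /andP[? ?].
  have -> : 0 < z.2 by lra.
  by apply/idP; lra.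
have -> : (0 < z.2) = false by apply/negbTE; rewrite -leNgt; lra.
by apply/negbTE; rewrite -leNgt; lra.
Qed.

Lemma closeC d z z' : close d z z' = close d z' z.
Proof. by rewrite /close (distrC z.1) (distrC z.2). Qed.

(** Unless all four points lie in one half-plane, [z1.2] is at least [d] in absolute value, so all
    four are on the same side of the horizontal axis. Then [up] counts either nothing or all changes
    of half-plane around a closed cycle, an even number. *)
Lemma square_up d z1 z2 z3 z4 : 0 < d ->
  far d z1 -> far d z2 -> far d z3 -> far d z4 ->
  close d z1 z2 -> close d z1 z3 -> close d z1 z4 ->
  close d z2 z3 -> close d z2 z4 -> close d z3 z4 ->
  up z1 z2 (+) up z2 z3 (+) up z3 z4 (+) up z4 z1 = false.
Proof.
move=> d0 f1 f2 f3 f4 c12 c13 c14 c23 c24 c34.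
have [E|] := boolP [&& sgz2 z1 == sgz2 z2, sgz2 z1 == sgz2 z3 & sgz2 z1 == sgz2 z4].
  by move: E => /and3P[/eqP E2 /eqP E3 /eqP E4]; rewrite /up -E2 -E3 -E4 eqxx.
move=> N; have D : d <= `|z1.2|.
  move: N; rewrite !negb_and => /or3P[] N.
  - exact: sgz2_neq f1 c12 N.
  - exact: sgz2_neq f1 c13 N.
  - exact: sgz2_neq f1 c14 N.
rewrite /up (sign_close d0 D c12) (sign_close d0 D c13) (sign_close d0 D c14).
by case: (0 < z1.2); case: (sgz2 z1); case: (sgz2 z2); case: (sgz2 z3); case: (sgz2 z4).
Qed.

(** The upper half-line for [- z] is the lower one for [z], so the two terms together count
    crossings of the whole axis. *)
Lemma up_opp d z z' : 0 < d -> far d z -> far d z' -> close d z z' ->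
  up (- z) (- z') (+) up z z' = sgz2 z (+) sgz2 z'.
Proof.
move=> d0 f f' c; rewrite /up (sgz2N (far_neq0 d0 f)) (sgz2N (far_neq0 d0 f')).
have [E|N] := eqVneq (sgz2 z) (sgz2 z'); first by rewrite E eqxx addbb.
have D := sgz2_neq f c N; rewrite /= oppr_gt0.
have : z.2 != 0 by rewrite -normr_gt0; exact: lt_le_trans d0 D.
by move: N; case: (sgz2 z); case: (sgz2 z') => //= _; case: (ltgtP z.2 0).
Qed.

Lemma upC d z z' : 0 < d -> far d z -> close d z z' -> up z z' = up z' z.
Proof.
move=> d0 f c; rewrite /up eq_sym; have [//|N] := eqVneq (sgz2 z') (sgz2 z).
by rewrite (sign_close d0 _ c) //; apply: sgz2_neq f c _; rewrite eq_sym.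
Qed.

Fixpoint ups (z : R * R) (s : seq (R * R)) : bool :=
  if s is z' :: s' then up z z' (+) ups z' s' else false.

Definition chained d (x : R * R) (s : seq (R * R)) := path (close d) x s.

Definition pairwise_far d (s t : seq (R * R)) := {in s & t, forall z y, far d (z - y)}.

Lemma close_sub d z z' y y' : close (d / 2) z z' -> close (d / 2) y y' ->
  close d (z - y) (z' - y').
Proof.
rewrite /close /= !ltr_norml => /andP[/andP[? ?] /andP[? ?]] /andP[/andP[? ?] /andP[? ?]].
apply/andP; split; apply/andP; split; lra.
Qed.

Lemma close_refl d z : 0 < d -> close d z z.
Proof. by move=> d0; rewrite /close !subrr !normr0 d0. Qed.

Lemma ups_strip d z z' y0 ys : 0 < d -> close (d / 2) z z' -> chained (d / 2) y0 ys ->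
  pairwise_far d [:: z; z'] (y0 :: ys) ->
  ups (z - y0) [seq z - y | y <- ys] (+) ups (z' - y0) [seq z' - y | y <- ys] =
  up (z - y0) (z' - y0) (+) up (z - last y0 ys) (z' - last y0 ys).
Proof.
move=> d0 cz; have h0 : 0 < d / 2 by lra.
elim: ys y0 => [|y ys IH] y0 /=; first by rewrite addbb.
move=> /andP[cy cys] F.
have /IH-/(_ _) {}IH := cys.
have {IH} E : ups (z - y) [seq z - y0 | y0 <- ys] (+) ups (z' - y) [seq z' - y0 | y0 <- ys] =
    up (z - y) (z' - y) (+) up (z - last y ys) (z' - last y ys).
  by apply: IH => a b az bys; apply: F; rewrite // inE bys orbT.
have Fa a b : a \in [:: z; z'] -> b \in [:: y0; y] -> far d (a - b).
  by move=> az; rewrite !inE => /orP[] /eqP ->; apply: F; rewrite // !inE eqxx ?orbT.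
have [mz mz'] : z \in [:: z; z'] /\ z' \in [:: z; z'] by rewrite !inE !eqxx orbT.
have [my my'] : y0 \in [:: y0; y] /\ y \in [:: y0; y] by rewrite !inE !eqxx orbT.
have cc a := close_refl a h0; have sC (a b : R * R) : close (d / 2) a b -> close (d / 2) b a by rewrite closeC.
have := @square_up d (z - y0) (z' - y0) (z' - y) (z - y) d0 (Fa _ _ mz my) (Fa _ _ mz' my)
   (Fa _ _ mz' my') (Fa _ _ mz my').
rewrite (@upC d (z' - y)) ?(@upC d (z - y) (z - y0)) ?Fa ?close_sub ?cc //; try exact: sC.
move=> /(_ isT isT isT isT isT isT); move: E.
move: (up _ _) (up _ _) (up _ _) (up _ _) (up _ _) (ups _ _) (ups _ _).
by do 7 case.
Qed.

(** A discrete homotopy: each elementary square of the grid of differences [z - y] has even parity,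
    and after summation only the boundary of the grid remains. *)
Lemma ups_grid d z0 zs y0 ys : 0 < d -> chained (d / 2) z0 zs -> chained (d / 2) y0 ys ->
  pairwise_far d (z0 :: zs) (y0 :: ys) ->
  ups (z0 - y0) [seq z0 - y | y <- ys] (+)
    ups (last z0 zs - y0) [seq last z0 zs - y | y <- ys] =
  ups (z0 - y0) [seq z - y0 | z <- zs] (+)
    ups (z0 - last y0 ys) [seq z - last y0 ys | z <- zs].
Proof.
move=> d0 cz cy; elim: zs z0 cz => [|z zs IH] z0 /=; first by rewrite addbb.
move=> /andP[c0 cz] F; have := IH z cz.
move/(_ (fun a b az by_ => F a b (mem_behead (s := z0 :: z :: zs) az) by_)).
have F2 : pairwise_far d [:: z0; z] (y0 :: ys).
  by move=> a b; rewrite !inE => /orP[] /eqP -> by_; apply: F; rewrite // !inE eqxx ?orbT.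
have := ups_strip d0 c0 cy F2.
move: (up _ _) (up _ _) (ups _ _) (ups _ _) (ups _ _) (ups _ _) (ups _ _).
by do 7 case.
Qed.

Lemma ups_opp d v y0 ys : 0 < d -> chained (d / 2) y0 ys ->
  {in y0 :: ys, forall y, far d (v - y)} ->
  ups (y0 - v) [seq y - v | y <- ys] =
  ups (v - y0) [seq v - y | y <- ys] (+) sgz2 (v - y0) (+) sgz2 (v - last y0 ys).
Proof.
move=> d0; have h0 : 0 < d / 2 by lra.
elim: ys y0 => [|y ys IH] y0 /=; first by rewrite addbb.
move=> /andP[cy cys] F; rewrite (IH y) //; last by move=> a ay; apply: F; rewrite inE ay orbT.
have := @up_opp d (v - y0) (v - y) d0 (F _ (mem_head _ _)) (F y _) (close_sub (close_refl _ h0) cy).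
rewrite !opprB !inE eqxx orbT => /(_ isT).
move: (up _ _) (up _ _) (ups _ _) (sgz2 _) (sgz2 _) (sgz2 _).
by do 6 case.
Qed.

(** The identity concerns the disjoint edges [i j] and [i' j'] of K33. Adding its instance with [j]
    and [j'] exchanged cancels [aa] and turns the antisymmetry of [bb] into the constant [true]. Of
    the other terms, [h] collects those with both [i] and [i'], and [G] those with both [j] and
    [j']. *)
Lemma no_K33_bool (Aa Ab : nat -> nat -> nat -> bool) (aa ab ba bb : nat -> nat -> bool) :
  (forall i i' j j', i < 3 -> i' < 3 -> j < 3 -> j' < 3 -> i != i' -> j != j' ->
    Aa i i' j' (+) Ab j i' j' =
    Aa i' i j (+) aa i' i (+) ab i' j (+) (Ab j' i j (+) ba j' i (+) bb j' j))%N ->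
  (forall j j', j < 3 -> j' < 3 -> j != j' -> bb j j' = ~~ bb j' j)%N -> False.
Proof.
move=> H B; have addE b c : b (+) c = xorb b c by case: b; case: c.
pose h i i' j := Aa i i' j (+) Aa i' i j (+) ab i' j (+) ba j i.
pose G i j j' := Ab j i j' (+) Ab j' i j.
have HG i i' j j' : (i < 3)%N -> (i' < 3)%N -> (j < 3)%N -> (j' < 3)%N -> i != i' -> j != j' ->
    h i i' j (+) h i i' j' (+) (G i j j' (+) G i' j j') = true.
  move=> li li' lj lj' ni nj; rewrite eq_sym in nj.
  have nj' := nj; rewrite eq_sym in nj'.
  have := f_equal2 addb (H i i' j j' li li' lj lj' ni nj') (H i i' j' j li li' lj' lj ni nj).
  rewrite (B j' j lj' lj nj) /h /G !addE => E.
  match type of E with ?X = ?Y => transitivity (~~ (xorb X Y)); [btauto|by rewrite E -addE addbb] end.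
(* Summed over the three pairs of columns, each [h] occurs twice and the constant [true] three
   times. *)
have F i i' : (i < 3)%N -> (i' < 3)%N -> i != i' ->
    G i 0%N 1%N (+) G i 0%N 2%N (+) G i 1%N 2%N (+) (G i' 0%N 1%N (+) G i' 0%N 2%N (+) G i' 1%N 2%N) = true.
  move=> li li' ni; have := f_equal2 addb (HG i i' 0 1 li li' isT isT ni isT)%N
    (f_equal2 addb (HG i i' 0 2 li li' isT isT ni isT) (HG i i' 1 2 li li' isT isT ni isT))%N.
  rewrite !addE => E; rewrite -[RHS]/(xorb true (xorb true true)) -E; btauto.
(* The three sums of [G], one for each row, would be pairwise different bits. *)
have := f_equal2 addb (F 0 1 isT isT isT)%N (f_equal2 addb (F 0 2 isT isT isT) (F 1 2 isT isT isT))%N.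
rewrite !addE; match goal with |- ?X = _ -> _ => have -> : X = false by btauto end.
by [].
Qed.

(** The boolean identity is [ups_grid] for two disjoint edges. Its two terms with the moving point
    on the left are reversed by [ups_opp], which produces the half-plane bits of differences of end
    points. *)
Lemma no_discrete_K33 d (a b : nat -> R * R) (p : nat -> nat -> seq (R * R)) : 0 < d ->
  (forall i j, i < 3 -> j < 3 -> chained (d / 2) (a i) (p i j) /\ last (a i) (p i j) = b j)%N ->
  (forall i i' j j', i < 3 -> i' < 3 -> j < 3 -> j' < 3 -> i != i' -> j != j' ->
     pairwise_far d (a i :: p i j) (a i' :: p i' j'))%N -> False.
Proof.
move=> d0 ch fr.
pose Aa i i' j' := ups (a i - a i') [seq a i - y | y <- p i' j'].
pose Ab j i' j' := ups (b j - a i') [seq b j - y | y <- p i' j'].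
apply: (@no_K33_bool Aa Ab (fun i i' => sgz2 (a i - a i')) (fun i j => sgz2 (a i - b j))
   (fun j i => sgz2 (b j - a i)) (fun j j' => sgz2 (b j - b j'))).
  move=> i i' j j' li li' lj lj' ni nj.
  have [c1 e1] := ch i j li lj; have [c2 e2] := ch i' j' li' lj'.
  have := ups_grid d0 c1 c2 (fr _ _ _ _ li li' lj lj' ni nj).
  rewrite e1 e2 /Aa /Ab => ->; congr (_ (+) _).
    rewrite (@ups_opp d (a i')) // ?e1 // => y yp.
    apply: (fr i' i j' j) => //; rewrite 1?eq_sym // ?mem_head //.
  rewrite (@ups_opp d (b j')) // ?e1 // => y yp.
  apply: (fr i' i j' j) => //; rewrite 1?eq_sym // -e2 mem_last //.
move=> j j' lj lj' nj; rewrite -sgz2N ?opprB //.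
have [_ e1] := ch 0 j isT lj; have [_ e2] := ch 1 j' isT lj'.
by apply: (far_neq0 d0); apply: (fr 1 0 j' j) => //; rewrite 1?eq_sym // -?e1 -?e2 mem_last.
Qed.
End DiscreteK33.

(** * From arcs to fine chains *)

Section Chains.
Import Order.TTheory GRing.Theory Num.Theory numFieldNormedType.Exports.
Local Open Scope ring_scope.
Local Open Scope classical_set_scope.
Variable R : realType.
Implicit Types (d : R) (P Q : set (R * R)).

Definition chain P d (x y : R * R) := exists s : seq (R * R),
  [/\ chained d x s, last x s = y & forall z, z \in x :: s -> P z].

Lemma chain_trans P d x y z : chain P d x y -> chain P d y z -> chain P d x z.
Proof.
move=> [s [cs <- Ps]] [t [ct <- Pt]]; exists (s ++ t); split.
- by rewrite /chained cat_path -/(chained _ _ _) cs.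
- by rewrite last_cat.
move=> w; rewrite -cat_cons mem_cat => /orP[/Ps //|wt].
by apply: Pt; rewrite inE wt orbT.
Qed.

Lemma chain_sym P d x y : chain P d x y -> chain P d y x.
Proof.
move=> [s [cs <- Ps]]; exists (rev (belast x s)); split.
- rewrite /chained rev_path; apply: sub_path cs => u v; by rewrite closeC.
- by case: s {cs Ps} => //= a s; rewrite rev_cons last_rcons.
- by move=> z; rewrite inE mem_rev => zs; apply: Ps; rewrite lastI mem_rcons inE.
Qed.

Lemma chain_sub P Q d x y : P `<=` Q -> chain P d x y -> chain Q d x y.
Proof. by move=> PQ [s [cs e Ps]]; exists s; split=> // z /Ps /PQ. Qed.

Lemma closeE d (z z' : R * R) : close d z z' = (`|z - z'| < d).
Proof. by rewrite prod_normE gt_max. Qed.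

Lemma farE d (z : R * R) : far d z = (d <= `|z|).
Proof. by rewrite prod_normE le_max. Qed.

Lemma in_itv01 (t : R) : (t \in `[0, 1]) = (0 <= t <= 1).
Proof. by rewrite mem_setE in_itv. Qed.

Definition curve (f : R -> R * R) : set (R * R) :=
  [set z | exists2 t : R, 0 <= t <= 1 & z = f t].

Lemma within_continuous_eps (f : R -> R * R) (x d : R) :
  {within `[0, 1], continuous f} -> 0 <= x <= 1 -> 0 < d ->
  exists2 e : R, 0 < e & forall y, 0 <= y <= 1 -> `|x - y| < e -> close d (f x) (f y).
Proof.
move=> cf x01 d0.
have /subspace_continuousP/(_ x) := cf; rewrite -inE in_itv01 => /(_ x01).
move=> /cvgrPdist_lt/(_ d d0).
rewrite /prop_near1 /within /= => /nbhs_ballP[e /= e0 H]; exists e => // y y01 xy.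
by rewrite closeE; apply: H => //; rewrite -inE in_itv01.
Qed.

(** Take the supremum of the parameters reachable by a [d]-chain. By continuity there it is
    reachable itself, and it can be exceeded unless it is 1. *)
Lemma curve_chain (f : R -> R * R) d : {within `[0, 1], continuous f} -> 0 < d ->
  chain (curve f) d (f 0) (f 1).
Proof.
move=> cf d0.
pose B := [set t : R | 0 <= t <= 1 /\ chain (curve f) d (f 0) (f t)].
have z01 : 0 <= (0 : R) <= 1 by rewrite lexx ler01.
have B0 : B 0.
  by split=> //; exists [::]; split=> // z; rewrite inE => /eqP ->; exists 0.
have ubB : ubound B 1 by move=> t [/andP[]].
have supB : has_sup B by split; [exists 0|exists 1].
pose s := sup B.
have s0 : 0 <= s by apply: ub_le_sup B0; exists 1.
have s1 : s <= 1 by apply: ge_sup => //; exists 0.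
have s01 : 0 <= s <= 1 by rewrite s0 s1.
have [e e0 He] := within_continuous_eps cf s01 d0.
have step u v : 0 <= u <= 1 -> 0 <= v <= 1 -> close d (f u) (f v) -> chain (curve f) d (f u) (f v).
  move=> u01 v01 c; exists [:: f v]; split=> //=; first by rewrite c.
  by move=> z; rewrite !inE => /orP[] /eqP ->; [exists u|exists v].
have [t [t01 ct] lt] := sup_adherent e0 supB.
have ts : t <= s by apply: ub_le_sup; [exists 1|].
have cs : chain (curve f) d (f 0) (f s).
  apply: chain_trans ct _; apply: chain_sym; apply: step => //; apply: He => //.
  by rewrite ger0_norm ?subr_ge0 //; rewrite -/s in lt; lra.
case: (ltgtP s 1) => [lt1|gt1|<- //]; last by lra.
pose u := Num.min 1 (s + e / 2).
have us : s < u by rewrite lt_min lt1; lra.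
have u01 : 0 <= u <= 1 by rewrite (le_trans s0 (ltW us)) ge_min lexx.
have Bu : B u.
  split=> //; apply: chain_trans cs _; apply: step => //; apply: He => //.
  rewrite distrC ger0_norm ?subr_ge0 1?ltW //.
  by have : u <= s + e / 2; [rewrite ge_min lexx orbT|lra].
by have := ub_le_sup (ex_intro _ 1 ubB) Bu; rewrite leNgt us.
Qed.

Lemma curveE f : curve f = f @` `[0, 1].
Proof.
apply/seteqP; split=> z [t t01].
  by move=> ->; exists t => //; rewrite -inE in_itv01.
by move=> <-; exists t => //; rewrite -in_itv01 inE.
Qed.

(** The distance attains its minimum on the compact product of the two arcs, and this minimum is not
    0. *)
Lemma curve_gap (f g : R -> R * R) :
  {within `[0, 1], continuous f} -> {within `[0, 1], continuous g} ->
  (forall s t, 0 <= s <= 1 -> 0 <= t <= 1 -> f s <> g t) ->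
  exists2 d : R, 0 < d & forall s t, 0 <= s <= 1 -> 0 <= t <= 1 -> far d (f s - g t).
Proof.
move=> cf cg D.
pose K := curve f `*` curve g.
have cK : compact K.
  by rewrite /K !curveE; apply: compact_setX; apply: continuous_compact => //; exact: segment_compact.
have z01 : 0 <= (0 : R) <= 1 by rewrite lexx ler01.
have K0 : K !=set0 by exists (f 0, g 0); split; exists 0.
have ch : continuous (fun z : (R * R) * (R * R) => `|z.1 - z.2|).
  move=> z; apply: cvg_norm; apply: cvgB; [exact: cvg_fst|exact: cvg_snd].
have [[x y] ] := compact_EVT_min K0 cK (continuous_subspaceT ch).
rewrite inE => -[[s s01 /= ->] [t t01 /= ->]] H.
exists `|f s - g t|; first by rewrite normr_gt0 subr_eq0; apply/eqP/D.
move=> s' t' s'01 t'01; rewrite farE; apply: (H (f s', g t')).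
by rewrite inE; split; [exists s'|exists t'].
Qed.

Lemma finite_gap (I : finType) (Q : I -> R -> Prop) :
  (forall i d d', 0 < d' <= d -> Q i d -> Q i d') -> (forall i, exists2 d, 0 < d & Q i d) ->
  exists2 d, 0 < d & forall i, Q i d.
Proof.
move=> mono ex; suff [d d0 H] : exists2 d, 0 < d & forall i, i \in enum I -> Q i d.
  by exists d => // i; apply: H; rewrite mem_enum.
elim: (enum I) => [|i s [d d0 H]]; first by exists 1.
have [d' d'0 Q'] := ex i; exists (Num.min d d'); first by rewrite lt_min d0.
move=> j; rewrite inE => /orP[/eqP ->|js].
  by apply: mono Q'; rewrite lt_min d0 d'0 ge_min lexx orbT.
by apply: mono (H j js); rewrite lt_min d0 d'0 ge_min lexx.
Qed.
End Chains.

(** * Subdivisions of K33 in a plane drawing *)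

Section DrawingK33.
Import Order.TTheory GRing.Theory Num.Theory numFieldNormedType.Exports.
Local Open Scope ring_scope.
Local Open Scope classical_set_scope.
Variables (R : realType) (T : finType) (e : rel T).
Variables (p : T -> R * R) (g : T -> T -> R -> R * R).
Hypothesis draw : plane_drawing e p g.

Lemma drawing_disjoint x y x' y' : e x y -> e x' y' ->
  x != x' -> x != y' -> y != x' -> y != y' ->
  forall s t, 0 <= s <= 1 -> 0 <= t <= 1 -> g x y s <> g x' y' t.
Proof.
case: draw => injp he hv hee exy exy' n1 n2 n3 n4 s t s01 t01.
have [_ _ g0 g1 _] := he _ _ exy; have [_ _ g0' g1' _] := he _ _ exy'.
have split01 (u : R) : 0 <= u <= 1 -> [\/ u = 0, u = 1 | u \in `]0, 1[].
  move=> /andP[]; rewrite le_eqVlt => /orP[/eqP <-|u0]; first by constructor 1.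
  rewrite le_eqVlt => /orP[/eqP ->|u1]; first by constructor 2.
  by constructor 3; rewrite mem_setE in_itv /= u0 u1.
have ninj a b : a != b -> p a <> p b by move=> /eqP nab /injp.
have nset : [set x; y]%SET <> [set x'; y']%SET.
  move=> /finset.setP/(_ x); rewrite !inE eqxx /= => /esym.
  by rewrite (negbTE n1) (negbTE n2).
case: (split01 _ s01) => [->|->|si]; case: (split01 _ t01) => [->|->|ti];
  rewrite ?g0 ?g1 ?g0' ?g1'; try (exact: ninj).
- by move=> E; apply: (hv x' y' x exy' t ti).
- by move=> E; apply: (hv x' y' y exy' t ti).
- by apply: (hv x y x' exy s si).
- by apply: (hv x y y' exy s si).
- exact: hee.
Qed.

Definition region (S : pred T) : set (R * R) := [set z | exists x y,
  [/\ e x y, S x, S y & curve (g x y) z]].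

(** One distance serves all disjoint vertex sets because there are only finitely many pairs of
    edges. *)
Lemma drawing_gap : exists2 d : R, 0 < d & forall (S S' : pred T) z z',
  (forall x, S x -> S' x -> False) -> region S z -> region S' z' -> far d (z - z').
Proof.
pose Q (q : (T * T) * (T * T)) (d : R) := e q.1.1 q.1.2 -> e q.2.1 q.2.2 ->
  q.1.1 != q.2.1 -> q.1.1 != q.2.2 -> q.1.2 != q.2.1 -> q.1.2 != q.2.2 ->
  forall s t : R, 0 <= s <= 1 -> 0 <= t <= 1 -> far d (g q.1.1 q.1.2 s - g q.2.1 q.2.2 t).
have [|[[x y] [x' y']] |d d0 H] := @finite_gap R _ Q.
- move=> q d d' /andP[_ le] H h1 h2 h3 h4 h5 h6 s t s01 t01.
  by have := H h1 h2 h3 h4 h5 h6 s t s01 t01; rewrite !farE; exact: le_trans.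
- have [C|nC] := pselect [&& e x y, e x' y', x != x', x != y', y != x' & y != y'].
    have /andP[exy /andP[exy' /and4P[n1 n2 n3 n4]]] := C.
    case: draw => _ he _ _; have [c1 _ _ _ _] := he _ _ exy; have [c2 _ _ _ _] := he _ _ exy'.
    have [d d0 H] := curve_gap c1 c2 (drawing_disjoint exy exy' n1 n2 n3 n4).
    by exists d => // _ _ _ _ _ _; exact: H.
  exists 1 => // h1 h2 h3 h4 h5 h6; case: nC.
  by rewrite /= in h1 h2 h3 h4 h5 h6; rewrite h1 h2 h3 h4 h5 h6.
exists d => // S S' z z' D [x [y [exy Sx Sy [s s01 ->]]]] [x' [y' [exy' Sx' Sy' [t t01 ->]]]].
by apply: (H ((x, y), (x', y'))) => //=; apply/eqP => E; subst; [exact: D Sx Sx'|exact: D Sx Sy'|exact: D Sy Sx'|exact: D Sy Sy'].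
Qed.

Lemma edge_chain (S : pred T) x y d : 0 < d -> e x y -> S x -> S y -> chain (region S) d (p x) (p y).
Proof.
move=> d0 exy Sx Sy; case: draw => _ he _ _; have [c _ <- <- _] := he _ _ exy.
by apply: chain_sub (curve_chain c d0) => z cz; exists x, y.
Qed.

Lemma walk_chain (S : pred T) x s d : 0 < d -> path e x s -> (0 < size s)%N -> all S (x :: s) ->
  chain (region S) d (p x) (p (last x s)).
Proof.
move=> d0; elim: s x => // y s IH x /= /andP[exy ps] _ /and3P[Sx Sy Ss].
have E := edge_chain d0 exy Sx Sy; case: s IH ps Ss => // z s IH ps Ss.
by apply: chain_trans E (IH y _ _ _) => //=; rewrite Sy.
Qed.

(** [S i j] confines the path that subdivides the edge [i j]. Disjointness is asked only of edges
    without a common end. A path may be walked from either end, as [e] is not assumed symmetric, and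
    is nonempty so that its end vertices lie on drawn edges. *)
Lemma no_K33_drawing (a b : nat -> T) (S : nat -> nat -> pred T) :
  (forall i j, i < 3 -> j < 3 -> exists s, [/\ path e (a i) s, (0 < size s)%N,
      last (a i) s = b j & all (S i j) (a i :: s)] \/
    exists s, [/\ path e (b j) s, (0 < size s)%N, last (b j) s = a i & all (S i j) (b j :: s)])%N ->
  (forall i i' j j', i < 3 -> i' < 3 -> j < 3 -> j' < 3 -> i != i' -> j != j' ->
     forall x, S i j x -> S i' j' x -> False)%N -> False.
Proof.
move=> W D; have [d d0 gap] := drawing_gap.
have h0 : 0 < d / 2 by lra.
have ch i j : (i < 3)%N -> (j < 3)%N -> chain (region (S i j)) (d / 2) (p (a i)) (p (b j)).
  move=> li lj; have [s [[ps sz <- al]|[t [pt sz <- al]]]] := W i j li lj.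
    exact: walk_chain.
  exact/chain_sym/walk_chain.
pose P i j s := [/\ chained (d / 2) (p (a i)) s, last (p (a i)) s = p (b j) &
   forall z, z \in p (a i) :: s -> region (S i j) z].
have {}ch i j : exists s, (i < 3)%N && (j < 3)%N -> P i j s.
  case: (boolP ((i < 3)%N && (j < 3)%N)) => [/andP[li lj]|_]; last by exists [::].
  by have [s Hs] := ch i j li lj; exists s.
pose f i j := xget [::] [set s | (i < 3)%N && (j < 3)%N -> P i j s].
have Hf i j : (i < 3)%N -> (j < 3)%N -> P i j (f i j).
  move=> li lj; have := @xgetPex _ [::] [set s | (i < 3)%N && (j < 3)%N -> P i j s] (ch i j).
  by apply; rewrite li lj.
apply: (@no_discrete_K33 R d (p \o a) (p \o b) f d0).
  by move=> i j li lj; have [] := Hf i j li lj.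
move=> i i' j j' li li' lj lj' ni nj z y zs ys.
have [_ _ H1] := Hf i j li lj; have [_ _ H2] := Hf i' j' li' lj'.
by apply: gap (D _ _ _ _ li li' lj lj' ni nj) (H1 _ zs) (H2 _ ys).
Qed.
End DrawingK33.

Section LinkedK33.
Variables (R : realType) (phi : cnf) (kappa : seq (vertex phi)).
Hypothesis link : linking_cycle kappa.
Let N := size kappa.

Lemma cycle_edge_nth x0 i : i.+1 < N -> cycle_edge kappa (nth x0 kappa i) (nth x0 kappa i.+1).
Proof.
have [_ uk _ _] := link => li; rewrite /cycle_edge !mem_nth //; last exact: ltnW.
apply/orP; left; rewrite next_nth mem_nth ?index_uniq //; try exact: ltnW.
by move: li; rewrite /N; case: (kappa) => //= y s li; rewrite (set_nth_default x0).
Qed.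

Lemma cycle_edge_wrap x0 : cycle_edge kappa (nth x0 kappa N.-1) (nth x0 kappa 0).
Proof.
have [N3 uk _ _] := link; rewrite /cycle_edge !mem_nth //=; try by rewrite -/N in N3 *; lia.
apply/orP; left; rewrite next_nth mem_nth ?index_uniq //; try by rewrite -/N in N3 *; lia.
by move: N3; rewrite /N; case: (kappa) => //= y s li; rewrite nth_default.
Qed.

Lemma linked_graph_sym x y : linked_graph kappa x y = linked_graph kappa y x.
Proof.
rewrite /linked_graph /incidence /cycle_edge andbCA orbC [in RHS]orbC; congr (_ || _).
  by rewrite [X in _ && (_ && X)]orbC.
by case: x; case: y.
Qed.

(* Three pairwise crossing chords of a Hamiltonian cycle form, with the cycle, a
   subdivision of K_{3,3}. *)
Lemma linked_no_crossing_triple x0 i1 i2 i3 j1 j2 j3 :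
  i1 < i2 -> i2 < i3 -> i3 < j1 -> j1 < j2 -> j2 < j3 -> j3 < N ->
  linked_graph kappa (nth x0 kappa i1) (nth x0 kappa j1) ->
  linked_graph kappa (nth x0 kappa i2) (nth x0 kappa j2) ->
  linked_graph kappa (nth x0 kappa i3) (nth x0 kappa j3) ->
  ~ planar R (linked_graph kappa).
Proof.
move=> l12 l23 l3 l45 l56 l6 e1 e2 e3 [p [g dr]].
have [N3 uk _ _] := link.
pose v i := nth x0 kappa i.
have idx i : i < N -> index (v i) kappa = i by move=> li; rewrite index_uniq.
have asc a b : a < b -> b < N -> exists s, [/\ path (linked_graph kappa) (v a) s, 0 < size s,
    last (v a) s = v b & all (fun x => a <= index x kappa <= b) (v a :: s)].
  move=> ab bN; exists [seq v k | k <- iota a.+1 (b - a)]; split.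
  - rewrite path_map.
    suff H : forall n c, c + n < N -> path (relpre v (linked_graph kappa)) c (iota c.+1 n).
      by apply: H; lia.
    elim=> //= n IH c En; rewrite IH ?andbT; last by lia.
    by apply/orP; right; apply: cycle_edge_nth; rewrite -/N; lia.
  - by rewrite size_map size_iota subn_gt0.
  - rewrite last_map; congr v.
    have -> : forall n c, last c (iota c.+1 n) = c + n; last by lia.
    by elim=> [|n IH] c /=; rewrite ?addn0 // IH addSnnS.
  - rewrite /= idx ?leqnn ?(ltnW ab) //=; last by lia.
    by apply/allP => x /mapP[k]; rewrite mem_iota => lk ->; rewrite idx; lia.
have edge a b : linked_graph kappa (v a) (v b) -> a < N -> b < N ->
    exists s, [/\ path (linked_graph kappa) (v a) s, 0 < size s, last (v a) s = v b &
     all (fun x => (index x kappa == a) || (index x kappa == b)) (v a :: s)].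
  by move=> eab aN bN; exists [:: v b]; rewrite /= eab !idx // !eqxx orbT.
have wrap : exists s, [/\ path (linked_graph kappa) (v j3) s, 0 < size s, last (v j3) s = v i1 &
     all (fun x => (j3 <= index x kappa) || (index x kappa <= i1)) (v j3 :: s)].
  have [s [ps ls als]] : exists s, [/\ path (linked_graph kappa) (v j3) s, last (v j3) s = v N.-1 &
     all (fun x => (j3 <= index x kappa) || (index x kappa <= i1)) (v j3 :: s)].
    have [<-|ne] := eqVneq j3 N.-1; first by exists [::]; rewrite /= idx // leqnn.
    have [||s [ps _ ls als]] := asc j3 N.-1; [lia|lia|exists s; split=> //].
    by apply: sub_all als => x /andP[->].
  have [t [pt lt alt]] : exists s, [/\ path (linked_graph kappa) (v 0) s, last (v 0) s = v i1 &
     all (fun x => (j3 <= index x kappa) || (index x kappa <= i1)) (v 0 :: s)].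
    have [->|ne] := eqVneq i1 0; first by exists [::]; rewrite /= idx ?leqnn ?orbT //; lia.
    have [||t [pt _ lt alt]] := asc 0 i1; [lia|lia|exists t; split=> //].
    by apply: sub_all alt => x /andP[_ ->]; rewrite orbT.
  exists (s ++ v 0 :: t); split.
  - by rewrite cat_path ps ls /= pt andbT; apply/orP; right; exact: cycle_edge_wrap.
  - by rewrite size_cat /= addnS.
  - by rewrite last_cat.
  - by rewrite -cat_cons all_cat als.
(* Along the cycle the six ends alternate between the two sides of K33; the six arcs of the cycle
   and the three chords are its nine edges. *)
pose a i := v (nth 0 [:: i1; i3; j2] i); pose b j := v (nth 0 [:: i2; j1; j3] j).
pose S i j : pred nat := match i, j with
  | 0, 0 => fun k => i1 <= k <= i2 | 0, 1 => fun k => (k == i1) || (k == j1)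
  | 0, _ => fun k => (j3 <= k) || (k <= i1)
  | 1, 0 => fun k => i2 <= k <= i3 | 1, 1 => fun k => i3 <= k <= j1
  | 1, _ => fun k => (k == i3) || (k == j3)
  | _, 0 => fun k => (k == i2) || (k == j2) | _, 1 => fun k => j1 <= k <= j2
  | _, _ => fun k => j2 <= k <= j3 end.
apply: (@no_K33_drawing R _ _ p g dr a b (fun i j x => S i j (index x kappa))); last first.
  move=> i i' j j' li li' lj lj' ni nj x; move: (index x kappa) => k.
  by case: i li ni => [|[|[|i]]] // _; case: i' li' => [|[|[|i']]] // _ _;
    case: j lj nj => [|[|[|j]]] // _; case: j' lj' => [|[|[|j']]] // _ _ /=; lia.
have swapP (P Q : seq (vertex phi) -> Prop) : ((exists s, P s) \/ (exists s, Q s)) ->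
    exists s, P s \/ exists t, Q t.
  by case=> [[s Ps]|[t Qt]]; [exists s; left|exists [::]; right; exists t].
move=> [|[|[|i]]] [|[|[|j]]] // _ _; apply: swapP.
- by left; apply: (asc i1 i2); lia.
- by left; apply: (edge i1 j1 e1); lia.
- by right; exact: wrap.
- by right; apply: (asc i2 i3); lia.
- by left; apply: (asc i3 j1); lia.
- by left; apply: (edge i3 j3 e3); lia.
- by right; apply: (edge i2 j2 e2); lia.
- by right; apply: (asc j1 j2); lia.
- by left; apply: (asc j2 j3); lia.
Qed.
End LinkedK33.

(** * Drawing a linked graph without crossing triples *)

Section Drawing.
Variables (R : realType) (phi : cnf) (cs : seq 'I_(size (clauses phi))) (vs : seq 'I_(nvars phi)).
Let kappa : seq (vertex phi) := map inl cs ++ map inr vs.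
Hypothesis link : linking_cycle kappa.
Let N := size kappa.
Let m := size cs.
Variable x0 : vertex phi.

Definition chord (a b : nat) := incidence (nth x0 kappa a) (nth x0 kappa b).

Hypothesis no_triple : forall i1 i2 i3 j1 j2 j3,
  i1 < i2 -> i2 < i3 -> i3 < j1 -> j1 < j2 -> j2 < j3 -> j3 < N ->
  chord i1 j1 -> chord i2 j2 -> chord i3 j3 -> False.

Definition pos (x : vertex phi) := index x kappa.

Lemma pos_lt x : pos x < N.
Proof. by have [_ _ a _] := link; rewrite /pos /N index_mem a. Qed.

Lemma nth_pos x : nth x0 kappa (pos x) = x.
Proof. by have [_ _ a _] := link; rewrite nth_index ?a. Qed.

Lemma pos_inj : injective pos.
Proof. by move=> x y E; rewrite -(nth_pos x) E nth_pos. Qed.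

Lemma chord_lt a b : a < b -> b < N -> chord a b -> a < m <= b.
Proof.
move=> ab bN; have NE : N = m + size vs by rewrite /N /kappa size_cat !size_map.
have nl i : i < m -> exists c, nth x0 kappa i = inl c.
  move=> im; rewrite /kappa nth_cat size_map im.
  have /mapP[c _ ->] : nth x0 (map inl cs) i \in map inl cs by rewrite mem_nth ?size_map.
  by exists c.
have nr i : m <= i < N -> exists c, nth x0 kappa i = inr c.
  move=> im; rewrite /kappa nth_cat size_map ifF; last by rewrite -/m; lia.
  have /mapP[c _ ->] : nth x0 (map inr vs) (i - size cs) \in map inr vs.
    by rewrite mem_nth ?size_map // -/m; lia.
  by exists c.
rewrite /chord; case: (ltnP a m) => am; case: (ltnP b m) => bm //.
- by have [c ->] := nl a am; have [c' ->] := nl b bm.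
- by lia.
- have [|c ->] := nr a; first by lia.
  by have [|c' ->] := nr b; first by lia.
Qed.

Lemma next_pos x y : next kappa x = y -> (pos y == (pos x).+1) || (pos x == N.-1) && (pos y == 0).
Proof.
have [N3 uk al _] := link; rewrite next_nth al => E.
have lx := pos_lt x; move: E lx; rewrite /pos /N; case K: (kappa) => [|z s] // <- lx.
rewrite -K -/(pos x) in lx *.
have [lt|ge] := ltnP (pos x) (size s).
  apply/orP; left; rewrite -[nth _ _ _]/(nth z (z :: s) (pos x).+1) -K.
  by rewrite index_uniq // K.
have -> : pos x = size s by move: lx; rewrite K /=; lia.
by rewrite nth_default // K /= !eqxx orbT.
Qed.

Lemma linked_pos a b : a < b -> b < N ->
  linked_graph kappa (nth x0 kappa a) (nth x0 kappa b) ->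
  [\/ b = a.+1, a = 0 /\ b = N.-1 | chord a b].
Proof.
have [N3 uk al _] := link => ab bN.
have pE i : i < N -> pos (nth x0 kappa i) = i by move=> li; rewrite /pos index_uniq.
have aN : a < N by exact: ltn_trans bN.
case/orP => [ch|]; first by constructor 3.
case/and3P=> _ _ /orP[] /eqP /next_pos; rewrite !pE // => /orP[/eqP E|/andP[/eqP E1 /eqP E2]].
- by constructor 1.
- by move: E1 E2 ab bN; lia.
- by lia.
- by constructor 2.
Qed.

Definition below (a b : nat) : bool :=
  has (fun a' => has (fun b' => (a' < b') && chord a' b') (iota 0 b)) (iota 0 a).

Lemma belowP a b : reflect (exists a' b', [/\ a' < a, b' < b, a' < b' & chord a' b']) (below a b).
Proof.
apply: (iffP hasP) => [[a']|[a' [b' [la lb lab ch]]]].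
  rewrite mem_iota => la /hasP[b']; rewrite mem_iota => lb /andP[lab ch].
  by exists a', b'; split.
exists a'; first by rewrite mem_iota.
by apply/hasP; exists b'; rewrite ?mem_iota // lab.
Qed.

(** The first chord puts the second one [below]. Were the first [below] too, the chord preceding it
    would cross both. The closing edge of the cycle spans all positions, so nothing crosses it. *)
Lemma crossing_below a b a' b' : a < a' -> a' < b -> b < b' -> b' < N ->
  linked_graph kappa (nth x0 kappa a) (nth x0 kappa b) ->
  linked_graph kappa (nth x0 kappa a') (nth x0 kappa b') ->
  b != a.+1 -> b' != a'.+1 -> below a b != below a' b'.
Proof.
move=> la lab lb lN e1 e2 n1 n2.
have ch1 : chord a b.
  have [|| E|[E1 E2]|//] := linked_pos _ _ e1; try lia.
have ch2 : chord a' b'.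
  have [|| E|[E1 E2]|//] := linked_pos _ _ e2; try lia.
have B2 : below a' b' by apply/belowP; exists a, b; split=> //; lia.
rewrite B2; apply/negP => /eqP /belowP[a'' [b'' [l1 l2 l3 ch3]]].
have := chord_lt _ _ ch3; have := chord_lt _ _ ch2; have := chord_lt _ _ ch1.
move=> h1 h2 h3; apply: (@no_triple a'' a a' b'' b b') => //; lia.
Qed.

Import Order.TTheory GRing.Theory Num.Theory numFieldNormedType.Exports.
Local Open Scope ring_scope.

Definition side (a b : nat) : R :=
  if maxn a b == (minn a b).+1 then 0 else if below (minn a b) (maxn a b) then - 1 else 1.

Lemma sideC a b : side a b = side b a.
Proof. by rewrite /side maxnC minnC. Qed.

Definition draw_vertex (x : vertex phi) : R * R := ((pos x)%:R, 0).

(** Up to sign all arcs are parabolas with leading coefficient -1 over intervals of the axis, and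
    edges between neighbours are straight. The height is a product of distances to the two ends, so
    of two nested arcs the outer one is higher factor by factor. *)
Definition draw_edge (x y : vertex phi) (t : R) : R * R :=
  let i := (pos x)%:R in let j := (pos y)%:R in let X := i + (j - i) * t in
  (X, side (pos x) (pos y) * ((X - i) * (j - X))).

Lemma linked_pos_neq x y : linked_graph kappa x y -> pos x != pos y.
Proof.
move=> e; apply/eqP => /pos_inj E; move: e; rewrite -{y}E /linked_graph.
rewrite (_ : incidence x x = false); last by case: x.
case/and3P=> _ _; rewrite orbb => /eqP /next_pos.
have [N3 _ _ _] := link; rewrite -/N in N3.
by move=> /orP[/eqP|/andP[/eqP -> /eqP]]; lia.
Qed.

Lemma draw_edgeP x y t : linked_graph kappa x y -> 0 < t < 1 ->
  let a := minn (pos x) (pos y) in let b := maxn (pos x) (pos y) in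
  [/\ (a < b)%N, (b < N)%N, linked_graph kappa (nth x0 kappa a) (nth x0 kappa b) &
   exists2 X : R, a%:R < X < b%:R & draw_edge x y t = (X, side a b * ((X - a%:R) * (b%:R - X)))].
Proof.
move=> exy /andP[t0 t1] a b; have := linked_pos_neq exy; rewrite neq_ltn.
have px := pos_lt x; have py := pos_lt y.
case/orP=> lt.
  have -> : a = pos x by rewrite /a; lia.
  have -> : b = pos y by rewrite /b; lia.
  rewrite !nth_pos; split=> //.
  have ltR : (pos x)%:R < (pos y)%:R :> R by rewrite ltr_nat.
  eexists; last by reflexivity.
  by apply/andP; split; nra.
have -> : a = pos y by rewrite /a; lia.
have -> : b = pos x by rewrite /b; lia.
rewrite !nth_pos linked_graph_sym; split=> //.
have ltR : (pos y)%:R < (pos x)%:R :> R by rewrite ltr_nat.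
eexists; last by rewrite /draw_edge sideC; congr (_, _ * _); rewrite mulrC -mulrNN !opprB.
by apply/andP; split; nra.
Qed.

Lemma consecutive_apart (k z : nat) : k%:R < z%:R :> R -> z%:R < k.+1%:R :> R -> False.
Proof. by rewrite !ltr_nat; lia. Qed.

Lemma drawn_disjoint a b a' b' (X : R) :
  (a < b)%N -> (b < N)%N -> linked_graph kappa (nth x0 kappa a) (nth x0 kappa b) ->
  (a' < b')%N -> (b' < N)%N -> linked_graph kappa (nth x0 kappa a') (nth x0 kappa b') ->
  a%:R < X < b%:R -> a'%:R < X < b'%:R ->
  side a b * ((X - a%:R) * (b%:R - X)) = side a' b' * ((X - a'%:R) * (b'%:R - X)) ->
  a = a' /\ b = b'.
Proof.
move=> ab bN e1 ab' bN' e2 /andP[X1 X2] /andP[X3 X4].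
have P1 : 0 < (X - a%:R) * (b%:R - X) by apply: mulr_gt0; rewrite subr_gt0.
have P2 : 0 < (X - a'%:R) * (b'%:R - X) by apply: mulr_gt0; rewrite subr_gt0.
have L1 : (a < b')%N by rewrite -(ltr_nat R); exact: lt_trans X4.
have L2 : (a' < b)%N by rewrite -(ltr_nat R); exact: lt_trans X2.
rewrite /side !(minn_idPl (ltnW _)) // !(maxn_idPr (ltnW _)) //.
have [Eb|nb] := eqVneq b a.+1; have [Eb'|nb'] := eqVneq b' a'.+1.
- by move=> _; move: L1 L2; rewrite Eb Eb'; lia.
- by rewrite mul0r; case: ifP => _ E; exfalso; lra.
- by rewrite mul0r; case: ifP => _ E; exfalso; lra.
have nest c1 d1 c2 d2 : (c1 <= c2)%N -> (d2 <= d1)%N -> c2%:R < X -> X < d2%:R ->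
    (X - c1%:R) * (d1%:R - X) = (X - c2%:R) * (d2%:R - X) -> c1 = c2 /\ d1 = d2.
  rewrite -!(ler_nat R) => h1 h2 h3 h4 E.
  have : c1%:R = c2%:R :> R by nra.
  have : d1%:R = d2%:R :> R by nra.
  by move=> /eqP; rewrite eqr_nat => /eqP -> /eqP; rewrite eqr_nat => /eqP ->.
move=> E.
have same : below a b = below a' b' by move: E; case: ifP => _; case: ifP => _ // E; exfalso; lra.
have {}E : (X - a%:R) * (b%:R - X) = (X - a'%:R) * (b'%:R - X).
  by move: E; rewrite same; case: ifP => _; lra.
have [la|la] := leqP a a'; have [lb|lb] := leqP b' b.
- exact: nest.
- have [ea|na] := eqVneq a a'.
    by have [-> ->] : a' = a /\ b' = b by apply: nest => //; [rewrite ea|exact: ltnW].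
  have := @crossing_below a b a' b'; rewrite same eqxx => /(_ _ L2 lb bN' e1 e2 nb nb').
  by rewrite ltn_neqAle na la => /(_ isT).
- have [eb|neb] := eqVneq b' b.
    by have [-> ->] : a' = a /\ b' = b by apply: nest => //; [exact: ltnW|rewrite eb].
  have := @crossing_below a' b' a b; rewrite same eqxx => /(_ la L1 _ bN e2 e1 nb' nb).
  by rewrite ltn_neqAle neb lb => /(_ isT).
- by have [-> ->] : a' = a /\ b' = b by apply: nest => //; exact: ltnW.
Qed.

Lemma linked_graph_planar : planar R (linked_graph kappa).
Proof.
exists draw_vertex, draw_edge; split.
- by move=> x y [] /eqP; rewrite eqr_nat => /eqP /pos_inj.
- move=> x y exy.
  have nij : (pos x)%:R != (pos y)%:R :> R by rewrite eqr_nat linked_pos_neq.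
  split.
  + apply: continuous_subspaceT => t.
    have cX : {for t, continuous (fun t : R => (pos x)%:R + ((pos y)%:R - (pos x)%:R) * t : R)}.
      by apply: cvgD; [exact: cvg_cst|apply: cvgM; [exact: cvg_cst|exact: cvg_id]].
    have cY : {for t, continuous (fun t : R => side (pos x) (pos y) *
        (((pos x)%:R + ((pos y)%:R - (pos x)%:R) * t - (pos x)%:R) *
         ((pos y)%:R - ((pos x)%:R + ((pos y)%:R - (pos x)%:R) * t))) : R)}.
      apply: cvgM; first exact: cvg_cst.
      by apply: cvgM; apply: cvgB => //; exact: cvg_cst.
    exact: (cvg_pair cX cY).
  + move=> s t _ _ [/addrI]; move/mulfI; rewrite subr_eq0 eq_sym => /(_ nij) -> //.
  + by rewrite /draw_edge /draw_vertex mulr0 addr0 subrr mul0r mulr0.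
  + by rewrite /draw_edge /draw_vertex mulr1 subrKC subrr !mulr0.
  + by move=> t _; rewrite /draw_edge sideC; congr (_, _ * _); ring.
- move=> x y z exy t; rewrite mem_setE in_itv /= => t01.
  have [ab bN e [X /andP[X1 X2] ->]] := draw_edgeP exy t01.
  case=> EX; rewrite /side !(minn_idPl (ltnW ab)) !(maxn_idPr (ltnW ab)).
  have [Eb _|nb] := eqVneq _ _.+1.
    by apply: (@consecutive_apart (minn (pos x) (pos y)) (pos z)); rewrite -EX // -Eb.
  have P1 : 0 < (X - (minn (pos x) (pos y))%:R) * ((maxn (pos x) (pos y))%:R - X).
    by apply: mulr_gt0; rewrite subr_gt0.
  by case: ifP => _ E; lra.
- move=> x y x' y' exy exy' ns s t; rewrite !mem_setE !in_itv /= => s01 t01.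
  have [ab bN e [X X12 ->]] := draw_edgeP exy s01.
  have [ab' bN' e' [X' X12' ->]] := draw_edgeP exy' t01.
  case=> EX; rewrite -{}EX in X12' *.
  move=> /(drawn_disjoint ab bN e ab' bN' e' X12 X12') [E1 E2]; apply: ns.
  have [[/pos_inj <- /pos_inj <-] //|[/pos_inj <- /pos_inj <-]] :
      (pos x = pos x' /\ pos y = pos y') \/ (pos x = pos y' /\ pos y = pos x').
    by move: E1 E2; move: (pos x) (pos y) (pos x') (pos y'); clear; lia.
  by rewrite finset.setUC.
Qed.
End Drawing.

(** * Membership in NP *)

(* A monotone clause: its sign and its variables. *)
Definition mclause := (bool * seq nat)%type.

(** Puts the variables in the order in which a set of literals is enumerated, without repetitions or
    indices out of range, so that raw data encode exactly like the formula. *)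
Definition clause_vars N (c : mclause) := [seq i <- iota 0 N | i \in c.2].
Definition nth_clause (cls : seq mclause) j := nth (true, [::]) cls j.

Definition raw_clause N (c : mclause) := enc_seq (fun i => c.1 :: enc_nat i) (clause_vars N c).

Definition raw_edges N (cls : seq mclause) :=
  enc_seq (fun p : nat * nat => enc_nat p.1 ++ enc_nat p.2)
    (flatten [seq [seq (j, i) | i <- clause_vars N (nth_clause cls j)] | j <- iota 0 (size cls)]).

Definition raw_instance N (cls : seq mclause) (cs vs : seq nat) : seq bool :=
  (enc_nat N ++ enc_seq (raw_clause N) cls) ++ raw_edges N cls ++
  enc_seq id ([seq false :: enc_nat c | c <- cs] ++ [seq true :: enc_nat v | v <- vs]).

Definition set_of N (c : mclause) : {set literal N} :=
  [set l : literal N | (val l.1 \in c.2) && (l.2 == c.1)]%SET.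

Lemma enc_seq_map (T U : Type) (f : U -> seq bool) (h : T -> U) s :
  enc_seq f (map h s) = enc_seq (f \o h) s.
Proof. by elim: s => //= x s ->. Qed.

Lemma eq_enc_seq (T : Type) (f h : T -> seq bool) : f =1 h -> enc_seq f =1 enc_seq h.
Proof. by move=> E; elim=> //= x s ->; rewrite E. Qed.

Lemma enum_prodE (T1 T2 : finType) (A : pred (T1 * T2)) :
  enum A = flatten [seq [seq (x, y) | y <- [seq y <- enum T2 | A (x, y)]] | x <- enum T1].
Proof.
rewrite -[LHS]/[seq z <- Finite.enum _ | A z] unlock /= filter_flatten -map_comp.
by congr flatten; apply: eq_map => x /=; rewrite filter_map.
Qed.

Lemma filter_ord n (P : pred nat) :
  [seq val i | i <- [seq i : 'I_n <- enum 'I_n | P (val i)]] = [seq i <- iota 0 n | P i].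
Proof. by rewrite -val_enum_ord filter_map. Qed.

Lemma enc_clause_set_of N (c : mclause) : enc_clause (set_of N c) = raw_clause N c.
Proof.
rewrite /enc_clause (eq_enum (B := [pred l : literal N | (val l.1 \in c.2) && (l.2 == c.1)])); last first.
  by move=> l; rewrite !inE.
rewrite enum_prodE /raw_clause /clause_vars -(filter_ord N) enc_seq_map.
have -> : flatten [seq [seq (x, y) | y <- [seq y <- enum {: bool} | (val x \in c.2) && (y == c.1)]] | x <- enum 'I_N]
    = [seq (x, c.1) | x : 'I_N <- [seq x : 'I_N <- enum 'I_N | val x \in c.2]].
  have -> : enum {: bool} = [:: true; false] by rewrite enumT unlock.
  by elim: (enum 'I_N) => //= x s ->; case: (val x \in c.2); case: (c.1).
by rewrite enc_seq_map.
Qed.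

Lemma cvars_set_of N (c : mclause) (i : 'I_N) : (i \in cvars (set_of N c)) = (val i \in c.2).
Proof.
apply/imsetP/idP => [[l]|ic]; first by rewrite inE => /andP[lc _] ->.
by exists (i, c.1); rewrite // inE /= ic eqxx.
Qed.

Lemma card_cvars_set_of N (c : mclause) : #|cvars (set_of N c)| = size (clause_vars N c).
Proof.
rewrite cardE /clause_vars -(filter_ord N) size_map; congr size.
by rewrite -[LHS]/[seq i <- Finite.enum _ | i \in cvars (set_of N c)] -enumT; apply: eq_filter => i; rewrite -cvars_set_of.
Qed.

Section Data.
Variables (N : nat) (cls : seq mclause).
Hypothesis ucls : uniq [seq set_of N c | c <- cls].
Let phi := Cnf ucls.

Lemma clause_of_data (j : 'I_(size (clauses phi))) : clause_of j = set_of N (nth_clause cls j).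
Proof.
rewrite /clause_of (tnth_nth finset.set0) /= (nth_map (true, [::])) //.
exact: leq_trans (ltn_ord j) (eq_leq (size_map _ _)).
Qed.

Lemma incidence_data j (i : 'I_(nvars phi)) :
  @incidence phi (inl j) (inr i) = (val i \in (nth_clause cls j).2).
Proof. by rewrite /incidence clause_of_data cvars_set_of. Qed.

Lemma enc_incidence_data : enc_incidence phi = raw_edges N cls.
Proof.
rewrite /enc_incidence /raw_edges enum_prodE.
have {1}-> : size cls = size (clauses phi) by rewrite size_map.
rewrite -val_enum_ord -map_comp.
transitivity (enc_seq (fun p : nat * nat => enc_nat p.1 ++ enc_nat p.2) [seq (val p.1, val p.2) | p <-
  flatten [seq [seq (x, y) | y <- [seq y <- enum 'I_(nvars phi) | @incidence phi (inl x) (inr y)]] | x <- enum 'I_(size (clauses phi))]]).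
  by rewrite enc_seq_map.
congr enc_seq; rewrite map_flatten -map_comp; congr flatten; apply: eq_map => j /=.
rewrite -map_comp /clause_vars -(filter_ord N) -map_comp.
by congr map; apply: eq_filter => i; exact: incidence_data.
Qed.

Variables (cs : seq 'I_(size (clauses phi))) (vs : seq 'I_(nvars phi)).

Lemma enc_instance_data :
  @enc_instance phi (map inl cs ++ map inr vs) = raw_instance N cls (map val cs) (map val vs).
Proof.
rewrite /enc_instance /raw_instance enc_incidence_data /enc_cnf; congr (_ ++ _ ++ _).
  by congr (_ ++ _); rewrite /= enc_seq_map; apply: eq_enc_seq => c; exact: enc_clause_set_of.
have -> : [seq false :: enc_nat c | c <- map val cs] ++ [seq true :: enc_nat v | v <- map val vs]
  = map (@enc_vertex phi) (map inl cs ++ map inr vs) by rewrite map_cat -!map_comp.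
by rewrite enc_seq_map.
Qed.

Lemma monotone_data : monotone_cnf phi.
Proof.
apply/allP => _ /mapP[c _ ->]; apply/orP; case: (boolP c.1) => [s|s]; [left|right];
  by apply/forallP => l; apply/implyP; rewrite inE => /andP[_ /eqP ->].
Qed.

Lemma three_cnf_data : three_cnf phi = all (fun c => size (clause_vars N c) <= 3) cls.
Proof. by rewrite /three_cnf all_map; apply: eq_all => c /=; rewrite card_cvars_set_of. Qed.

Definition sat_clause (a : nat -> bool) (c : mclause) := has (fun v => (v < N) && (a v == c.1)) c.2.

Lemma satisfiable_data : satisfiable phi <-> exists a, all (sat_clause a) cls.
Proof.
split=> [[a H]|[a H]].
  exists (fun v => if insub v is Some i then a i else true).
  apply/allP => c cc; have [|l] := H (set_of N c); first exact: map_f.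
  rewrite inE => /andP[lc /eqP ls] al; apply/hasP; exists (val l.1) => //.
  by rewrite ltn_ord /= valK al ls eqxx.
exists (fun i => a (val i)) => _ /mapP[c cc ->].
have /hasP[v vc /andP[lv av]] := allP H _ cc.
by exists (Ordinal lv, c.1); rewrite ?inE /= ?vc ?eqxx //; exact/eqP.
Qed.

Definition chords (ics ivs : seq nat) : seq (nat * nat) :=
  flatten [seq [seq (i, j) | j <- [seq j <- iota 0 (size ivs) |
     nth 0 ivs j \in (nth_clause cls (nth 0 ics i)).2]] | i <- iota 0 (size ics)].

Definition no_chain ics ivs : bool :=
  let E := chords ics ivs in
  all (fun e1 => all (fun e2 => all (fun e3 =>
    ~~ ((e1.1 < e2.1) && (e2.1 < e3.1) && ((e1.2 < e2.2) && (e2.2 < e3.2)))) E) E) E.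

Lemma mem_chords ics ivs i j : ((i, j) \in chords ics ivs) =
  [&& i < size ics, j < size ivs & nth 0 ivs j \in (nth_clause cls (nth 0 ics i)).2].
Proof.
apply/flattenP/and3P => [[_ /mapP[i' + ->] /mapP[j' + [-> ->]]]|[li lj H]].
  by rewrite mem_iota => li; rewrite mem_filter mem_iota => /andP[H lj].
eexists; first by apply/mapP; exists i; rewrite ?mem_iota.
by apply/mapP; exists j; rewrite // mem_filter mem_iota H.
Qed.

Lemma no_chainP ics ivs : reflect (forall i1 i2 i3 j1 j2 j3,
   i1 < i2 -> i2 < i3 -> j1 < j2 -> j2 < j3 -> (i1, j1) \in chords ics ivs ->
   (i2, j2) \in chords ics ivs -> (i3, j3) \in chords ics ivs -> False) (no_chain ics ivs).
Proof.
apply: (iffP allP) => [H i1 i2 i3 j1 j2 j3 l1 l2 l3 l4 m1 m2 m3|H [i1 j1] m1].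
  by have /allP/(_ _ m2)/allP/(_ _ m3) := H _ m1; rewrite /= l1 l2 l3 l4.
apply/allP => -[i2 j2] m2; apply/allP => -[i3 j3] m3; apply/negP => /=.
by move=> /andP[/andP[l1 l2] /andP[l3 l4]]; apply: H l1 l2 l3 l4 m1 m2 m3.
Qed.

Let kappa : seq (vertex phi) := map inl cs ++ map inr vs.

Lemma linking_data : linking_cycle kappa <->
  [/\ 3 <= size cs + size vs, uniq cs, uniq vs, forall j, j \in cs & forall i, i \in vs].
Proof.
have szk : size kappa = size cs + size vs by rewrite size_cat; congr (_ + _); exact: size_map.
rewrite /linking_cycle szk /kappa cat_uniq.
have inlI : injective (inl : _ -> vertex phi) by move=> ? ? [].
have inrI : injective (inr : _ -> vertex phi) by move=> ? ? [].
have D : ~~ has [in [seq (inl i : vertex phi) | i <- cs]] [seq inr i | i <- vs].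
  by apply/hasPn => _ /mapP[i _ ->]; apply/mapP => -[].
rewrite D !map_inj_uniq //=.
split=> [[s3 /andP[u1 u2] al _]|[s3 u1 u2 a1 a2]]; split=> //.
- move=> j; have := al (inl j); rewrite mem_cat mem_map // => /orP[//|/mapP[]] //.
- move=> i; have := al (inr i); rewrite mem_cat (mem_map inrI) => /orP[/mapP[]|] //.
- by rewrite u1 u2.
- by case=> [j|i]; rewrite mem_cat ?(mem_map inlI) ?(mem_map inrI) ?a1 ?a2 ?orbT.
- by exists cs, vs.
Qed.

Lemma chord_data x0 i j : i < size cs -> j < size vs ->
  chord cs vs x0 i (size cs + j) = ((i, j) \in chords (map val cs) (map val vs)).
Proof.
move=> li lj; rewrite mem_chords !size_map li lj /chord !nth_cat size_map li ifF; last by lia.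
have [c0 v0] : 'I_(size (clauses phi)) * 'I_(nvars phi).
  by split; [case: (cs) li => // c|case: (vs) lj => // v].
rewrite (nth_map c0) // addKn (nth_map v0) // incidence_data.
by rewrite (nth_map v0) // (nth_map c0).
Qed.

Lemma planar_data (R : realType) : linking_cycle kappa ->
  planar R (linked_graph kappa) <-> no_chain (map val cs) (map val vs).
Proof.
move=> link; have szk : size kappa = size cs + size vs by rewrite size_cat; congr (_ + _); exact: size_map.
have [x0 _] : {x0 : vertex phi | x0 \in kappa}.
  by case: link => + _ _ _; case: (kappa) => // x s _; exists x; rewrite mem_head.
split=> [pl|/no_chainP nc].
  apply/no_chainP => i1 i2 i3 j1 j2 j3 l1 l2 l3 l4 m1 m2 m3.
  have := m1; have := m2; have := m3; rewrite !mem_chords !size_map.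
  move=> /and3P[li3 lj3 _] /and3P[li2 lj2 _] /and3P[li1 lj1 _].
  rewrite -(chord_data x0) // in m1; rewrite -(chord_data x0) // in m2; rewrite -(chord_data x0) // in m3.
  apply: (@linked_no_crossing_triple R phi kappa link x0 i1 i2 i3 (size cs + j1) (size cs + j2) (size cs + j3)) pl; rewrite ?szk ?ltn_add2l //.
  - exact: leq_trans li3 (leq_addr _ _).
  - by apply/orP; left.
  - by apply/orP; left.
  - by apply/orP; left.
apply: (@linked_graph_planar R phi cs vs link x0).
move=> i1 i2 i3 j1 j2 j3 l1 l2 l3 l4 l5 lN c1 c2 c3.
rewrite -/kappa szk in lN.
have up i j : i < j -> j < size cs + size vs -> chord cs vs x0 i j ->
    [/\ i < size cs, size cs <= j & (i, j - size cs) \in chords (map val cs) (map val vs)].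
  move=> ij jN ch; have /andP[h1 h2] : i < size cs <= j by apply: chord_lt ch; rewrite // -/kappa szk.
  by split=> //; rewrite -(chord_data x0) ?subnKC // ltn_subLR.
have [_ h1 m1] := up i1 j1 (ltn_trans l1 (ltn_trans l2 l3)) (ltn_trans l4 (ltn_trans l5 lN)) c1.
have [_ h2 m2] := up i2 j2 (ltn_trans l2 (ltn_trans l3 l4)) (ltn_trans l5 lN) c2.
have [_ h3 m3] := up i3 j3 (ltn_trans l3 (ltn_trans l4 l5)) lN c3.
by apply: nc l1 l2 _ _ m1 m2 m3; apply: ltn_sub2r => //; apply: leq_ltn_trans h1 _ => //; exact: ltn_trans l5.
Qed.
End Data.

(** Clauses are compared through their codes. A list of length [m] that contains all numbers below
    [m] is a permutation of them, which is what the tests on [cs] and [vs] ensure. *)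
Definition valid_data N (cls : seq mclause) (cs vs : seq nat) : bool :=
  [&& uniq [seq raw_clause N c | c <- cls], all (fun c => size (clause_vars N c) <= 3) cls,
      3 <= size cls + N, size cs == size cls, all (fun j => j \in cs) (iota 0 (size cls)),
      size vs == N, all (fun i => i \in vs) (iota 0 N) & no_chain cls cs vs].

Lemma uniq_raw_clause N cls :
  uniq [seq raw_clause N c | c <- cls] = uniq [seq set_of N c | c <- cls].
Proof.
rewrite -(map_inj_uniq (f := @enc_clause N)) -?map_comp.
  by congr uniq; apply: eq_map => c /=; rewrite enc_clause_set_of.
move=> c d E; have := @prefix_free_clause N c d [::] [::]; rewrite !cats0.
by case/(_ E).
Qed.

Lemma lift_ordinals m (s : seq nat) : size s = m -> all (fun j => j \in s) (iota 0 m) ->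
  exists s' : seq 'I_m, [/\ map val s' = s, uniq s' & forall j, j \in s'].
Proof.
move=> sz /allP H.
have le : size s <= size (iota 0 m) by rewrite size_iota sz.
have us : uniq s := leq_size_uniq (iota_uniq 0 m) H le.
have [_ E] := uniq_min_size (iota_uniq 0 m) H le.
have [s' Es] : exists s' : seq 'I_m, map val s' = s.
  case: m {sz H le} E => [|m] E; first by exists [::]; case: s {us} E => // x s /(_ x); rewrite mem_head.
  exists (map inord s); rewrite -map_comp map_id_in // => x xs /=.
  by rewrite inordK //; have := E x; rewrite xs mem_iota.
exists s'; split=> //; first by rewrite -(map_inj_uniq val_inj) Es.
by move=> j; rewrite -(mem_map val_inj) Es; apply: H; rewrite mem_iota ltn_ord.
Qed.

Lemma valid_data_instance (R : realType) N cls cs vs : valid_data N cls cs vs ->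
  exists (phi : cnf) (kappa : seq (vertex phi)),
  [/\ raw_instance N cls cs vs = enc_instance kappa, three_cnf phi /\ monotone_cnf phi,
      linking_cycle kappa, planar R (linked_graph kappa) &
      satisfiable phi <-> exists a, all (sat_clause N a) cls].
Proof.
case/and5P=> ucls c3 s3 szc /and4P[mc szv mv nc].
have u : uniq [seq set_of N c | c <- cls] by rewrite -uniq_raw_clause.
have [||cs' [Ec uc ac]] := @lift_ordinals (size [seq set_of N c | c <- cls]) cs.
- by rewrite size_map (eqP szc).
- by rewrite size_map.
have [|vs' [Ev uv av]] := @lift_ordinals N vs (eqP szv); first by [].
have szc' : size cs' = size cls by rewrite -(size_map val cs') Ec (eqP szc).
have szv' : size vs' = N by rewrite -(size_map val vs') Ev (eqP szv).
have lk : @linking_cycle (Cnf u) (map inl cs' ++ map inr vs').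
  by apply/linking_data; split=> //; rewrite szc' szv'.
exists (Cnf u), (map inl cs' ++ map inr vs'); split=> //.
- by rewrite enc_instance_data Ec Ev.
- by split; [rewrite three_cnf_data|exact: monotone_data].
- by apply/planar_data => //; rewrite Ec Ev.
- exact: satisfiable_data.
Qed.

Lemma language_of_data (R : realType) N cls cs vs : valid_data N cls cs vs ->
  linked_planar_3SAT R monotone_cnf (raw_instance N cls cs vs) <->
  exists a, all (sat_clause N a) cls.
Proof.
move=> /(valid_data_instance R) [phi [kappa [E c3 lk pl sat]]].
rewrite -sat; split=> [[psi [k [E' _ _ _ sat']]]|sat']; last by exists phi, kappa.
(* Injectivity of the encoding: any instance with this code has the formula [phi]. *)
by have /= -> := f_equal (@projT1 _ _) (enc_instance_inj (etrans (esym E) E')).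
Qed.

(** The empty clause gets the sign [true], vacuously. *)
Definition clause_data n (c : {set literal n}) : mclause :=
  ([forall l in c, l.2], [seq val i | i <- enum (cvars c)]).

Lemma set_of_clause_data n (c : {set literal n}) : monotone_clause c ->
  set_of n (clause_data c) = c.
Proof.
move=> mc; have sgn l : l \in c -> l.2 = [forall l in c, l.2].
  move=> lc; case/orP: mc => /forall_inP H; last first.
    by rewrite (negbTE (H _ lc)); apply/esym/negbTE/forall_inPn; exists l; rewrite ?H.
  by rewrite H //; apply/esym/forall_inP.
apply/finset.setP => l; rewrite inE /= (mem_map val_inj) mem_enum.
apply/andP/idP => [[/imsetP[l' l'c E] /eqP El]|lc].
  by rewrite (surjective_pairing l) El E -(sgn _ l'c) -surjective_pairing.
by split; [exact: imset_f|rewrite -(sgn _ lc)].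
Qed.

Lemma data_of_instance (R : realType) phi (kappa : seq (vertex phi)) :
  three_cnf phi -> monotone_cnf phi -> linking_cycle kappa -> planar R (linked_graph kappa) ->
  exists cls cs vs, [/\ enc_instance kappa = raw_instance (nvars phi) cls cs vs,
    valid_data (nvars phi) cls cs vs,
    all (fun c => (size c.2 <= nvars phi) && all (fun v => v < nvars phi) c.2) cls &
    satisfiable phi -> exists a, all (sat_clause (nvars phi) a) cls].
Proof.
case: phi kappa => n cl u kappa c3 mono lk pl /=.
pose cls := [seq clause_data c | c <- cl].
have Ecl : [seq set_of n c | c <- cls] = cl.
  rewrite -map_comp map_id_in // => c cc; apply: set_of_clause_data; exact: (allP mono).
have bd : all (fun c : mclause => (size c.2 <= n) && all (fun v => v < n) c.2) cls.
  apply/allP => _ /mapP[c _ ->] /=; rewrite size_map -cardE; apply/andP; split.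
    by rewrite -[X in _ <= X](card_ord n); exact: max_card.
  by apply/allP => _ /mapP[i _ ->].
move: cls Ecl bd => cls Ecl bd; subst cl.
have [_ _ _ [cs [vs Ek]]] := lk; subst kappa.
have [s3 uc uv ac av] := (iffLR (linking_data _ _)) lk.
have szc : size cs = size cls.
  rewrite -(size_map (set_of n)) -[RHS](card_ord) cardE; apply/eqP.
  by rewrite eqn_leq (uniq_leq_size uc) ?(uniq_leq_size (enum_uniq _)) // => j _; rewrite ?mem_enum ?ac.
have szv : size vs = n.
  rewrite -[RHS](card_ord) cardE; apply/eqP.
  by rewrite eqn_leq (uniq_leq_size uv) ?(uniq_leq_size (enum_uniq _)) // => j _; rewrite ?mem_enum ?av.
exists cls, (map val cs), (map val vs); split=> //.
- exact: enc_instance_data.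
- rewrite /valid_data uniq_raw_clause u -(three_cnf_data u) c3 !size_map szc szv !eqxx /=.
  have -> : 2 < size cls + n by move: s3; rewrite szc szv.
  rewrite /= (iffLR (planar_data R lk) pl) andbT; apply/andP; split.
    apply/allP => j; rewrite mem_iota => /= lj.
    have lj' : j < size [seq set_of n c | c <- cls] by rewrite size_map.
    by apply/mapP; exists (Ordinal lj'); rewrite ?ac.
  apply/allP => j; rewrite mem_iota => /= lj.
  by apply/mapP; exists (Ordinal lj); rewrite ?av.
- by move/satisfiable_data.
Qed.

(** * A polynomial-time verifier and the size of certificates *)

Lemma enc_seqE (T : Type) (f : T -> seq bool) s :
  enc_seq f s = flatten [seq true :: f x | x <- s] ++ [:: false].
Proof. by elim: s => //= x s ->; rewrite catA. Qed.

Lemma pt_enc_seq {A B : ctype} (f : A -> B -> seq bool) (l : A -> seq B) :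
  pt (fun u : A * B => f u.1 u.2) -> pt l -> pt (fun x => enc_seq (f x) (l x)).
Proof.
move=> pf pl; apply: (pt_recode (f := fun x => flatten [seq true :: f x b | b <- l x] ++ [:: false])).
  by move=> x; rewrite enc_seqE.
by pts.
Qed.

Lemma pt_enc_nat {A : ctype} (n : A -> nat) : pt n -> pt (fun x => enc_nat (n x)).
Proof.
move=> pn; apply: (pt_recode (f := fun x => nseq (n x) true ++ [:: false])).
  by move=> x; rewrite cats1.
by pts.
Qed.

Ltac pt_step_enc := first [ pt_step | match goal with
  | |- pt (fun x => enc_nat (@?n x)) => apply: (pt_enc_nat (n := n))
  | |- pt (fun x => enc_seq (@?f x) (@?l x)) => apply: (pt_enc_seq (f := f) (l := l))
  | |- pt (fun x => (@?f x) == (@?g x) :> seq bool) => apply: (pt_eq_bits (f := f) (g := g))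
  | |- pt (fun x => uniq (@?f x)) => apply: (pt_uniq_bits (f := f))
  end; cbv beta ].
Ltac ptse := repeat pt_step_enc.

Lemma pt_clause_vars {A : ctype} (n : A -> nat) (c : A -> mclause) :
  pt n -> pt c -> pt (fun x => clause_vars (n x) (c x)).
Proof. move=> pn pc; rewrite /clause_vars; ptse. Qed.

Lemma pt_nth_clause {A : ctype} (l : A -> seq mclause) (j : A -> nat) :
  pt l -> pt j -> pt (fun x => nth_clause (l x) (j x)).
Proof. by move=> pl pj; rewrite /nth_clause; ptse. Qed.

Lemma pt_raw_clause {A : ctype} (n : A -> nat) (c : A -> mclause) :
  pt n -> pt c -> pt (fun x => raw_clause (n x) (c x)).
Proof.
move=> pn pc; have pv := pt_clause_vars pn pc.
by rewrite /raw_clause; ptse.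
Qed.

Section PtInstance.
Context {A : ctype}.
Variables (n : A -> nat) (cls : A -> seq mclause) (cs vs : A -> seq nat).
Hypotheses (pn : pt n) (pcls : pt cls) (pcs : pt cs) (pvs : pt vs).

Lemma pt_raw_instance : pt (fun x => raw_instance (n x) (cls x) (cs x) (vs x)).
Proof.
have p1 : pt (fun u : A * mclause => raw_clause (n u.1) u.2).
  by apply: (pt_raw_clause (n := fun u : A * mclause => n u.1) (c := fun u => u.2)); ptse.
have p2 : pt (fun u : A * nat => clause_vars (n u.1) (nth_clause (cls u.1) u.2)).
  apply: (pt_clause_vars (n := fun u : A * nat => n u.1) (c := fun u : A * nat => nth_clause (cls u.1) u.2)); ptse.
  by apply: (pt_nth_clause (l := fun u : A * nat => cls u.1) (j := fun u => u.2)); ptse.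
by rewrite /raw_instance /raw_edges; ptse.
Qed.

Lemma pt_no_chain : pt (fun x => no_chain (cls x) (cs x) (vs x)).
Proof.
have pch : pt (fun x => chords (cls x) (cs x) (vs x)).
  by rewrite /chords; ptse; apply: pt_nth_clause; ptse.
pose h x := chords (cls x) (cs x) (vs x).
have {}pch : pt h := pch; apply: (pt_recode (f := fun x => all (fun e1 => all (fun e2 => all (fun e3 =>
    ~~ ((e1.1 < e2.1) && (e2.1 < e3.1) && ((e1.2 < e2.2) && (e2.2 < e3.2)))) (h x)) (h x)) (h x))) => //.
by move: h pch => h pch; ptse.
Qed.

Lemma pt_valid_data : pt (fun x => valid_data (n x) (cls x) (cs x) (vs x)).
Proof.
have pnc := pt_no_chain.
have p1 : pt (fun u : A * mclause => raw_clause (n u.1) u.2).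
  by apply: (pt_raw_clause (n := fun u : A * mclause => n u.1) (c := fun u => u.2)); ptse.
have p2 : pt (fun u : A * mclause => clause_vars (n u.1) u.2).
  by apply: (pt_clause_vars (n := fun u : A * mclause => n u.1) (c := fun u => u.2)); ptse.
by rewrite /valid_data; ptse.
Qed.
End PtInstance.

(** A node bit with fewer than two trees on the stack is ignored; this can happen only on padding or
    on malformed input. *)
Definition tree_step (acc : seq tree) (b : bool) : seq tree :=
  if b then (if nilp (behead acc) then acc
             else Node (head Leaf acc) (head Leaf (behead acc)) :: behead (behead acc))
  else Leaf :: acc.

(* Polish notation read backwards with a stack: [enc t] followed by arbitrary
   padding is parsed as [t]. *)
Definition parse_tree (y : seq bool) : tree := head Leaf (foldl tree_step [::] (rev y)).

Lemma foldl_tree_step t acc : foldl tree_step acc (rev (enc t)) = t :: acc.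
Proof.
elim: t acc => [|t IHt u IHu] acc //=.
by rewrite rev_cons rev_cat -cats1 !foldl_cat IHu IHt.
Qed.

Lemma parse_treeK t v : parse_tree (enc t ++ v) = t.
Proof. by rewrite /parse_tree rev_cat foldl_cat foldl_tree_step. Qed.

Lemma pt_node {A : ctype} (f g : A -> tree) : pt f -> pt g -> pt (fun x => Node (f x) (g x)).
Proof. by move=> pf pg; apply: (pt_recode (f := fun x => (f x, g x))); last exact: pt_pair. Qed.

Lemma pt_parse_tree : pt parse_tree.
Proof.
rewrite /parse_tree; apply: pt_head; first exact: pt_const.
apply: (pt_foldl (f := fun _ b s => tree_step s b) (q := fun=> 2)).
- by rewrite /tree_step; pts; apply: pt_node; pts.
- exact: pb_const.
- move=> _ b s; rewrite /tree_step; case: b; last by rewrite csize_cons; rewrite /csize /= /tsize /=; lia.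
  case: s => [|a [|a' s]] //=; rewrite ?csize_cons ?leq_addr //.
  by rewrite /csize /= tsize_node; lia.
- exact: pt_rev pt_id.
- exact: pt_const.
Qed.

Fixpoint tree_seq (t : tree) : seq tree := if t is Node a b then a :: tree_seq b else [::].
Definition tree_nat (t : tree) := size (tree_seq t).

Lemma pt_tree_seq : pt tree_seq.
Proof.
apply: (pt_recode (f := id)) pt_id.
by elim=> //= a _ b IHb; rewrite /code /= /code_seq /= in IHb *; rewrite -IHb.
Qed.

Lemma pt_tree_nat : pt tree_nat.
Proof. by have p := pt_tree_seq; rewrite /tree_nat; pts. Qed.

Lemma tree_seqK {A : ctype} (s : seq A) : tree_seq (code s) = map code s.
Proof. by elim: s => //= x s; rewrite /code /= /code_seq /= => ->. Qed.

Lemma tree_natK n : tree_nat (code n) = n.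
Proof. by rewrite /tree_nat; elim: n => //= n; rewrite /code /= => ->. Qed.

Definition certificate := (nat * (seq mclause * (seq nat * (seq nat * seq bool))))%type.

Definition tree_cert (t : tree) : certificate :=
  let t1 := tlT t in let t2 := tlT t1 in let t3 := tlT t2 in
  (tree_nat (hdT t), ([seq (is_node (hdT u), [seq tree_nat x | x <- tree_seq (tlT u)]) | u <- tree_seq (hdT t1)],
   ([seq tree_nat x | x <- tree_seq (hdT t2)], ([seq tree_nat x | x <- tree_seq (hdT t3)],
    [seq is_node x | x <- tree_seq (tlT t3)])))).

Lemma tree_certK (c : certificate) : tree_cert (code c) = c.
Proof.
case: c => n [cls [cs [vs a]]].
have K (s : seq nat) : [seq tree_nat x | x <- tree_seq (code s)] = s.
  by rewrite tree_seqK -map_comp map_id_in // => x _ /=; rewrite tree_natK.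
rewrite /tree_cert /= tree_natK !K !tree_seqK -!map_comp; congr (_, (_, (_, (_, _)))).
  by rewrite map_id_in // => -[b s] _ /=; rewrite K; case: b.
by rewrite map_id_in // => -[].
Qed.

Lemma pt_tree_cert : pt tree_cert.
Proof.
have [p1 p2 p3 p4 p5] : [/\ pt hdT, pt tlT, pt is_node, pt tree_seq & pt tree_nat].
  by split; [exact: pt_hdT|exact: pt_tlT|exact: pt_is_node|exact: pt_tree_seq|exact: pt_tree_nat].
by rewrite /tree_cert; pts.
Qed.

(** The input word is never parsed: the certificate supplies the raw data, which are encoded again
    and compared with the word. *)
Definition verify (u : seq bool * seq bool) : bool :=
  let c := tree_cert (parse_tree u.2) in
  (u.1 == raw_instance c.1 c.2.1 c.2.2.1 c.2.2.2.1) &&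
  valid_data c.1 c.2.1 c.2.2.1 c.2.2.2.1 &&
  all (fun cl : mclause => has (fun v => (v < c.1) && (nth true c.2.2.2.2 v == cl.1)) cl.2) c.2.1.

Lemma pt_verify : pt verify.
Proof.
pose g y := tree_cert (parse_tree y); have pc : pt g := pt_comp pt_parse_tree pt_tree_cert.
have E : verify =1 (fun u => (u.1 == raw_instance (g u.2).1 (g u.2).2.1 (g u.2).2.2.1 (g u.2).2.2.2.1) &&
  valid_data (g u.2).1 (g u.2).2.1 (g u.2).2.2.1 (g u.2).2.2.2.1 &&
  all (fun cl : mclause => has (fun v => (v < (g u.2).1) && (nth true (g u.2).2.2.2.2 v == cl.1)) cl.2) (g u.2).2.1) by [].
apply: (pt_recode (f := _)) (_ : pt _); first by move=> u; rewrite E; reflexivity.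
move: g pc {E} => g pc.
have p1 : pt (fun u : seq bool * seq bool => raw_instance (g u.2).1 (g u.2).2.1 (g u.2).2.2.1 (g u.2).2.2.2.1).
  by apply: (pt_raw_instance (n := fun u : seq bool * seq bool => (g u.2).1)); ptse.
have p2 : pt (fun u : seq bool * seq bool => valid_data (g u.2).1 (g u.2).2.1 (g u.2).2.2.1 (g u.2).2.2.2.1).
  by apply: (pt_valid_data (n := fun u : seq bool * seq bool => (g u.2).1)); ptse.
by ptse.
Qed.

Lemma csize_seq_le {A : ctype} (s : seq A) k m : size s <= k -> all (fun x => csize x <= m) s ->
  csize s <= k * m.+1 + 1.
Proof.
elim: s k => [|x s IH] k /=; first by rewrite addn1.
case: k => // k sk /andP[xm al]; rewrite csize_cons.
by have := IH k sk al; rewrite mulSn; lia.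
Qed.

Lemma size_enc_seq (T : Type) (f : T -> seq bool) s : size s < size (enc_seq f s).
Proof. by elim: s => //= x s IH; rewrite size_cat; lia. Qed.

(** The largest part is the clause list: [k] clauses of [k] unary numbers below [k] take about
    [2 * k ^ 3] bits, so a fourth power leaves room for everything. *)
Lemma csize_cert n k cls cs vs a : n <= k -> size cls <= k -> size cs <= k -> size vs <= k -> size a <= k ->
  all (fun c : mclause => (size c.2 <= k) && all (fun v => v < k) c.2) cls ->
  all (fun v => v <= k) cs -> all (fun v => v <= k) vs ->
  csize ((n, (cls, (cs, (vs, a)))) : certificate) <= csize ((k + 2) ^ 4).
Proof.
move=> nk sc scs svs sa ac acs avs; rewrite !csize_pair [X in _ <= X]csize_nat.
have cn v : v <= k -> csize v <= 2 * k + 1 by rewrite csize_nat; lia.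
have l1 := cn n nk.
have l2 : csize cs <= k * (2 * k + 1).+1 + 1 by apply: csize_seq_le => //; apply: sub_all acs => v /cn.
have l3 : csize vs <= k * (2 * k + 1).+1 + 1 by apply: csize_seq_le => //; apply: sub_all avs => v /cn.
have l4 : csize a <= k * 4 + 1 by apply: csize_seq_le => //; apply/allP => -[].
have l5 : csize cls <= k * (k * (2 * k + 1).+1 + 5).+1 + 1.
  apply: csize_seq_le => //; apply: sub_all ac => -[b s] /andP[/= ss al]; rewrite csize_pair.
  have : csize s <= k * (2 * k + 1).+1 + 1.
    by apply: csize_seq_le => //; apply: sub_all al => v /ltnW /cn.
  have : csize b <= 3; [by case: b|lia].
rewrite (_ : (k + 2) ^ 4 = k * k * (k * k) + 8 * (k * (k * k)) + 24 * (k * k) + 32 * k + 16); last first.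
  by rewrite !expnS expn0 !mulnDl !mulnDr; lia.
move: l1 l2 l3 l4 l5; move: (csize n) (csize cs) (csize vs) (csize a) (csize cls) => *; nia.
Qed.

Theorem linked_planar_in_NP (R : realType) : in_NP (linked_planar_3SAT R monotone_cnf).
Proof.
apply: (@pt_in_NP nat_ctype _ (fun w => (size w + 2) ^ 4) verify); first by pts.
  exact: pt_verify.
move=> w; split=> [[phi [kappa [-> [c3 mono] lk pl sat]]]|[y [sz]]]; last first.
  rewrite /verify; case: (tree_cert _) => n [cls [cs [vs a]]] /= /andP[/andP[/eqP -> vd] st].
  by apply/language_of_data => //; exists (nth true a).
have [cls [cs [vs [E vd bd st]]]] := data_of_instance c3 mono lk pl.
have [a sa] := st sat; set w0 := enc_instance kappa.
pose n := nvars phi; pose c : certificate := (n, (cls, (cs, (vs, mkseq a n)))).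
have [lw1 lw2] : n <= size w0 /\ size cls <= size w0.
  rewrite /w0 E /raw_instance !size_cat size_rcons size_nseq.
  by have := size_enc_seq (raw_clause n) cls; rewrite -/n; lia.
have /and5P[_ _ _ /eqP szc /and4P[mc /eqP szv mv _]] := vd.
have bdd m (s : seq nat) : size s = m -> all (fun j => j \in s) (iota 0 m) -> m <= size w0 ->
    all (fun v => v <= size w0) s.
  move=> /lift_ordinals H /H [s' [<- _ _]] lm.
  by apply/allP => _ /mapP[j _ ->]; apply: leq_trans lm; exact: ltnW (ltn_ord j).
have le : csize c <= csize ((size w0 + 2) ^ 4).
  apply: csize_cert => //; rewrite ?szc ?szv ?size_mkseq //.
  - apply: sub_all bd => d /andP[h1 h2]; rewrite (leq_trans h1) //=.
    by apply: sub_all h2 => v vn; exact: leq_trans lw1.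
  - exact: bdd szc mc lw2.
  - exact: bdd szv mv lw1.
(* Padded to the exact length required by [pt_in_NP]; [parse_tree] ignores the padding. *)
exists (enc (code c) ++ nseq (csize ((size w0 + 2) ^ 4) - csize c) true); split.
  by rewrite size_cat size_nseq -/(csize c) subnKC.
set y := enc _ ++ _; have Ec : tree_cert (parse_tree y) = c by rewrite parse_treeK tree_certK.
rewrite /verify Ec /= /w0 E eqxx vd /=.
apply: sub_all sa => d /hasP[v vd' /andP[vn av]]; apply/hasP; exists v => //.
by rewrite vn nth_mkseq.
Qed.

(** * Queue programs *)

(* A queue operation: the number of entries popped from the front and the
   clauses constraining the entry pushed at the back.  A clause shape lists its
   sign, the offsets of its variables from the front (the pushed entry must not
   be among them) and the offsets from the back (0 is the pushed entry). *)
Definition shape := (bool * (seq nat * seq nat))%type.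
Definition op := (nat * seq shape)%type.

Definition shape_values (s : shape) (front back : seq bool) : seq bool :=
  [seq nth false front d | d <- s.2.1] ++ [seq nth false back d | d <- s.2.2].

Definition op_holds (o : op) (front back : seq bool) : bool :=
  all (fun s : shape => s.1 \in shape_values s front back) o.2.

Fixpoint qrun (ops : seq op) (q q' : seq bool) : Prop :=
  if ops is o :: ops' then
    exists2 b, op_holds o q (b :: rev q) & qrun ops' (drop o.1 (rcons q b)) q'
  else q' = q.

Lemma qrun_cat s t q q' : qrun (s ++ t) q q' <-> exists2 q1, qrun s q q1 & qrun t q1 q'.
Proof.
elim: s q => [|o s IH] q /=; first by split=> [H|[_ -> //]]; exists q.
split=> [[b H /IH[q1 H1 H2]]|[q1 [b H H1] H2]].
  by exists q1 => //; exists b.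
by exists b => //; apply/IH; exists q1.
Qed.

Definition op_fits (o : op) (n m : nat) : bool :=
  (o.1 <= n) && all (fun s : shape => all (fun d => d < n) s.2.1 && all (fun d => d <= m) s.2.2) o.2.

Fixpoint qfits (ops : seq op) (L : nat) : option nat :=
  if ops is o :: ops' then
    if op_fits o L L then qfits ops' (L.+1 - o.1) else None
  else Some L.

Lemma qfits_cat s t L : qfits (s ++ t) L = obind (qfits t) (qfits s L).
Proof. by elim: s L => //= o s IH L; case: ifP. Qed.

Definition shape_le (s t : shape) : bool :=
  all (fun d => all (fun e => d <= e) t.2.1) s.2.1 &&
  all (fun d => all (fun e => e <= d) t.2.2) s.2.2.

Definition shape_neq (s t : shape) : bool :=
  (s.1 != t.1) || ((t.2.2 == [:: 0]) && has (fun d => d \notin t.2.1) s.2.1).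

(** The bounds on offsets make both groups of variables advance weakly from one operation to the
    next: the next front starts at [P + o.1], and the next pushed entry is [k.+1]. The pairwise
    condition asks the same within one operation, where it also keeps clauses distinct. *)
Definition op_form (o : op) : bool :=
  all (fun s : shape => [&& 0 \in s.2.2, all (fun d => d <= 1) s.2.2,
      all (fun d => d <= o.1) s.2.1 & size s.2.1 + size s.2.2 <= 3]) o.2 &&
  pairwise (fun s t => shape_le s t && shape_neq s t) o.2.

(* Clauses in absolute form keep the two groups of variables apart: the first
   is the one drawn on one side of the cycle, the second on the other. *)
Definition place P k (s : shape) : shape :=
  (s.1, ([seq P + d | d <- s.2.1], [seq k - d | d <- s.2.2])).

Fixpoint gen P k (ops : seq op) : seq shape :=
  if ops is o :: ops' then map (place P k) o.2 ++ gen (P + o.1) k.+1 ops' else [::].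

Definition flat (s : shape) : mclause := (s.1, s.2.1 ++ s.2.2).

Definition page_le (s t : shape) : bool :=
  all (fun d => all (fun e => d <= e) t.2.1) s.2.1 &&
  all (fun d => all (fun e => d <= e) t.2.2) s.2.2.

Lemma gen_bounds P k ops s : all op_form ops -> s \in gen P k ops ->
  all (fun d => P <= d) s.2.1 && all (fun d => k <= d.+1) s.2.2.
Proof.
elim: ops P k => //= o ops IH P k /andP[/andP[fo _] fops]; rewrite mem_cat.
case/orP=> [/mapP[t to ->]|/IH].
  have /and4P[_ h1 _ _] := allP fo _ to; rewrite /= !all_map; apply/andP; split.
    by apply/allP => d _ /=; rewrite leq_addr.
  by apply: sub_all h1 => d /=; lia.
move=> /(_ fops)/andP[h1 h2]; apply/andP; split.
  by apply: sub_all h1 => d; apply: leq_trans (leq_addr _ _).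
by apply: sub_all h2 => d /=; lia.
Qed.

Lemma gen_page_le P k ops : all op_form ops -> pairwise page_le (gen P k ops).
Proof.
elim: ops P k => //= o ops IH P k /andP[fo fops]; rewrite pairwise_cat IH // andbT.
have /andP[ao po] := fo; apply/andP; split.
  apply/allrelP => _ t /mapP[s so ->] tg.
  have /andP[h1 h2] := gen_bounds fops tg; have /and4P[_ b1 b2 _] := allP ao _ so.
  rewrite /page_le /= !all_map; apply/andP; split; apply/allP => d /= ds; apply/allP => e et.
    by move: (allP h1 _ et) (allP b2 _ ds) => /=; clear; lia.
  by move: (allP h2 _ et) (allP b1 _ ds) => /=; clear; lia.
rewrite pairwise_map; apply: sub_pairwise po => s t /andP[/andP[h1 h2] _].
rewrite /= /page_le /= !all_map; apply/andP; split; apply/allP => d ds /=; rewrite all_map; apply/allP => e et /=.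
  by rewrite leq_add2l; exact: (allP (allP h1 _ ds)).
by apply: leq_sub2l; exact: (allP (allP h2 _ ds)).
Qed.

Definition clause_neq N (c d : mclause) : bool :=
  has (fun v => (v < N) && ((v \notin d.2) || (c.1 != d.1))) c.2 ||
  has (fun v => (v < N) && ((v \notin c.2) || (c.1 != d.1))) d.2.

Lemma clause_neqP N c d : clause_neq N c d -> set_of N c != set_of N d.
Proof.
have key (x y : mclause) v : v < N -> v \in x.2 -> (v \notin y.2) || (x.1 != y.1) -> set_of N x != set_of N y.
  move=> lv vx H; apply/eqP => /finset.setP /(_ (Ordinal lv, x.1)); rewrite !inE /= vx eqxx /=.
  by case/orP: H => [/negbTE -> //|/negbTE ->]; rewrite andbF.
case/orP=> /hasP[v vc /andP[lv H]]; first exact: key lv vc H.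
by rewrite eq_sym; apply: key lv vc _; rewrite [d.1 == _]eq_sym.
Qed.

(** A clause of a later operation contains the entry which that operation pushes, too recent for the
    earlier clause; within one operation [shape_neq] separates the clauses. *)
Lemma uniq_gen P k ops N L : all op_form ops -> qfits ops L != None -> k = P + L -> k + size ops <= N ->
  pairwise (fun s t => clause_neq N (flat s) (flat t)) (gen P k ops).
Proof.
elim: ops P k L => //= o ops IH P k L /andP[fo fops].
case: ifP => // /andP[poL fit] fits kP lN; have /andP[ao po] := fo.
rewrite pairwise_cat (IH _ _ _ fops fits); [|lia|lia].
rewrite andbT; apply/andP; split.
  have mx t P' k' : k < k' -> k' + size ops <= N -> t \in gen P' k' ops -> exists2 v, (k < v) && (v < N) & v \in t.2.2.
    elim: ops fops {IH fits lN} P' k' => //= o' ops IH /andP[fo' fops] P' k' lk lN; rewrite mem_cat.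
    case/orP=> [/mapP[s so ->]|]; last by apply: IH => //; lia.
    have /andP[/allP /(_ _ so) /and4P[h _ _ _] _] := fo'.
    by exists k'; [lia|rewrite /=; apply/mapP; exists 0; rewrite ?subn0].
  apply/allrelP => _ t /mapP[s so ->] tg.
  have [|v /andP[lv vN] vt] := mx t _ _ (ltnSn k) _ tg; first by lia.
  apply/orP; right; apply/hasP; exists v; first by rewrite mem_cat vt orbT.
  rewrite vN /= mem_cat; apply/orP; left; apply/negP => /orP[] /mapP[d ds Ev].
    by have /andP[/allP /(_ _ ds) dL _] := allP fit _ so; move: dL kP lv Ev; clear; lia.
  by move: lv Ev; clear; lia.
rewrite pairwise_map; apply: sub_in_pairwise (allss _) po => s t so to /andP[_].
have /and4P[s0 _ _ _] := allP ao _ so; have /andP[fs _] := allP fit _ so.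
case/orP=> [ne|/andP[/eqP t0 /hasP[d ds dt]]]; apply/orP; left; apply/hasP.
  exists k; first by rewrite mem_cat; apply/orP; right; apply/mapP; exists 0; rewrite ?subn0.
  by rewrite /= ne orbT andbT; move: lN; clear; lia.
exists (P + d); first by rewrite mem_cat map_f.
have dL := allP fs _ ds.
rewrite /= mem_cat t0 /= inE subn0; apply/andP; split; first by move: dL kP lN; clear; lia.
apply/orP; left; rewrite negb_or; apply/andP; split; last by move: dL kP; clear; lia.
by apply/mapP => -[e et /addnI ed]; rewrite ed et in dt.
Qed.

Section Semantics.
Variable N : nat.

Lemma sat_place (a : nat -> bool) P k L (s : shape) : k = P + L -> k < N ->
  all (fun d => d < L) s.2.1 -> all (fun d => d <= 1) s.2.2 -> all (fun d => d <= L) s.2.2 ->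
  sat_clause N a (flat (place P k s)) =
  (s.1 \in shape_values s [seq a i | i <- iota P L] (a k :: rev [seq a i | i <- iota P L])).
Proof.
move=> kP kN h1 h2 h3; rewrite /sat_clause /shape_values /= has_cat mem_cat !has_map.
rewrite -!has_pred1 !has_map; congr (_ || _); apply: eq_in_has => d ds /=.
  have dL := allP h1 _ ds; rewrite (nth_map 0) ?size_iota // nth_iota //.
  by have -> : P + d < N by lia.
have := allP h3 _ ds; have := allP h2 _ ds.
case: d {ds} => [|[|//]] _ dL; first by rewrite subn0 kN.
have -> /= : k - 1 < N by lia.
rewrite nth_rev ?size_map ?size_iota // (nth_map 0) ?size_iota; last by lia.
by rewrite nth_iota; [congr (a _ == _); lia|lia].
Qed.

(** Variables are numbered in the order of pushing: those below [k] already have values, the queue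
    holds those from [P] to [k], excluded, and the bit chosen by [qrun] is the value of [k]. *)
Lemma gen_qrun ops (a : nat -> bool) P k L : all op_form ops -> qfits ops L != None -> k = P + L ->
  k + size ops <= N ->
  (exists2 a', {in gtn k, a' =1 a} & all (sat_clause N a') (map flat (gen P k ops))) <->
  exists q', qrun ops [seq a i | i <- iota P L] q'.
Proof.
elim: ops a P k L => [|o ops IH] a P k L /=; first by split=> [_|]; [eexists|exists a].
case/andP=> fo fops; case: ifP => // /andP[poL fit] fits kP lN; have /andP[ao _] := fo.
have E a' : {in gtn k, a' =1 a} -> [seq a i | i <- iota P L] = [seq a' i | i <- iota P L].
  by move=> aa; apply/eq_in_map => i; rewrite mem_iota => li; rewrite aa // unfold_in /=; lia.
have holds a' : all (sat_clause N a') (map flat (map (place P k) o.2)) =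
    op_holds o [seq a' i | i <- iota P L] (a' k :: rev [seq a' i | i <- iota P L]).
  rewrite -map_comp all_map; apply: eq_in_all => s so /=.
  have /andP[h1 h3] := allP fit _ so; have /and4P[_ h2 _ _] := allP ao _ so.
  by apply: sat_place => //; lia.
have next a' : drop o.1 (rcons [seq a' i | i <- iota P L] (a' k)) = [seq a' i | i <- iota (P + o.1) (L.+1 - o.1)].
  by rewrite kP -cats1 -[[:: a' _]]/(map a' (iota (P + L) 1)) -map_cat -iotaD addn1 -map_drop drop_iota.
have IH' a' : (exists2 a2, {in gtn k.+1, a2 =1 a'} & all (sat_clause N a2) (map flat (gen (P + o.1) k.+1 ops))) <->
     exists q', qrun ops [seq a' i | i <- iota (P + o.1) (L.+1 - o.1)] q'.
  by apply: IH => //; lia.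
split=> [[a' aa]|[q' [b ho rn]]].
  rewrite map_cat all_cat holds => /andP[ho sa]; rewrite (E a') //.
  have [q' rn] : exists q', qrun ops [seq a' i | i <- iota (P + o.1) (L.+1 - o.1)] q'.
    by apply/IH'; exists a'.
  by exists q'; exists (a' k) => //; rewrite next.
pose a1 i := if i == k then b else a i.
have aa1 : {in gtn k, a1 =1 a} by move=> i; rewrite unfold_in /a1 /= => ik; rewrite ltn_eqF.
have bk : b = a1 k by rewrite /a1 eqxx.
move: ho rn; rewrite (E a1) // bk next => ho rn.
have [|a2 aa2 sa] := iffRL (IH' a1); first by exists q'.
have aa2' : {in gtn k, a2 =1 a1} by move=> i; rewrite !unfold_in /= => ik; apply: aa2; rewrite unfold_in /=; lia.
exists a2; first by move=> i ik; rewrite aa2' // aa1.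
rewrite map_cat all_cat sa andbT holds aa2 ?unfold_in /= ?leqnn //.
by rewrite (_ : [seq a2 i | i <- iota P L] = [seq a1 i | i <- iota P L]) // -!E // => i ik; rewrite aa2' // aa1.
Qed.
End Semantics.

Definition op_clauses (ops : seq op) : seq mclause := map flat (gen 0 0 ops).

Definition op_instance (ops : seq op) : seq bool :=
  raw_instance (size ops) (op_clauses ops) (rev (iota 0 (size (op_clauses ops)))) (iota 0 (size ops)).

(** Pigeonhole: of three chords two belong to the same group, front or back. In each group variables
    advance weakly along the clauses, so in the reversed clause order those two chords cannot both
    increase. *)
Lemma no_chain_gen ops N : all op_form ops ->
  no_chain (op_clauses ops) (rev (iota 0 (size (op_clauses ops)))) (iota 0 N).
Proof.
move=> fops; apply/no_chainP => i1 i2 i3 j1 j2 j3 l1 l2 l3 l4.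
have mono := pairwiseP (true, ([::], [::])) (gen_page_le 0 0 fops).
set g := gen 0 0 ops in mono *; rewrite /op_clauses -/g size_map; set m := size g in mono *.
have chordE i j : (i, j) \in chords (map flat g) (rev (iota 0 m)) (iota 0 N) ->
    let s := nth (true, ([::], [::])) g (m - i.+1) in i < m /\ ((j \in s.2.1) || (j \in s.2.2)).
  rewrite mem_chords size_rev !size_iota => /and3P[li lj].
  rewrite nth_iota // nth_rev ?size_iota // nth_iota; last by lia.
  have lm : m - i.+1 < m by lia.
  by rewrite !add0n /nth_clause (nth_map (true, ([::], [::]))) //= mem_cat.
move=> /chordE[k1 m1] /chordE[k2 m2] /chordE[k3 m3].
have lt i i' j j' : i < i' -> i' < m -> j < j' ->
    let s i := nth (true, ([::], [::])) g (m - i.+1) in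
    (j \in (s i).2.1) && (j' \in (s i').2.1) || (j \in (s i).2.2) && (j' \in (s i').2.2) -> False.
  move=> ii im jj s H; have /andP[h1 h2] : page_le (s i') (s i).
    by apply: mono; rewrite ?inE /= -/m; move: (m) ii im; clear; lia.
  by case/orP: H => /andP[ja jb]; [have := allP (allP h1 _ jb) _ ja|have := allP (allP h2 _ jb) _ ja]; rewrite leqNgt jj.
move: m1 m2 m3 => /orP[m1|m1] /orP[m2|m2] /orP[m3|m3];
  first [apply: (lt i1 i2 j1 j2) => //; rewrite m1 m2 ?orbT //; fail
        |apply: (lt i2 i3 j2 j3) => //; rewrite m2 m3 ?orbT //; fail
        |apply: (lt i1 i3 j1 j3); [lia|lia|lia|rewrite m1 m3 ?orbT //]].
Qed.

Lemma op_instance_valid ops : all op_form ops -> qfits ops 0 != None -> 3 <= size ops ->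
  valid_data (size ops) (op_clauses ops) (rev (iota 0 (size (op_clauses ops)))) (iota 0 (size ops)).
Proof.
move=> fops fits s3; rewrite /valid_data uniq_raw_clause no_chain_gen // size_rev !size_iota !eqxx !andbT.
rewrite (leq_trans s3 (leq_addl _ _)) /=; apply/and4P; split.
- rewrite uniq_pairwise pairwise_map /op_clauses pairwise_map.
  apply: sub_pairwise (@uniq_gen 0 0 ops (size ops) 0 fops fits _ _) => // s t.
  exact: clause_neqP.
- apply/allP => _ /mapP[s sg ->].
  have : size (flat s).2 <= 3.
    move: sg; move: {1}0 {1}0 => P k; elim: ops P k fops {fits s3} => //= o ops IH P k /andP[/andP[ao _] fops]; rewrite mem_cat.
    case/orP=> [/mapP[t to ->]|]; last exact: IH fops.
    by have /and4P[_ _ _] := allP ao _ to; rewrite /= size_cat !size_map.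
  apply: leq_trans; apply: uniq_leq_size; first by rewrite filter_uniq // iota_uniq.
  by move=> v; rewrite mem_filter => /andP[].
- by apply/allP => i; rewrite mem_rev.
- by apply/allP => i.
Qed.

Theorem op_instance_correct (R : realType) ops : all op_form ops -> qfits ops 0 != None -> 3 <= size ops ->
  linked_planar_3SAT R monotone_cnf (op_instance ops) <-> exists q, qrun ops [::] q.
Proof.
move=> fops fits s3; rewrite /op_instance language_of_data; last exact: op_instance_valid.
rewrite -[[::]]/([seq (fun=> false) i | i <- iota 0 0]) -(@gen_qrun (size ops) ops _ 0 0 0) //.
by split=> [[a]|[a _]] H; exists a.
Qed.

(** Replaces the recursion by a map with prefix sums, a form to which the polynomial-time closure
    properties apply. *)
Lemma genE P k ops : gen P k ops = flatten [seq map (place (P + sumn (take i (map fst ops))) (k + i))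
  (nth (0, [::]) ops i).2 | i <- iota 0 (size ops)].
Proof.
elim: ops P k => //= o ops IH P k; rewrite addn0 addn0 IH; congr (_ ++ flatten _).
rewrite -[in RHS]add1n iotaDl -map_comp; apply: eq_map => i /=.
by rewrite addnA addnS.
Qed.

Lemma pt_op_instance : pt op_instance.
Proof.
have pc : pt op_clauses.
  apply: (pt_recode (f := fun ops => map flat (flatten [seq map (place (0 + sumn (take i (map fst ops))) (0 + i))
    (nth ((0, [::]) : op) ops i).2 | i <- iota 0 (size ops)]))).
    by move=> ops; rewrite /op_clauses genE.
  by rewrite /flat /place; pts.
apply: (pt_raw_instance (n := fun ops : seq op => size ops)); by pts.
Qed.

(** * From monotone CNF to queue programs *)

Definition op_not (pop : nat) : op := (pop, [:: (true, ([:: 0], [:: 0])); (false, ([:: 0], [:: 0]))]).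
(** The usual three clauses, with the ternary one in the middle so that front offsets are weakly
    increasing, as [shape_le] demands. *)
Definition op_nand (pop : nat) : op :=
  (pop, [:: (true, ([:: 0], [:: 0])); (false, ([:: 0; 1], [:: 0])); (true, ([:: 1], [:: 0]))]).
Definition op_nor (pop : nat) : op :=
  (pop, [:: (false, ([:: 0], [:: 0])); (true, ([:: 0; 1], [:: 0])); (false, ([:: 1], [:: 0]))]).
Definition op_free : op := (0, [::]).
Definition op_false : op := (0, [:: (false, ([::], [:: 0]))]).
(** Each clause must contain the pushed entry. This entry is forced to be false, so the positive
    clause constrains the front alone; [op_or] works the same way. *)
Definition op_assert : op := (1, [:: (true, ([:: 0], [:: 0])); (false, ([::], [:: 0]))]).
Definition op_excl : op := (0, [:: (false, ([::], [:: 1; 0]))]).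
Definition op_or : op := (1, [:: (true, ([:: 0; 1], [:: 0])); (false, ([::], [:: 0]))]).

(** * Layers and gadgets on a block of the queue *)

Notation NOT := (op_not 1).

(* A layer consumes the block [ins] at the front of the queue; [prev] holds the
   entries it has already pushed, the last one first. *)
Fixpoint layer_outs (ops : seq op) (ins prev : seq bool) : seq (seq bool) :=
  if ops is o :: ops' then
    flatten [seq layer_outs ops' (drop o.1 ins) (b :: prev) |
               b <- [seq b <- [:: true; false] | op_holds o ins (b :: prev)]]
  else [:: rev prev].

Fixpoint layer_fits (ops : seq op) (n m : nat) : bool :=
  if ops is o :: ops' then op_fits o n m && layer_fits ops' (n - o.1) m.+1 else n == 0.

(** Locality: front offsets stay within the block being consumed and back offsets within the output
    of the layer, so the rest of the queue is invisible. *)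
Lemma op_holds_cat o ins rest prev b : op_fits o (size ins) (size prev) ->
  op_holds o (ins ++ rest ++ rev prev) (b :: rev (ins ++ rest ++ rev prev)) = op_holds o ins (b :: prev).
Proof.
case/andP=> _ fit; apply: eq_in_all => s so; have /andP[/allP f1 /allP f2] := allP fit _ so.
congr (_ \in _ ++ _); apply/eq_in_map => d ds.
  by rewrite nth_cat f1.
rewrite !rev_cat revK -catA -cat_cons nth_cat /=.
by rewrite ltnS f2.
Qed.

Lemma layer_outs_cons o ops ins prev outs : outs \in layer_outs (o :: ops) ins prev <->
  exists2 b, op_holds o ins (b :: prev) & outs \in layer_outs ops (drop o.1 ins) (b :: prev).
Proof.
rewrite /layer_outs -/layer_outs; split=> [/flatten_mapP[b]|[b ho H]].
  by rewrite mem_filter => /andP[ho _]; exists b.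
by apply/flatten_mapP; exists b; rewrite // mem_filter ho; case: (b).
Qed.

Lemma qrun_layer ops ins rest prev q' : layer_fits ops (size ins) (size prev) ->
  qrun ops (ins ++ rest ++ rev prev) q' <->
  exists2 outs, outs \in layer_outs ops ins prev & q' = rest ++ outs.
Proof.
elim: ops ins prev => [|o ops IH] ins prev.
  move=> /eqP/size0nil -> /=; split=> [->|[outs]]; first by exists (rev prev); rewrite ?mem_head.
  by rewrite inE => /eqP ->.
case/andP=> fit fits; have /andP[pop _] := fit.
have next b : drop o.1 (rcons (ins ++ rest ++ rev prev) b) = drop o.1 ins ++ rest ++ rev (b :: prev).
  by rewrite rcons_cat rcons_cat -rev_cons drop_cat; case: ltngtP pop => // ->; rewrite subnn drop0 drop_size.
have IHb b := IH (drop o.1 ins) (b :: prev); rewrite size_drop in IHb.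
split=> [[b]|[outs /layer_outs_cons[b ho oo] Eq]].
  rewrite op_holds_cat // next => ho /(IHb b fits) [outs oo Eq].
  by exists outs => //; apply/layer_outs_cons; exists b.
exists b; first by rewrite op_holds_cat.
by rewrite next; apply/IHb => //; exists outs.
Qed.

Lemma layer_qfits ops n r m : layer_fits ops n m -> qfits ops (n + r + m) = Some (r + m + size ops).
Proof.
elim: ops n m => [|o ops IH] n m /=; first by move=> /eqP ->; rewrite addn0.
case/andP=> /[dup] fit /andP[pop fs] /IH E.
have -> : op_fits o (n + r + m) (n + r + m).
  apply/andP; split; first by lia.
  apply: sub_all fs => s /andP[h1 h2]; apply/andP; split.
    by apply: sub_all h1 => d; clear; lia.
  by apply: sub_all h2 => d; clear; lia.
by have -> : (n + r + m).+1 - o.1 = n - o.1 + r + m.+1; [lia|rewrite E; congr Some; lia].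
Qed.

Lemma nots_fits n m : layer_fits (nseq n NOT) n m.
Proof. by elim: n m => //= n IH m; rewrite subn1 IH. Qed.

Lemma nots_outs ins prev : layer_outs (nseq (size ins) NOT) ins prev = [:: rev prev ++ map negb ins].
Proof.
elim: ins prev => [|x ins IH] prev; first by rewrite cats0.
by case: x; rewrite /= drop0 IH cats0 rev_cons cat_rcons.
Qed.

Lemma qrun_front ops ins rest q' : layer_fits ops (size ins) 0 ->
  qrun ops (ins ++ rest) q' <-> exists2 outs, outs \in layer_outs ops ins [::] & q' = rest ++ outs.
Proof. by move=> fit; rewrite -(@qrun_layer ops ins rest [::]) // cats0. Qed.

Lemma qrun_nots ins rest n q' : size ins = n ->
  qrun (nseq n NOT) (ins ++ rest) q' <-> q' = rest ++ map negb ins.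
Proof.
move=> <-; rewrite qrun_front ?nots_fits // nots_outs /=; split=> [[outs]|->].
  by rewrite inE => /eqP ->.
by exists (map negb ins); rewrite ?inE.
Qed.

Lemma nots_qfits n r : qfits (nseq n NOT) (n + r) = Some (n + r).
Proof.
have := @layer_qfits (nseq n NOT) n r 0 (nots_fits _ _).
by rewrite !addn0 size_nseq addnC => ->; rewrite addnC.
Qed.

(** One full turn of the queue, after which the entries are again in their order; those outside the
    block have been negated by the move. *)
Definition frame p q (l : seq op) : seq op := nseq p NOT ++ l ++ nseq q NOT.

Lemma qrun_frame l (B0 B B1 : seq bool) q' : layer_fits l (size B) 0 ->
  qrun (frame (size B0) (size B1) l) (B0 ++ B ++ B1) q' <->
  exists2 outs, outs \in layer_outs l B [::] & q' = map negb B0 ++ outs ++ map negb B1.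
Proof.
move=> fit; rewrite /frame qrun_cat; split=> [[q1]|[outs oo ->]].
  rewrite qrun_nots // => -> /qrun_cat[q2]; rewrite -catA qrun_front // => -[outs oo ->].
  by rewrite -catA qrun_nots // => ->; exists outs; rewrite // catA.
exists ((B ++ B1) ++ map negb B0); first by rewrite qrun_nots.
apply/qrun_cat; exists ((B1 ++ map negb B0) ++ outs); first by rewrite -catA qrun_front //; exists outs; rewrite // -catA.
by rewrite -catA qrun_nots // catA.
Qed.

Lemma frame_qfits p q l n : layer_fits l n 0 -> qfits (frame p q l) (p + n + q) = Some (p + size l + q).
Proof.
move=> fit; rewrite /frame !qfits_cat -addnA nots_qfits /=.
rewrite (_ : p + (n + q) = n + (p + q) + 0); last by lia.
rewrite qfits_cat layer_qfits //= (_ : p + q + 0 + size l = q + (p + size l)); last by lia.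
by rewrite nots_qfits; congr Some; lia.
Qed.

Definition gadget_outs (g : seq (seq op)) (B : seq bool) : seq (seq bool) :=
  foldl (fun bs l => flatten [seq layer_outs l b [::] | b <- bs]) [:: B] g.

Fixpoint gadget_fits (g : seq (seq op)) (n : nat) : bool :=
  if g is l :: g' then layer_fits l n 0 && gadget_fits g' (size l) else true.

Lemma size_layer_outs l ins prev outs : outs \in layer_outs l ins prev -> size outs = size prev + size l.
Proof.
elim: l ins prev => [|o l IH] ins prev /=; first by rewrite inE => /eqP ->; rewrite size_rev addn0.
by move=> /flatten_mapP[b _ /IH ->] /=; rewrite addnS.
Qed.

Lemma gadget_outs_cons l g B outs : outs \in gadget_outs (l :: g) B <->
  exists2 B', B' \in layer_outs l B [::] & outs \in gadget_outs g B'.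
Proof.
rewrite /gadget_outs /= cats0.
have gen bs : outs \in foldl (fun bs l => flatten [seq layer_outs l b [::] | b <- bs]) bs g <->
    exists2 B', B' \in bs & outs \in foldl (fun bs l => flatten [seq layer_outs l b [::] | b <- bs]) [:: B'] g.
  elim: g bs => [|l' g IH] bs /=.
    by split=> [H|[B' ? ]]; [exists outs; rewrite ?inE|rewrite inE => /eqP ->].
  rewrite IH; split=> [[B' /flatten_mapP[b bb H] H']|[b bb]].
    by exists b => //; rewrite cats0; apply/IH; exists B'.
  by rewrite cats0 => /IH[B' H H']; exists B' => //; apply/flatten_mapP; exists b.
exact: gen.
Qed.

Definition gadget_ops p q (g : seq (seq op)) : seq op := flatten [seq frame p q l | l <- g].

Lemma qrun_gadget g (B0 B B1 : seq bool) q' : gadget_fits g (size B) ->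
  qrun (gadget_ops (size B0) (size B1) g) (B0 ++ B ++ B1) q' <->
  exists2 outs, outs \in gadget_outs g B &
    q' = map (addb (odd (size g))) B0 ++ outs ++ map (addb (odd (size g))) B1.
Proof.
elim: g B0 B B1 => [|l g IH] B0 B B1 /=.
  move=> _; rewrite !map_id; split=> [->|[outs]]; first by exists B; rewrite ?inE.
  by rewrite inE => /eqP ->.
case/andP=> fit fits; rewrite /gadget_ops /= qrun_cat.
have neg (s : seq bool) : map (addb (odd (size g))) (map negb s) = map (addb (~~ odd (size g))) s.
  by rewrite -map_comp; apply: eq_map => b /=; rewrite addbN addNb.
have IH' B' : B' \in layer_outs l B [::] -> qrun (gadget_ops (size B0) (size B1) g) (map negb B0 ++ B' ++ map negb B1) q' <->
   exists2 outs, outs \in gadget_outs g B' & q' = map (addb (~~ odd (size g))) B0 ++ outs ++ map (addb (~~ odd (size g))) B1.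
  move=> HB; have := IH (map negb B0) B' (map negb B1); rewrite !size_map !neg; apply.
  by rewrite (size_layer_outs HB).
split=> [[q1 /(qrun_frame _ _ _ fit)[B' HB ->] /(IH' _ HB)[outs oo Eq]]|[outs /gadget_outs_cons[B' HB oo] Eq]].
  by exists outs => //; apply/gadget_outs_cons; exists B'.
exists (map negb B0 ++ B' ++ map negb B1); first by apply/qrun_frame => //; exists B'.
by apply/IH' => //; exists outs.
Qed.

Lemma gadget_qfits g p q n : gadget_fits g n ->
  qfits (gadget_ops p q g) (p + n + q) = Some (p + last n (map size g) + q).
Proof.
elim: g n => //= l g IH n /andP[fit fits].
by rewrite /gadget_ops /= qfits_cat frame_qfits //= IH.
Qed.

Definition par p q (g : seq (seq op)) := map (frame p q) g.

(* Layers of gates negate or not according to the parity of their number; this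
   gadget negates [a] in an even number of layers.  The first one guesses [g]
   with [g <= a] next to [~~ a], and the second forces [g || ~~ a], so [g = a]
   and both [a] and its negation live on the same layer. *)
Definition g_not := [:: [:: NOT; op_excl]; [:: op_or; NOT]; [:: op_nor 2]; [:: NOT]].
Definition g_and := [:: [:: op_nand 2]; [:: NOT]].
Definition g_or := [:: [:: op_nor 2]; [:: NOT]].
Definition g_dup := [:: [:: op_not 0; NOT]; [:: NOT; NOT]].
Definition g_mid := [:: [:: op_not 0; op_nand 1; NOT]; [:: NOT; NOT; NOT]].
(* With [n] the conjunction of the inputs, in the middle, [a] xor [b] is
   [(a && ~~ n) || (~~ n && b)]. *)
Definition g_xor := g_mid ++ par 1 1 g_not ++ par 1 1 g_dup ++ par 0 2 g_and ++ par 1 0 g_and ++ g_or.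
(** The planar crossover made of three exclusive ors: with [x] the xor of [a] and [b], the xor of
    [a] and [x] is [b], and that of [x] and [b] is [a]. *)
Definition g_swap := par 0 1 g_dup ++ par 2 0 g_dup ++ par 1 1 g_xor ++ par 1 1 g_dup ++
  par 0 2 g_xor ++ par 1 0 g_xor.
(** The input is the accumulator followed by the variable. After the swap, a copy of the variable,
    or of its negation in [g_neg], is or-ed into the accumulator. *)
Definition g_pos := g_swap ++ par 0 1 g_dup ++ par 1 0 g_or.
Definition g_neg := g_swap ++ par 0 1 g_dup ++ par 1 1 g_not ++ par 1 0 g_or.

Definition literal_gadget (m s : bool) := if m then (if s then g_pos else g_neg) else g_swap.

Lemma literal_gadget_outs m s acc x :
  undup (gadget_outs (literal_gadget m s) [:: acc; x]) = [:: [:: x; acc || m && (x == s)]].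
Proof. by move: m s acc x => [] [] [] []; vm_compute. Qed.

(** The number of layers is even, so all other variables come out unchanged. *)
Lemma literal_gadget_fits m s : [&& gadget_fits (literal_gadget m s) 2, ~~ odd (size (literal_gadget m s)) &
   last 2 (map size (literal_gadget m s)) == 2].
Proof. by move: m s => [] []; vm_compute. Qed.

(** * Sweeping the accumulator over the variables *)

Definition literal_ops Nv (c : mclause) j : seq op :=
  gadget_ops j (Nv - j.+1) (literal_gadget (j \in c.2) c.1).

Lemma qrun_literal Nv c j (B0 B1 : seq bool) acc x q' : size B0 = j -> size B1 = Nv - j.+1 ->
  qrun (literal_ops Nv c j) (B0 ++ [:: acc, x & B1]) q' <->
  q' = rcons B0 x ++ (acc || (j \in c.2) && (x == c.1)) :: B1.
Proof.
move=> s0 s1; have /and3P[fit ev _] := literal_gadget_fits (j \in c.2) c.1.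
have := @qrun_gadget _ B0 [:: acc; x] B1 q' fit; rewrite (negbTE ev) s0 s1 => ->.
have id s : map (addb false) s = s by rewrite map_id.
have outsE outs : (outs \in gadget_outs (literal_gadget (j \in c.2) c.1) [:: acc; x]) =
    (outs == [:: x; acc || (j \in c.2) && (x == c.1)]).
  by rewrite -mem_undup literal_gadget_outs inE.
split=> [[outs]|->]; first by rewrite outsE !id => /eqP -> ->; rewrite cat_rcons.
by exists [:: x; acc || (j \in c.2) && (x == c.1)]; rewrite ?outsE // !id cat_rcons.
Qed.

Lemma literal_qfits Nv c j : j < Nv -> qfits (literal_ops Nv c j) Nv.+1 = Some Nv.+1.
Proof.
move=> lj; have /and3P[fit _ /eqP sz] := literal_gadget_fits (j \in c.2) c.1.
have -> : Nv.+1 = j + 2 + (Nv - j.+1) by lia.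
by rewrite /literal_ops gadget_qfits // sz.
Qed.

(** The sweep ends with the accumulator at the back. Negating all variables brings it to the front,
    where it is asserted and replaced by a fresh [false]; a second negation restores the variables
    and the queue. *)
Definition clause_ops Nv (c : mclause) : seq op :=
  flatten [seq literal_ops Nv c j | j <- iota 0 Nv] ++ nseq Nv NOT ++ op_assert :: nseq Nv NOT.

Lemma qrun_sweep (xs : seq bool) c (B0 B1 : seq bool) acc q' : xs = B0 ++ B1 ->
  qrun (flatten [seq literal_ops (size xs) c j | j <- iota (size B0) (size B1)]) (B0 ++ acc :: B1) q' <->
  q' = xs ++ [:: acc || has (fun j => (j \in c.2) && (nth false xs j == c.1)) (iota (size B0) (size B1))].
Proof.
elim: B1 B0 acc => [|x B1 IH] B0 acc Ex /=; first by rewrite orbF Ex cats0.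
rewrite qrun_cat.
have Ex' : xs = rcons B0 x ++ B1 by rewrite cat_rcons.
have := IH (rcons B0 x) (acc || (size B0 \in c.2) && (x == c.1)) Ex'; rewrite size_rcons => IH'.
have xE : nth false xs (size B0) = x by rewrite Ex nth_cat ltnn subnn.
have sz : size B1 = size xs - (size B0).+1 by rewrite Ex size_cat /=; lia.
rewrite xE orbA; split=> [[q1]|Eq].
  by rewrite qrun_literal // => ->; rewrite IH'.
exists (rcons B0 x ++ (acc || (size B0 \in c.2) && (x == c.1)) :: B1); first by rewrite qrun_literal.
by rewrite IH'.
Qed.

Lemma qrun_assert x q q' : qrun [:: op_assert] (x :: q) q' <-> x /\ q' = rcons q false.
Proof.
rewrite -[x :: q]/([:: x] ++ q) qrun_front //; case: x => /=; last by split=> [[]|[]].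
split=> [[outs]|[_ ->]]; first by rewrite inE => /eqP -> ->; rewrite cats1.
by exists [:: false]; rewrite ?cats1 ?inE.
Qed.

Lemma qrun_clause xs c q' : qrun (clause_ops (size xs) c) (false :: xs) q' <->
  sat_clause (size xs) (nth false xs) c /\ q' = false :: xs.
Proof.
have E : has (fun j => (j \in c.2) && (nth false xs j == c.1)) (iota 0 (size xs)) = sat_clause (size xs) (nth false xs) c.
  apply/hasP/hasP => [[j]|[j jc /andP[lj e]]]; last by exists j; rewrite ?mem_iota ?jc.
  by rewrite mem_iota => /= lj /andP[jc e]; exists j; rewrite ?lj.
have neg : map negb (map negb xs) = xs by rewrite -map_comp map_id_in // => b _ /=; rewrite negbK.
have last2 q1 : qrun (op_assert :: nseq (size xs) NOT) (sat_clause (size xs) (nth false xs) c :: map negb xs) q1 <->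
    sat_clause (size xs) (nth false xs) c /\ q1 = false :: xs.
  rewrite -cat1s qrun_cat; split=> [[q2 /qrun_assert[st ->]]|[st ->]].
    by rewrite -cats1 qrun_nots ?size_map // neg => ->.
  exists (rcons (map negb xs) false); first exact/qrun_assert.
  by rewrite -cats1 qrun_nots ?size_map // neg.
rewrite /clause_ops qrun_cat; have sw := @qrun_sweep xs c [::] xs false _ erefl.
split=> [[q1 /sw ->]|H].
  by rewrite E qrun_cat => -[q2]; rewrite qrun_nots // => ->; exact: (iffLR (last2 _)).
exists (xs ++ [:: sat_clause (size xs) (nth false xs) c]); first by apply/sw; rewrite E.
apply/qrun_cat; exists ([:: sat_clause (size xs) (nth false xs) c] ++ map negb xs); first by rewrite qrun_nots.
exact/last2.
Qed.

Lemma clause_qfits Nv c : qfits (clause_ops Nv c) Nv.+1 = Some Nv.+1.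
Proof.
rewrite /clause_ops qfits_cat.
have -> : qfits (flatten [seq literal_ops Nv c j | j <- iota 0 Nv]) Nv.+1 = Some Nv.+1.
  have : all (fun j => j < Nv) (iota 0 Nv) by apply/allP => j; rewrite mem_iota.
  by elim: (iota 0 Nv) => //= j s IH /andP[lj /IH E]; rewrite qfits_cat literal_qfits.
have E := nots_qfits Nv 1; rewrite addn1 in E.
by rewrite /= qfits_cat E /= subSS subn0 E.
Qed.

Definition cnf_ops (x : nat * seq mclause) : seq op :=
  (op_false :: nseq x.1 op_free) ++ flatten [seq clause_ops x.1 c | c <- x.2].

Lemma qrun_cnf x : (exists q, qrun (cnf_ops x) [::] q) <-> exists a, all (sat_clause x.1 a) x.2.
Proof.
case: x => Nv cls; rewrite [(_, _).1]/= [(_, _).2]/=.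
have free q n q' : qrun (nseq n op_free) q q' <-> exists2 xs, size xs = n & q' = q ++ xs.
  elim: n q => [|n IH] q /=; first by split=> [->|[xs /size0nil -> ->]]; [exists [::]|]; rewrite ?cats0.
  split=> [[b _]|[[//|b xs] [sz] Eq]].
    by rewrite drop0 => /IH[xs <- ->]; exists (b :: xs); rewrite // cat_rcons.
  by exists b => //; rewrite drop0; apply/IH; exists xs; rewrite // cat_rcons.
have ini q' : qrun (op_false :: nseq Nv op_free) [::] q' <-> exists2 xs, size xs = Nv & q' = false :: xs.
  rewrite /=; split=> [[[] //= _ /free]|H]; first by case=> xs sz ->; exists xs.
  by exists false => //; apply/free.
have cl xs q' s : size xs = Nv -> qrun (flatten [seq clause_ops Nv c | c <- s]) (false :: xs) q' <->
    all (sat_clause Nv (nth false xs)) s /\ q' = false :: xs.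
  move=> sz; elim: s => [|c s IH] /=; first by split=> [->|[]].
  rewrite qrun_cat -sz; split=> [[q1 /qrun_clause[st ->]]|[/andP[st al] Eq]].
    by rewrite sz IH -sz st => -[-> ->].
  by exists (false :: xs); [apply/qrun_clause|rewrite sz IH -sz].
rewrite /cnf_ops; split=> [[q' /qrun_cat[q1 /ini[xs sz ->] /(cl _ _ _ sz)[al _]]]|[a al]].
  by exists (nth false xs).
have sz : size (mkseq a Nv) = Nv by rewrite size_mkseq.
exists (false :: mkseq a Nv); apply/qrun_cat; exists (false :: mkseq a Nv).
  by apply/ini; exists (mkseq a Nv).
apply/cl => //; split=> //; apply: sub_all al => c /hasP[v vc /andP[lv e]].
by apply/hasP; exists v => //; rewrite lv nth_mkseq.
Qed.

Lemma cnf_qfits x : qfits (cnf_ops x) 0 != None.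
Proof.
case: x => Nv cls; rewrite /cnf_ops qfits_cat.
have -> : qfits (op_false :: nseq Nv op_free) 0 = Some Nv.+1.
  by rewrite /= subn0 -[Nv.+1]addn1; elim: Nv 1 => //= n IH m; rewrite subn0 IH addnS.
by rewrite /=; elim: cls => //= c s IH; rewrite qfits_cat clause_qfits.
Qed.

Lemma cnf_op_form x : all op_form (cnf_ops x).
Proof.
case: x => Nv cls; have nsq n o : op_form o -> all op_form (nseq n o).
  by move=> fo; rewrite all_nseq fo orbT.
rewrite /cnf_ops all_cat [all _ (_ :: _)]/= nsq //=; apply/allP => o /flatten_mapP[c _]; move: o; apply/allP.
rewrite /clause_ops !all_cat /= !nsq // !andbT; apply/allP => o /flatten_mapP[j _]; move: o; apply/allP.
have : all (all op_form) (literal_gadget (j \in c.2) c.1) by case: (j \in c.2); case: (c.1).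
move=> /allP H; apply/allP => o /flatten_mapP[l lg]; move: o; apply/allP.
by rewrite /frame !all_cat !nsq // andbT /= H.
Qed.

Definition cnf_instance x := op_instance (cnf_ops x).

Theorem cnf_instance_correct (R : realType) x : 1 < x.1 ->
  linked_planar_3SAT R monotone_cnf (cnf_instance x) <-> exists a, all (sat_clause x.1 a) x.2.
Proof.
move=> gt1; rewrite -qrun_cnf; apply: op_instance_correct; [exact: cnf_op_form|exact: cnf_qfits|].
by rewrite size_cat /= size_nseq; lia.
Qed.

Lemma pt_cnf_instance : pt cnf_instance.
Proof.
have pg : pt (fun u : bool * bool => literal_gadget u.1 u.2).
  by rewrite /literal_gadget; pts; [exact: pt_fst pt_id|exact: pt_snd pt_id].
apply: (pt_comp (f := cnf_ops)) pt_op_instance.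
rewrite /cnf_ops /clause_ops /literal_ops /gadget_ops /frame; pts.
apply: (pt_comp (f := fun u : nat * seq mclause * mclause * nat => (u.2 \in u.1.2.2, u.1.2.1))) pg.
by pts.
Qed.

(** * From machines to monotone CNF *)

Lemma all_flatten_map (S T : Type) (P : pred T) (f : S -> seq T) s :
  all P (flatten [seq f x | x <- s]) = all (fun x => all P (f x)) s.
Proof. by elim: s => //= x s <-; rewrite all_cat. Qed.

Lemma all_iotaP n (P : pred nat) : reflect (forall i, i < n -> P i) (all P (iota 0 n)).
Proof.
apply: (iffP allP) => H i; last by rewrite mem_iota; exact: H.
by move=> li; apply: H; rewrite mem_iota.
Qed.

Lemma sat_pos N a (s : seq nat) : all (fun v => v < N) s -> sat_clause N a (true, s) = has a s.
Proof. by move=> /allP H; apply: eq_in_has => v /H /= ->; rewrite eqb_id. Qed.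

Lemma sat_neg N a (s : seq nat) : all (fun v => v < N) s -> sat_clause N a (false, s) = ~~ all a s.
Proof. by move=> /allP H; rewrite -has_predC; apply: eq_in_has => v /H /= ->; rewrite eqbF_neg. Qed.

Section Tableau.
Variable M : ntm.
Local Notation K := (tm_tapes M).+1.
Local Notation X := (option (bool + tm_sym M)).
Local Notation reads := {ffun 'I_K -> X}.
(* State, symbols read and chosen transition; [None] is an idle step. *)
Local Notation Y := (tm_state M * reads * option (tm_state M * {ffun 'I_K -> X * move}))%type.

Definition next_state (y : Y) : tm_state M := if y.2 is Some qa then qa.1 else y.1.1.
Definition act (y : Y) (i : 'I_K) : X * move := if y.2 is Some qa then qa.2 i else (y.1.2 i, MoveStay).
(** Idling is allowed at any time, as it does not change the configuration; only the last row must
    show a halting accepting state. *)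
Definition valid_act (y : Y) : bool := if y.2 is Some qa then qa \in tm_trans y.1.1 y.1.2 else true.
Definition final_act (y : Y) : bool :=
  [&& y.2 == None, tm_trans y.1.1 y.1.2 == finset.set0 & tm_accept y.1.1].

Definition tape_at c (t : tape (bool + tm_sym M)) p : X :=
  if p == c then thead t else if c < p then nth None (tright t) (p - c.+1) else nth None (tleft t) (c - p.+1).

(* Positions are relative to the head, which stays at [c]; the entry at [p.+1]
   after the move was at [p + shift m] before. *)
Definition shift (m : move) : nat := match m with MoveLeft => 0 | MoveStay => 1 | MoveRight => 2 end.

Lemma tape_at_act c t (s : X) m p : tape_at c (tape_act t (s, m)) p.+1 =
  if p + shift m == c then s else tape_at c t (p + shift m).
Proof.
rewrite /tape_at; case: m => /=; rewrite ?addn0 ?addn1 ?addn2.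
- have [<-|ne] := eqVneq p c; first by rewrite ltnSn subnn; case: ltngtP => //; lia.
  case: (ltngtP p.+1 c) => h.
  + by rewrite ifF ?nth_behead; [congr nth; lia|lia].
  + by rewrite ifT; [rewrite subSS; have -> : p - c = (p - c.+1).+1 by lia|lia].
  + by rewrite -h ltnNge leqnSn /= subnn nth0.
- by case: ltngtP.
- case: (ltngtP p.+1 c) => h.
  + case: (ltngtP p.+2 c) => h2; [|lia|].
    * by rewrite (_ : c - p.+2 = (c - p.+3).+1) //; lia.
    * by rewrite h2 subnn.
  + case: (ltngtP p.+2 c) => h2; [lia| |lia].
    by rewrite nth_behead; congr nth; lia.
  + by rewrite -h gtn_eqF // ltnSn subnn nth0.
Qed.

Definition init_cell T (w : seq bool) (i p : nat) : X :=
  if (i == 0) && (T.+1 <= p) then nth None [seq Some (inl b) | b <- w] (p - T.+1) else None.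

Lemma init_tape_at T w (i : 'I_K) p : tape_at T.+1 (ctapes (init M w) i) p = init_cell T w i p.
Proof.
have nil q : nth None [::] q = None :> X by rewrite nth_nil.
rewrite ffunE /init_cell /tape_at -(inj_eq val_inj) /=.
case: (val i == 0) => /=; last by rewrite !nil; case: ifP => //; case: ifP.
rewrite nil; case: (ltngtP p T.+1) => h; rewrite ?nth0 //.
  by rewrite nth_behead; congr nth; lia.
by rewrite h subnn nth0.
Qed.

(** Border cells of later rows are unconstrained, so wrong values may spread inwards by one cell per
    step. With the head at [T.+1] in a window of [T + T + 3] cells they cannot reach it within [T]
    steps. *)
Definition tableau T (w : seq bool) (cell : nat -> 'I_K -> nat -> X) (y : nat -> Y) : Prop :=
  [/\ forall i p, p < T + T + 3 -> cell 0 i p = init_cell T w i p,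
      forall t, t <= T -> [&& valid_act (y t), (t == 0) ==> ((y t).1.1 == tm_start M) & (t == T) ==> final_act (y t)],
      forall t i, t <= T -> cell t i T.+1 = (y t).1.2 i,
      forall t, t < T -> (y t.+1).1.1 = next_state (y t) &
      forall t i p, t < T -> p < T + T + 1 -> cell t.+1 i p.+1 =
        if p + shift (act (y t) i).2 == T.+1 then (act (y t) i).1 else cell t i (p + shift (act (y t) i).2)].

Definition act_config (y : Y) (cf : config M) : config M :=
  Config (next_state y) [ffun i => tape_act (ctapes cf i) (act y i)].

Definition config_reads (cf : config M) : reads := [ffun i => thead (ctapes cf i)].

Definition idle (cf : config M) : Y := (cstate cf, config_reads cf, None).

Lemma act_idle cf : act_config (idle cf) cf = cf.
Proof.
case: cf => q tp; rewrite /act_config /idle /=; congr Config; apply/ffunP => i.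
by rewrite ffunE /act /= ffunE /tape_act /=; case: (tp i).
Qed.

Lemma reach_rcons n (c d e : config M) : reach n c d -> step d e -> reach n.+1 c e.
Proof.
elim: n c => [|n IH] c /=; first by move=> -> ?; exists e.
by case=> c' st /IH H /H; exists c'.
Qed.

Lemma haltedE (cf : config M) : halted cf <-> tm_trans (cstate cf) (config_reads cf) = finset.set0.
Proof.
split=> [H|E d [qa]]; last by rewrite -/(config_reads cf) E inE.
apply/finset.setP => qa; rewrite !inE; apply/negP => qin.
by apply: (H (Config qa.1 [ffun i => tape_act (ctapes cf i) (qa.2 i)])); exists qa.
Qed.

Lemma tableau_accepts T w cell y : tableau T w cell y ->
  exists n c, [/\ reach n (init M w) c, halted c & tm_accept (cstate c)].
Proof.
case=> h0 hv hr hs hm.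
(* The part of row [t] that is still reliable is [t <= p <= T + T + 2 - t]. The step count [n] may
   be smaller than [t] because of idle steps. *)
have inv t : t <= T -> exists n cf, [/\ reach n (init M w) cf, cstate cf = (y t).1.1 &
    forall i p, t <= p -> p + t <= T + T + 2 -> cell t i p = tape_at T.+1 (ctapes cf i) p].
  elim: t => [|t IH] lt.
    have /and3P[_ /eqP q0 _] := hv 0 lt.
    exists 0, (init M w); split=> // i p _ lp; rewrite init_tape_at h0 //; lia.
  have [n [cf [rc qc cc]]] := IH (ltnW lt).
  have rd : (y t).1.2 = config_reads cf.
    apply/ffunP => i; rewrite ffunE -hr ?(ltnW lt) // cc; [|lia|lia].
    by rewrite /tape_at eqxx.
  have new i p : t.+1 <= p -> p + t.+1 <= T + T + 2 -> cell t.+1 i p = tape_at T.+1 (tape_act (ctapes cf i) (act (y t) i)) p.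
    case: p => // p; move=> l1 l2; rewrite hm //; last by lia.
    rewrite (surjective_pairing (act (y t) i)) tape_at_act /=; case: ifP => // _.
    by apply: cc; case: (act (y t) i).2 => /=; lia.
  have /and3P[vy _ _] := hv t (ltnW lt); rewrite /valid_act in vy.
  have nq := hs t lt.
  case Ey : (y t).2 vy => [qa|] vy.
    exists n.+1, (act_config (y t) cf); split.
    - apply: reach_rcons rc _; exists qa; first by rewrite -/(config_reads cf) -rd qc.
      rewrite /act_config /next_state Ey; congr Config; apply/ffunP => i; rewrite !ffunE.
      by rewrite /act Ey.
    - by rewrite nq.
    - by move=> i p l1 l2; rewrite ffunE new.
  have yi : y t = idle cf.
    by move: Ey rd qc; case: (y t) => -[q r] [//|] /= _ -> <-.
  exists n, cf; split=> //; first by rewrite nq /next_state Ey.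
  move=> i p l1 l2; rewrite new //; congr tape_at.
  by have := act_idle cf; rewrite -yi => E; rewrite -[in RHS]E ffunE.
have [n [cf [rc qc cc]]] := inv T (leqnn T).
have /and3P[_ _] := hv T (leqnn T); rewrite eqxx /= => /and3P[_ /eqP tr ac].
exists n, cf; split=> //; last by rewrite qc.
apply/haltedE; rewrite qc -tr; congr tm_trans; apply/ffunP => i.
by rewrite ffunE -hr // cc; [rewrite /tape_at eqxx|lia|lia].
Qed.

(** A finite run is prolonged by idle steps, so that it fills a tableau of any greater height. *)
Lemma reach_path n (c d : config M) : reach n c d ->
  exists (cf : nat -> config M) (y : nat -> Y), [/\ cf 0 = c,
    forall t, [/\ valid_act (y t), (y t).1 = (cstate (cf t), config_reads (cf t)) & cf t.+1 = act_config (y t) (cf t)] &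
    forall t, n <= t -> cf t = d /\ y t = idle d].
Proof.
elim: n c => [|n IH] c /=.
  move=> ->; exists (fun=> c), (fun=> idle c); split=> // t; split=> //.
  by rewrite act_idle.
case=> c' [qa qin Ec'] /IH[cf [y [c0 st fin]]].
exists (fun t => if t is t'.+1 then cf t' else c).
exists (fun t => if t is t'.+1 then y t' else (cstate c, config_reads c, Some qa)); split=> //.
  case=> [|t]; last exact: st.
  by split=> //; rewrite c0 Ec'.
by case.
Qed.

Lemma accepts_tableau T w n (c : config M) : reach n (init M w) c -> halted c -> tm_accept (cstate c) ->
  n <= T -> exists cell y, tableau T w cell y.
Proof.
move=> /reach_path[cf [y [c0 st fin]]] /haltedE hc ac nT.
exists (fun t i p => tape_at T.+1 (ctapes (cf t) i) p), y; split.
- by move=> i p _; rewrite c0 init_tape_at.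
- move=> t tT; have [vy Ey _] := st t; rewrite vy Ey /=; apply/andP; split.
    by apply/implyP => /eqP ->; rewrite c0.
  apply/implyP => /eqP Et; have [_ ->] := fin t (leq_trans nT (eq_leq (esym Et))).
  by rewrite /final_act /= hc eqxx.
- by move=> t i tT; have [_ -> _] := st t; rewrite /tape_at eqxx ffunE.
- by move=> t tT; have [_ -> _] := st t.+1; have [_ _ ->] := st t.
- move=> t i p tT lp; have [_ _ ->] := st t; rewrite ffunE.
  by rewrite {1}(surjective_pairing (act (y t) i)) tape_at_act.
Qed.

(** * Variables and clauses of the tableau *)

Definition rX (v : X) : nat := enum_rank v.
Definition rY (y : Y) : nat := enum_rank y.
Definition width T := T + T + 3.
Definition groups T := K * width T + 1.
Definition radix := #|{: X}| + #|{: Y}|.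

(** A number with three digits. Group [K * width T] stands for the action, the smaller ones for
    cells; [radix] exceeds the ranks of both symbols and actions. *)
Definition var T t g v := (t * groups T + g) * radix + v.
Definition cell_var T t i p v := var T t (i * width T + p) v.
Definition act_var T t v := var T t (K * width T) v.
(** The two extra variables guarantee the lower bound [1 < x.1] of [cnf_instance_correct]. *)
Definition nvar T := (T.+1 * groups T * radix).+2.

Lemma rX_lt v : rX v < radix.
Proof. by apply: leq_trans (ltn_ord _) (leq_addr _ _). Qed.

Lemma rY_lt y : rY y < radix.
Proof. by apply: leq_trans (ltn_ord _) (leq_addl _ _). Qed.

Lemma mixed_radix_inj n a b a' b' : b < n -> b' < n -> a * n + b = a' * n + b' -> a = a' /\ b = b'.
Proof.
move=> l l' E; have n0 : 0 < n by lia.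
have := f_equal (fun x => x %/ n) E; rewrite !divnMDl // !divn_small // !addn0 => Ea.
by split=> //; move: E; rewrite Ea => /addnI.
Qed.

Lemma mixed_radix_lt n m a b : a < m -> b < n -> a * n + b < m * n.
Proof. by move=> la lb; apply: (@leq_trans (a.+1 * n)); rewrite ?leq_mul2r ?la ?orbT // mulSn addnC ltn_add2r. Qed.

Lemma var_inj T t g v t' g' v' : g < groups T -> g' < groups T -> v < radix -> v' < radix ->
  var T t g v = var T t' g' v' -> [/\ t = t', g = g' & v = v'].
Proof.
by move=> lg lg' lv lv' /(mixed_radix_inj lv lv')[/(mixed_radix_inj lg lg')[-> ->] ->].
Qed.

Lemma cell_group_lt T (i : 'I_K) p : p < width T -> i * width T + p < K * width T.
Proof. exact: mixed_radix_lt. Qed.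

Lemma cell_var_inj T t (i : 'I_K) p v t' (i' : 'I_K) p' v' : p < width T -> p' < width T ->
  cell_var T t i p (rX v) = cell_var T t' i' p' (rX v') -> [/\ t = t', i = i', p = p' & v = v'].
Proof.
move=> lp lp' /var_inj[]; rewrite ?rX_lt //; try by rewrite /groups addn1 ltnS ltnW // cell_group_lt.
by move=> -> /(mixed_radix_inj lp lp')[/val_inj -> ->] /val_inj/enum_rank_inj ->.
Qed.

Lemma act_var_inj T t y t' y' : act_var T t (rY y) = act_var T t' (rY y') -> t = t' /\ y = y'.
Proof.
move=> /var_inj[]; rewrite ?rY_lt ?/groups ?addn1 //.
by move=> -> _ /val_inj/enum_rank_inj ->.
Qed.

Lemma cell_act_var T t (i : 'I_K) p v t' y : p < width T -> cell_var T t i p (rX v) <> act_var T t' (rY y).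
Proof.
move=> lp /var_inj[]; rewrite ?rX_lt ?rY_lt ?/groups ?addn1 ?ltnS ?(ltnW (cell_group_lt i lp)) //.
by move=> _ E _; have := cell_group_lt i lp; rewrite E ltnn.
Qed.

Lemma var_lt T t g v : t <= T -> g < groups T -> v < radix -> var T t g v < nvar T.
Proof.
move=> lt lg lv; rewrite /nvar /var; apply: (@leq_trans (T.+1 * groups T * radix)); last by lia.
by apply: mixed_radix_lt => //; apply: mixed_radix_lt.
Qed.

Lemma cell_var_lt T t (i : 'I_K) p v : t <= T -> p < width T -> cell_var T t i p (rX v) < nvar T.
Proof. by move=> lt lp; apply: var_lt; rewrite ?rX_lt // /groups addn1 ltnS ltnW // cell_group_lt. Qed.

Lemma act_var_lt T t y : t <= T -> act_var T t (rY y) < nvar T.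
Proof. by move=> lt; apply: var_lt; rewrite ?rY_lt // /groups addn1. Qed.

(** Mentions only the ranks of three symbols, as constants, which makes it a polynomial-time
    function of the word. *)
Definition init_rank T (w : seq bool) (i p : nat) : nat :=
  if (i == 0) && (T.+1 <= p) then nth (rX None) [seq if b then rX (Some (inl true)) else rX (Some (inl false)) | b <- w] (p - T.+1)
  else rX None.

Lemma init_rankE T w i p : init_rank T w i p = rX (init_cell T w i p).
Proof.
rewrite /init_rank /init_cell; case: ifP => // _; elim: w (p - T.+1) => [|b w IH] [|k] //=.
by case: b.
Qed.

(** This table and the following ones depend on the machine alone, so for the reduction they are
    constants. *)
Definition act_list (b0 b1 : bool) : seq nat :=
  [seq rY y | y <- enum {: Y} & [&& valid_act y, b0 ==> (y.1.1 == tm_start M) & b1 ==> final_act y]].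

Definition read_conflicts : seq (nat * (nat * nat)) :=
  [seq (val e.1.1, (rY e.1.2, rX e.2)) | e <- [seq e : 'I_K * Y * X <- enum {: 'I_K * Y * X} | e.2 != e.1.2.1.2 e.1.1]].

Definition state_conflicts : seq (nat * nat) :=
  [seq (rY e.1, rY e.2) | e <- enum {: Y * Y} & e.2.1.1 != next_state e.1].

Definition move_entries : seq (nat * (nat * (nat * (nat * (nat * nat))))) :=
  [seq (val e.1.1.1, (shift (act e.1.1.2 e.1.1.1).2, (rY e.1.1.2, (rX e.1.2, (rX e.2, rX (act e.1.1.2 e.1.1.1).1)))))
  | e <- enum {: 'I_K * Y * X * X}].

Definition init_clauses T w : seq mclause :=
  flatten [seq [seq (true, [:: cell_var T 0 i p (init_rank T w i p)]) | p <- iota 0 (width T)] | i <- iota 0 K].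
Definition cell_clauses T : seq mclause :=
  flatten [seq flatten [seq [seq (true, [seq cell_var T t.+1 i p v | v <- map rX (enum {: X})]) | p <- iota 0 (width T)]
     | i <- iota 0 K] | t <- iota 0 T].
Definition act_clauses T : seq mclause :=
  [seq (true, [seq act_var T t v | v <- if t == 0 then (if t == T then act_list true true else act_list true false)
     else (if t == T then act_list false true else act_list false false)]) | t <- iota 0 T.+1].
Definition read_clauses T : seq mclause :=
  flatten [seq [seq (false, [:: act_var T t e.2.1; cell_var T t e.1 T.+1 e.2.2]) | e <- read_conflicts] | t <- iota 0 T.+1].
Definition state_clauses T : seq mclause :=
  flatten [seq [seq (false, [:: act_var T t e.1; act_var T t.+1 e.2]) | e <- state_conflicts] | t <- iota 0 T].
Definition move_clauses T : seq mclause :=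
  flatten [seq flatten [seq [seq (false, [:: act_var T t e.2.2.1; cell_var T t e.1 (p + e.2.1) e.2.2.2.1;
        cell_var T t.+1 e.1 p.+1 e.2.2.2.2.1])
     | e <- [seq e <- move_entries | ~~ (e.2.2.2.2.1 == if p + e.2.1 == T.+1 then e.2.2.2.2.2 else e.2.2.2.1)]]
     | p <- iota 0 (T + T + 1)] | t <- iota 0 T].

Definition tableau_clauses T w : seq mclause :=
  init_clauses T w ++ cell_clauses T ++ act_clauses T ++ read_clauses T ++ state_clauses T ++ move_clauses T.

Section Meaning.
Variables (T : nat) (w : seq bool) (a : nat -> bool).
Local Notation sat := (all (sat_clause (nvar T) a)).
Local Notation C t i p v := (a (cell_var T t i p (rX v))).
Local Notation D t y := (a (act_var T t (rY y))).

Lemma all_tapes (P : pred nat) : reflect (forall i : 'I_K, P i) (all P (iota 0 K)).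
Proof.
apply: (iffP (all_iotaP _ _)) => H i => [|li]; first exact: H.
by have := H (Ordinal li).
Qed.

Lemma sat_init : sat (init_clauses T w) <-> forall (i : 'I_K) p, p < width T -> C 0 i p (init_cell T w i p).
Proof.
have E (i : 'I_K) p : p < width T ->
    sat_clause (nvar T) a (true, [:: cell_var T 0 i p (init_rank T w i p)]) = C 0 i p (init_cell T w i p).
  by move=> lp; rewrite init_rankE sat_pos /= ?orbF // cell_var_lt.
rewrite all_flatten_map; split=> [/all_tapes H i p lp|H].
  by have := H i; rewrite all_map => /all_iotaP/(_ p lp); rewrite /= E.
by apply/all_tapes => i; rewrite all_map; apply/all_iotaP => p lp; rewrite /= E // H.
Qed.

Lemma sat_cell : sat (cell_clauses T) <->
  forall t (i : 'I_K) p, t < T -> p < width T -> exists v, C t.+1 i p v.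
Proof.
have E t (i : 'I_K) p : t < T -> p < width T ->
    sat_clause (nvar T) a (true, [seq cell_var T t.+1 i p v | v <- map rX (enum {: X})]) = [exists v, C t.+1 i p v].
  move=> lt lp; rewrite sat_pos; last by apply/allP => _ /mapP[_ /mapP[v _ ->] ->]; apply: cell_var_lt.
  rewrite !has_map; apply/hasP/existsP => [[v _ H]|[v H]]; first by exists v.
  by exists v; rewrite ?mem_enum.
rewrite all_flatten_map; split=> [/all_iotaP H t i p lt lp|H].
  have := H t lt; rewrite all_flatten_map => /all_tapes/(_ i); rewrite all_map => /all_iotaP/(_ p lp).
  by rewrite /= E // => /existsP.
apply/all_iotaP => t lt; rewrite all_flatten_map; apply/all_tapes => i; rewrite all_map.
by apply/all_iotaP => p lp; rewrite /= E //; apply/existsP/H.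
Qed.

Lemma sat_act : sat (act_clauses T) <-> forall t, t <= T -> exists2 y : Y,
  [&& valid_act y, (t == 0) ==> (y.1.1 == tm_start M) & (t == T) ==> final_act y] & D t y.
Proof.
have E t : t <= T -> sat_clause (nvar T) a (true, [seq act_var T t v | v <- act_list (t == 0) (t == T)]) =
    [exists y : Y, [&& valid_act y, (t == 0) ==> (y.1.1 == tm_start M) & (t == T) ==> final_act y] && D t y].
  move=> lt; rewrite sat_pos; last by apply/allP => _ /mapP[_ /mapP[y _ ->] ->]; apply: act_var_lt.
  rewrite /act_list !has_map; apply/hasP/existsP => [[y]|[y /andP[H1 H2]]].
    by rewrite mem_filter => /andP[H1 _] H2; exists y; rewrite H1.
  by exists y; rewrite // mem_filter H1 mem_enum.
have E' t : (if t == 0 then (if t == T then act_list true true else act_list true false)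
     else (if t == T then act_list false true else act_list false false)) = act_list (t == 0) (t == T).
  by case: (t == 0); case: (t == T).
rewrite all_map; split=> [/all_iotaP H t lt|H].
  by have := H t lt; rewrite /= E' E // => /existsP[y /andP[]]; exists y.
by apply/all_iotaP => t lt; rewrite /= E' E //; apply/existsP; have [y H1 H2] := H t lt; exists y; rewrite H1.
Qed.

Lemma sat_read : sat (read_clauses T) <->
  forall t (i : 'I_K) y v, t <= T -> D t y -> C t i T.+1 v -> v = y.1.2 i.
Proof.
have cw : T.+1 < width T by rewrite /width; lia.
rewrite all_flatten_map; split=> [/all_iotaP H t i y v lt Dy Cv|H].
  apply/eqP/negPn/negP => ne; have := H t lt; rewrite all_map => /allP /(_ (val i, (rY y, rX v))).
  rewrite /= sat_neg /= ?act_var_lt ?cell_var_lt // Dy Cv => /(_ _) /negP; apply => //.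
  by apply/mapP; exists (i, y, v); rewrite // mem_filter /= ne mem_enum.
apply/all_iotaP => t lt; rewrite all_map; apply/allP => _ /mapP[[[i y] v] + ->] /=.
rewrite mem_filter /= => /andP[ne _]; rewrite sat_neg /= ?act_var_lt ?cell_var_lt // andbT.
by apply/negP => /andP[Dy Cv]; rewrite (H t i y v lt Dy Cv) eqxx in ne.
Qed.

Lemma sat_state : sat (state_clauses T) <->
  forall t y y', t < T -> D t y -> D t.+1 y' -> y'.1.1 = next_state y.
Proof.
rewrite all_flatten_map; split=> [/all_iotaP H t y y' lt Dy Dy'|H].
  apply/eqP/negPn/negP => ne; have := H t lt; rewrite all_map => /allP /(_ (rY y, rY y')).
  rewrite /= sat_neg /= ?act_var_lt // ?(ltnW lt) // Dy Dy' => /(_ _) /negP; apply => //.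
  by apply/mapP; exists (y, y'); rewrite // mem_filter /= ne mem_enum.
apply/all_iotaP => t lt; rewrite all_map; apply/allP => _ /mapP[[y y'] + ->] /=.
rewrite mem_filter /= => /andP[ne _]; rewrite sat_neg /= ?act_var_lt ?(ltnW lt) // andbT.
by apply/negP => /andP[Dy Dy']; rewrite (H t y y' lt Dy Dy') eqxx in ne.
Qed.

Lemma sat_move : sat (move_clauses T) <->
  forall t (i : 'I_K) p y v v', t < T -> p < T + T + 1 -> D t y -> C t i (p + shift (act y i).2) v ->
    C t.+1 i p.+1 v' -> v' = if p + shift (act y i).2 == T.+1 then (act y i).1 else v.
Proof.
have wd p m : p < T + T + 1 -> p + shift m < width T by rewrite /width; case: m => /=; lia.
have wd' p : p < T + T + 1 -> p.+1 < width T by rewrite /width; lia.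
have rXE (b : bool) v s : (if b then rX s else rX v) = rX (if b then s else v) by case: b.
have rX_eq v v' : (rX v == rX v') = (v == v') by rewrite (inj_eq val_inj) (inj_eq enum_rank_inj).
rewrite all_flatten_map; split=> [/all_iotaP H t i p y v v' lt lp Dy Cv Cv'|H].
  apply/eqP/negPn/negP => ne; have := H t lt; rewrite all_flatten_map => /all_iotaP/(_ p lp).
  rewrite all_map => /allP /(_ (val i, (shift (act y i).2, (rY y, (rX v, (rX v', rX (act y i).1)))))).
  rewrite /= sat_neg /= ?act_var_lt ?cell_var_lt ?wd ?wd' ?(ltnW lt) // Dy Cv Cv' => /(_ _) /negP; apply => //.
  rewrite mem_filter /= rXE rX_eq ne /=.
  by apply/mapP; exists (i, y, v, v'); rewrite // mem_enum.
apply/all_iotaP => t lt; rewrite all_flatten_map; apply/all_iotaP => p lp; rewrite all_map.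
apply/allP => e; rewrite mem_filter => /andP[+ /mapP[[[[i y] v] v'] _ Ee]]; rewrite Ee /= rXE rX_eq => ne.
rewrite sat_neg /= ?act_var_lt ?cell_var_lt ?wd ?wd' ?(ltnW lt) // andbT.
by apply/negP => /and3P[Dy Cv Cv']; rewrite {1}(H t i p y v v' lt lp Dy Cv Cv') eqxx in ne.
Qed.
End Meaning.

Lemma tableau_clauses_sat T w (P : pred mclause) : all P (tableau_clauses T w) =
  [&& all P (init_clauses T w), all P (cell_clauses T), all P (act_clauses T), all P (read_clauses T),
      all P (state_clauses T) & all P (move_clauses T)].
Proof.
rewrite /tableau_clauses; move: (init_clauses T w) (cell_clauses T) (act_clauses T) (read_clauses T) (state_clauses T) (move_clauses T).
by move=> *; rewrite !all_cat.
Qed.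

(** No clause forbids two values in one place: the conflicts hold for all values marked true, so any
    choice among them gives a tableau. *)
Lemma sat_tableau T w : (exists a, all (sat_clause (nvar T) a) (tableau_clauses T w)) <->
  exists cell y, tableau T w cell y.
Proof.
split=> [[a]|[cell [y [h0 hv hr hs hm]]]].
  rewrite tableau_clauses_sat => /andP[/(iffLR (@sat_init T w a)) s0 /andP[/(iffLR (@sat_cell T a)) sc
    /andP[/(iffLR (@sat_act T a)) sa /and3P[/(iffLR (@sat_read T a)) sr /(iffLR (@sat_state T a)) ss
    /(iffLR (@sat_move T a)) sm]]]].
  pose cell t (i : 'I_K) p := if t == 0 then init_cell T w i p else odflt None [pick v | a (cell_var T t i p (rX v))].
  pose ok t (y : Y) := [&& valid_act y, (t == 0) ==> (y.1.1 == tm_start M) & (t == T) ==> final_act y].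
  pose y t := odflt (idle (init M w)) [pick y | ok t y && a (act_var T t (rY y))].
  have Cc t (i : 'I_K) p : t <= T -> p < width T -> a (cell_var T t i p (rX (cell t i p))).
    case: t => [|t] lt lp; first exact: s0.
    by rewrite /cell /=; case: pickP => // N; have [v Cv] := sc t i p lt lp; rewrite N in Cv.
  have Dy t : t <= T -> ok t (y t) /\ a (act_var T t (rY (y t))).
    move=> lt; rewrite /y; case: pickP => [y' /andP[]//|N]; have [y' H1 H2] := sa t lt.
    by have := N y'; rewrite /ok H1 H2.
  have cw : T.+1 < width T by rewrite /width; lia.
  have wd p m : p < T + T + 1 -> p + shift m < width T by rewrite /width; case: m => /=; lia.
  exists cell, y; split=> //.
  - by move=> t /Dy[].
  - by move=> t i lt; have [_ H] := Dy t lt; apply: (sr t i (y t) _ lt H); exact: Cc.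
  - by move=> t lt; have [_ H] := Dy t (ltnW lt); have [_ H'] := Dy t.+1 lt; exact: ss lt H H'.
  - move=> t i p lt lp; have [_ H] := Dy t (ltnW lt); apply: (sm t i p (y t)) => //.
      by apply: Cc; [exact: ltnW|exact: wd].
    by apply: Cc => //; rewrite /width; lia.
pose a x := `[< (exists t (i : 'I_K) p, p < width T /\ x = cell_var T t i p (rX (cell t i p))) \/
  exists t, x = act_var T t (rY (y t)) >].
have Ca t (i : 'I_K) p v : p < width T -> a (cell_var T t i p (rX v)) -> v = cell t i p.
  move=> lp /asboolP[[t' [i' [p' [lp' E]]]]|[t' E]].
    by have [-> -> -> ->] := cell_var_inj lp lp' E.
  by case: (cell_act_var lp E).
have aC t (i : 'I_K) p : p < width T -> a (cell_var T t i p (rX (cell t i p))).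
  by move=> lp; apply/asboolP; left; exists t, i, p.
have Da t y' : a (act_var T t (rY y')) -> y' = y t.
  move=> /asboolP[[t' [i' [p' [lp' E]]]]|[t' /act_var_inj[-> ->] //]].
  by case: (cell_act_var lp' (esym E)).
have aD t : a (act_var T t (rY (y t))) by apply/asboolP; right; exists t.
have cw : T.+1 < width T by rewrite /width; lia.
have wd p m : p < T + T + 1 -> p + shift m < width T by rewrite /width; case: m => /=; lia.
exists a; rewrite tableau_clauses_sat; apply/and5P; split; last first; [apply/andP; split; last first| | | |].
- apply: (iffRL (@sat_move T a)) => t i p y' v v' lt lp /Da -> /(Ca _ _ _ _ (wd _ _ lp)) -> Cv'.
  by rewrite -hm //; apply: Ca Cv'; rewrite /width; lia.
- by apply: (iffRL (@sat_state T a)) => t y1 y2 lt /Da -> /Da ->; exact: hs.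
- by apply: (iffRL (@sat_read T a)) => t i y' v lt /Da -> /(Ca _ _ _ _ cw) ->; exact: hr.
- by apply: (iffRL (@sat_act T a)) => t lt; exists (y t); [exact: hv|exact: aD].
- by apply: (iffRL (@sat_cell T a)) => t i p lt lp; exists (cell t.+1 i p); exact: aC.
- by apply: (iffRL (@sat_init T w a)) => i p lp; rewrite -h0 //; exact: aC.
Qed.

Lemma pt_tableau (T : seq bool -> nat) : pt T -> pt (fun w => (nvar (T w), tableau_clauses (T w) w)).
Proof.
move=> pT.
rewrite /tableau_clauses /init_clauses /cell_clauses /act_clauses /read_clauses /state_clauses /move_clauses.
rewrite /init_rank /nvar /cell_var /act_var /var /groups /width.
(* Whatever depends only on the machine becomes an arbitrary constant. *)
move: (map rX _) act_list read_conflicts state_conflicts move_entries radix (rX None) (rX _) (rX _) => cX cA cR cS cM rx x0 x1 x2.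
by pts; exact: pt_snd pt_id.
Qed.
End Tableau.

Theorem linked_planar_NP_hard (R : realType) : NP_hard (linked_planar_3SAT R monotone_cnf).
Proof.
move=> L [M [a [b [k bound]]] LM].
pose T (w : seq bool) := a * size w ^ k + b.
have pT : pt T by rewrite /T; pts.
pose f w := cnf_instance (nvar M (T w), tableau_clauses M (T w) w).
exists f; first by apply: pt_poly_time_function; apply: (pt_comp (pt_tableau M pT)); exact: pt_cnf_instance.
move=> w; rewrite LM /f cnf_instance_correct //= sat_tableau.
split=> [[n [c [rc hc ac]]]|[cell [y tb]]]; last exact: tableau_accepts tb.
exact: accepts_tableau rc hc ac (bound _ _ _ rc).
Qed.

Theorem theorem9 (R : realType) :
  NP_complete (linked_planar_3SAT R monotone_cnf).
Proof. by split; [exact: linked_planar_in_NP|exact: linked_planar_NP_hard]. Qed.
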